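(* If $M$ is a compact, closed, connected and simply connected $3$-dimensional stellar flat manifold, then $M$ is a stellar $3$-sphere.
   Context: Topological properties of a stellar manifold mean those of its geometric realization. Simplexes are identified with their vertex sets; generators of a complex are its top-dimensional simplexes; $\star$ denotes join. Two complexes are stellar equivalent if they are related by finitely many stellar subdivisions, inverse subdivisions (welds) and vertex relabellings. A stellar $n$-ball (resp. $n$-sphere) is a complex stellar equivalent to the $n$-simplex $(1\;2\dots n+1)$ (resp. to $\partial(1\;2\dots n+2)$); a stellar $n$-manifold is a complex whose vertex links are stellar $(n-1)$-balls or $(n-1)$-spheres; it is closed if its $\mathbb{Z}_2$-boundary is zero. Stellar structure. $S$ is a stellar sphere of dimension $n=\dim M-1$ (here $n=2$), $a\notin S$ is a vertex, and $\simeq$ is a regular equivalence on $S$: a pair of equivalence relations, one on the vertices and one on the generators ($n$-simplexes) of $S$, such that (i) no generator has two vertices equivalent to each other; (ii) for any generator $g$ there is at most one generator $p\ne g$ with $p\simeq g$, and in that case any vertex of $g$ is equal or equivalent to some vertex of $p$. $a\star(S/\simeq)$ is obtained from $a\star S$ by identifying equivalent generators of $S$ while still distinguishing $a\star p$ and $a\star g$ when $p\simeq g$. For closed $M$ every generator of $S$ is equivalent to exactly one other generator. Coxeter group. Let $\mathcal G$ be the set of generators ($n$-simplexes) of $S$. The permutation $p_0$ of $\mathcal G$ sends $g$ to the unique $g'\neq g$ with $g'\simeq g$. Two $(n-1)$-simplexes of $S$ are called equivalent if they belong to equivalent $n$-simplexes of $S$ and each vertex of the first is equal or equivalent to some vertex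 of the second; $\mathcal E$ is the set of equivalence classes of $(n-1)$-simplexes (for the equivalence relation so determined). For $\alpha\in\mathcal E$ the permutation $p_\alpha$ of $\mathcal G$ is: $p_\alpha(g)=g$ if $g$ has no face in $\alpha$; otherwise $g$ has exactly one face in $\alpha$, and $p_\alpha(g)$ is the unique other $n$-simplex of $S$ containing that same $(n-1)$-simplex. $Cox(S/\simeq)$ is the group generated by $p_0$ and $\{p_\alpha\}_{\alpha\in\mathcal E}$. Flatness. A stellar manifold $M=a\star(S/\simeq)$ is called flat if, and only if, $\{1,p_0\}$ is a normal subgroup of $Cox(S/\simeq)$. *)

(* Defs.v *)
From HB Require Import structures.
From Stdlib Require Import Relation_Operators.
From mathcomp Require Import all_boot all_order all_algebra all_fingroup finmap.
From mathcomp Require Import all_classical all_reals all_analysis.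
Import numFieldNormedType.Exports.

Set Implicit Arguments.
Unset Strict Implicit.
Unset Printing Implicit Defensive.

Import Order.TTheory GRing.Theory Num.Theory.

Local Open Scope fset_scope.

(* A complex is a finite, subset-closed family of finite vertex sets.  The
   empty simplex is a member of every complex, so
   that joins, links and boundaries need no special case in low dimension. *)
Definition simplex_family := {fset {fset nat}}.

Definition is_complex (K : simplex_family) : Prop :=
  fset0 \in K /\ {in K, forall s t : {fset nat}, t `<=` s -> t \in K}.

Definition vertices (K : simplex_family) : {fset nat} := fcover K.

(* dim K + 1 *)
Definition top_card (K : simplex_family) : nat := \max_(s <- K) #|` s|.

Definition generators (K : simplex_family) : simplex_family :=
  [fset s in K | #|` s| == top_card K].

(* the simplexes of dimension dim K - 1 *)
Definition facets (K : simplex_family) : simplex_family :=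
  [fset s in K | #|` s|.+1 == top_card K].

Definition simplex (A : {fset nat}) : simplex_family := fpowerset A.

Definition simplex_bd (A : {fset nat}) : simplex_family :=
  [fset t in fpowerset A | t != A].

Definition join (K L : simplex_family) : simplex_family :=
  [fset s `|` t | s in K, t in L].

Definition cone (a : nat) (K : simplex_family) : simplex_family :=
  join (simplex [fset a]) K.

Definition link (K : simplex_family) (s : {fset nat}) : simplex_family :=
  [fset t in K | (s `&` t == fset0) && (s `|` t \in K)].

(* The Z_2-boundary: the facets lying in an odd number of generators. *)
Definition Z2_boundary (K : simplex_family) : simplex_family :=
  [fset t in facets K | odd #|` [fset g in generators K | t `<=` g]|].

Definition closed_complex (K : simplex_family) : Prop := Z2_boundary K = fset0.

(* s * link(s) + Q  |->  v * bd(s) * link(s) + Q *)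
Definition stellar_subdivision (K : simplex_family) (s : {fset nat}) (v : nat) :
  simplex_family :=
  [fset t in K | ~~ (s `<=` t)] `|` cone v (join (simplex_bd s) (link K s)).

Definition relabel (V : choiceType) (f : V -> nat) (K : {fset {fset V}}) :
  simplex_family := [fset [fset f x | x in (s : {fset V})] | s in K].

Inductive stellar_move (K : simplex_family) : simplex_family -> Prop :=
| StellarSubdivision (s : {fset nat}) (v : nat) :
    is_complex K -> s \in K -> s != fset0 -> v \notin vertices K ->
    stellar_move K (stellar_subdivision K s v)
| StellarRelabel (f : nat -> nat) :
    is_complex K -> {in vertices K &, injective f} ->
    stellar_move K (relabel f K).

Definition stellar_equiv : simplex_family -> simplex_family -> Prop :=
  clos_refl_sym_trans simplex_family stellar_move.

Definition stellar_ball (n : nat) (K : simplex_family) : Prop :=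
  stellar_equiv K (simplex [fset i in iota 1 n.+1]).

Definition stellar_sphere (n : nat) (K : simplex_family) : Prop :=
  stellar_equiv K (simplex_bd [fset i in iota 1 n.+2]).

Definition stellar_manifold (n : nat) (K : simplex_family) : Prop :=
  [/\ (0 < n)%N, is_complex K
    & {in vertices K, forall v, stellar_ball n.-1 (link K [fset v]) \/
                                stellar_sphere n.-1 (link K [fset v])}].

Section Topology.
Local Open Scope classical_set_scope.
Local Open Scope ring_scope.
Variable R : realType.

(* Barycentric coordinates.  A complex is finite, so the topology induced by
   pointwise convergence is the usual one. *)
Definition realization (K : simplex_family) : set {ptws nat -> R} :=
  [set x : {ptws nat -> R} | (forall i, 0 <= x i) /\
    exists s : {fset nat}, [/\ s \in K, forall i, i \notin s -> x i = 0
                             & \sum_(i <- s) x i = 1]].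

Variables (T : topologicalType) (A : set T).

Definition path_in (f : R -> T) : Prop :=
  {within `[0, 1], continuous f} /\ f @` `[0, 1] `<=` A.

Definition path_connected : Prop :=
  A !=set0 /\ forall x y, A x -> A y ->
    exists f : R -> T, [/\ path_in f, f 0 = x & f 1 = y].

(* H is a homotopy in A, relative to the endpoints, from f to a constant *)
Definition null_homotopic (f : R -> T) : Prop :=
  exists H : R * R -> T,
    [/\ {within `[0, 1] `*` `[0, 1], continuous H},
        H @` (`[0, 1] `*` `[0, 1]) `<=` A,
        {in `[0, 1], forall t, H (0, t) = f t},
        {in `[0, 1], forall t, H (1, t) = f 0}
      & {in `[0, 1], forall s, H (s, 0) = f 0 /\ H (s, 1) = f 0}].

Definition simply_connected : Prop :=
  path_connected /\
  forall f : R -> T, path_in f -> f 0 = f 1 -> null_homotopic f.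

End Topology.

Record regular_equiv (S : simplex_family) := RegularEquiv {
  vertex_equiv : rel nat;
  gen_equiv : rel {fset nat};
  vertex_equiv_rel : {in vertices S & &, equivalence_rel vertex_equiv};
  gen_equiv_rel : {in generators S & &, equivalence_rel gen_equiv};
  gen_vertex_inj : {in generators S, forall g : {fset nat},
    {in g &, forall v w, vertex_equiv v w -> v = w}};
  gen_equiv_unique : {in generators S & &, forall g p q : {fset nat},
    p != g -> q != g -> gen_equiv p g -> gen_equiv q g -> p = q};
  gen_equiv_vertices : {in generators S &, forall g p : {fset nat},
    p != g -> gen_equiv p g ->
    {in g, forall v, exists2 w, w \in p & v = w \/ vertex_equiv v w}}
}.

Section StellarStructure.
Variables (S : simplex_family) (e : regular_equiv S).

(* s and t are corresponding faces, of equal dimension, of equivalent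
   generators *)
Definition face_equiv (s t : {fset nat}) : Prop :=
  exists g p : {fset nat},
    [/\ g \in generators S, p \in generators S & gen_equiv e g p] /\
    [/\ s `<=` g, t `<=` p, #|` s| = #|` t|
      & {in s, forall v, exists2 w, w \in t & v = w \/ vertex_equiv e v w}].

Definition identified (s t : {fset nat}) : Prop :=
  face_equiv s t \/
  exists v w, [/\ v \in vertices S, w \in vertices S, vertex_equiv e v w,
                  s = [fset v] & t = [fset w]].

(* The cells of a * (S/~) are the nonempty simplexes of a * S modulo
   [identified]; a simplex containing a is identified only with itself, which
   keeps a * g and a * p distinct when g ~ p. *)
Definition cell_of (a : nat) (s : {fset nat}) : simplex_family :=
  [fset t in cone a S |
     `[< clos_refl_sym_trans {fset nat} identified s t >]].

Definition cells (a : nat) : {fset simplex_family} :=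
  [fset cell_of a s | s in [fset s in cone a S | s != fset0]].

Definition cell_face (c d : simplex_family) : Prop :=
  exists s t : {fset nat}, [/\ s \in c, t \in d & s `<=` t].

Definition is_flag (F : {fset simplex_family}) : Prop :=
  {in F &, forall c d, cell_face c d \/ cell_face d c}.

(* Since distinct simplexes of a * (S/~) may have the same vertices, a * (S/~)
   is in general not a family of vertex sets.  It is therefore represented by
   the complex obtained by starring all its simplexes in order of decreasing
   dimension, that is, by its first derived complex, whose simplexes are the
   flags of cells; [choice.pickle] labels the cells by natural numbers. *)
Definition cone_quotient (a : nat) : simplex_family :=
  relabel (fun c : {fset {fset nat}} => choice.pickle c)
    [fset F in fpowerset (cells a) | `[< is_flag F >]].

Local Open Scope group_scope.

Definition is_p0 (p : {perm generators S}) : Prop :=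
  forall g, p g != g /\ gen_equiv e (val (p g)) (val g).

Definition facet_class (s : {fset nat}) : simplex_family :=
  [fset t in facets S | `[< clos_refl_sym_trans {fset nat}
     (fun x y => [/\ x \in facets S, y \in facets S & face_equiv x y]) s t >]].

Definition facet_classes : {fset simplex_family} :=
  [fset facet_class s | s in facets S].

(* When S is a sphere, an (n-1)-simplex lies in exactly two generators and a
   generator has at most one face in alpha, so that exactly one permutation
   satisfies this. *)
Definition is_p_alpha (alpha : simplex_family) (p : {perm generators S}) :
  Prop :=
  forall g,
    (forall s, s \in alpha -> s `<=` val g ->
       p g != g /\ s `<=` val (p g)) /\
    ((forall s, s \in alpha -> ~~ (s `<=` val g)) -> p g = g).

Definition Cox (p0 : {perm generators S}) : {set {perm generators S}} :=
  <<p0 |: [set p | `[< exists2 alpha, alpha \in facet_classes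
                                    & is_p_alpha alpha p >]]>>.

(* p0 is unique: it exists if and only if every generator of S is equivalent to
   another generator, as is the case when a * (S/~) is closed. *)
Definition flat_structure : Prop :=
  exists p0 : {perm generators S},
    [/\ is_p0 p0, group_set [set 1; p0] & fingroup.normal [set 1; p0] (Cox p0)].

End StellarStructure.

(* An n-dimensional M = a * (S/~), as complexes up to stellar equivalence,
   with {1, p0} normal in Cox (S/~). *)
Definition flat (n : nat) (M : simplex_family) : Prop :=
  exists (S : simplex_family) (e : regular_equiv S) (a : nat),
    [/\ stellar_sphere n.-1 S, a \notin vertices S,
        stellar_equiv M (cone_quotient e a) & flat_structure e].

(* Main.v *)
(* Under stellar moves the vanishing of the first Z_2-cohomology of a complex,
   and of suitable cohomology of its links, is invariant.  Flatness makes [p0]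
   come from a simplicial involution [phi] of the sphere [S].  As [M] has no
   first cohomology, only [v] and [phi v] are identified, and local colourings
   of the triangles of [S], exchanged by [phi] and changing only across fixed
   edges, fit together to a global one.  So [S] is the union of two discs [D]
   and [phi D] that meet in the fixed set of [phi], their common boundary, and
   [M] is the union of the cones [a * D] and [a * phi D], glued along their
   boundary spheres.  A disc is shellable, and following a shelling by flips one
   may replace, in any complex, the ball [a * D] by [b * bd (a * D)].  Doing so
   for a subdivision in which only the second cone is derived gives the derived
   subdivision, along the same simplexes, of [a * D u b * bd (a * D)].  The
   shelling reduces the latter to the boundary of a 4-simplex. *)

(* A stellar equivalence provides no map to work with, so of a sphere given up to it only invariants
   can be used. Degree one over Z_2 suffices because everything to be found is two-valued: the sheet
   of a simplex, the side of a chord, the part of a star. An obstruction to such a choice always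
   appears as a cocycle without potential. This also replaces the classification of surfaces and the
   Jordan curve theorem: a disc is known only by the degrees of its edges, connected stars and
   vanishing cohomology, conditions that survive the removal of a well-chosen triangle. The quotient
   is accessible only through its derived complex, where both cones are finely subdivided and no
   flip along the shelling applies. They cannot both be restored: [a * s] and [a * phi s] have the
   same vertices in the quotient and would become one simplex. So the first cone alone is restored
   and exchanged for [b * bd (a * D)]; only then can the second one be restored. *)
Require Import Defs.
From Stdlib Require Import Relation_Operators.
From mathcomp Require Import all_boot all_order all_algebra all_fingroup finmap.
From mathcomp Require Import all_classical all_reals all_analysis.
From mathcomp Require Import zify ring lra.
Import numFieldNormedType.Exports.

Set Implicit Arguments.
Unset Strict Implicit.
Unset Printing Implicit Defensive.

Local Open Scope fset_scope.

(* Reduces an inclusion or equality of finite sets to a propositional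
   tautology about the membership of a generic element. *)
Ltac fset_atoms :=
  rewrite ?inE /=;
  repeat match goal with
  | |- context [?x \in ?A] => is_var x; is_var A; case: (x \in A) => //=
  end;
  repeat match goal with
  | |- context [?x == ?y] => case: (eqVneq x y) => //= ?
  end.

Ltac fset_hyps i :=
  repeat match goal with
  | H : is_true (fsubset ?A ?B) |- _ => move/fsubsetP/(_ i): H; rewrite ?inE
  end.

Ltac fset_tac :=
  try (apply/fsubsetP || apply/fsetP || apply/eqP/fsetP);
  let i := fresh "i" in move=> i; fset_hyps i; fset_atoms.

(** * Stellar subdivision, links and relabelling *)

Section Basic.
Implicit Types (K L : simplex_family) (s t u : {fset nat}).

Lemma complex0 K : is_complex K -> fset0 \in K.
Proof. by case. Qed.

Lemma complexS K s t : is_complex K -> t `<=` s -> s \in K -> t \in K.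
Proof. by case=> _ h ts sK; exact: h ts. Qed.

Lemma in_vertices K v : is_complex K -> (v \in vertices K) = ([fset v] \in K).
Proof.
move=> cK; apply/bigfcupP/idP => [[s /andP[sK _] vs]|vK].
  by apply: complexS cK _ sK; rewrite fsub1set.
by exists [fset v]; rewrite ?vK ?inE.
Qed.

Lemma in_verticesP K v :
  reflect (exists2 s, s \in K & v \in s) (v \in vertices K).
Proof.
rewrite /vertices /fcover; apply: (iffP (bigfcupP _ _ _ _)) => [[s /andP[sK _] vs]|[s sK vs]];
    exists s => //.
by rewrite sK.
Qed.

Lemma vertices_notin K v s : v \notin vertices K -> s \in K -> v \notin s.
Proof. by move=> vK sK; apply: contra vK => vs; apply/in_verticesP; exists s. Qed.

Lemma in_joinP K L t :
  reflect (exists s u, [/\ s \in K, u \in L & t = s `|` u]) (t \in join K L).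
Proof.
apply: (iffP idP) => [/imfset2P[s sK [u uL ->]]|[s [u [sK uL ->]]]].
  by exists s, u.
by apply/imfset2P; exists s => //; exists u.
Qed.

Lemma in_simplex s t : (t \in simplex s) = (t `<=` s).
Proof. exact: fpowersetE. Qed.

Lemma in_simplex_bd s t : (t \in simplex_bd s) = (t `<=` s) && ~~ (s `<=` t).
Proof.
by rewrite /simplex_bd !inE /= fpowersetE; case ts: (t `<=` s) => //=;
  rewrite eqEfsubset ts.
Qed.

Lemma in_link K s t :
  (t \in link K s) = [&& t \in K, fdisjoint s t & (s `|` t \in K)].
Proof. by rewrite /link !inE /=. Qed.

Lemma simplex_complex s : is_complex (simplex s).
Proof.
split; first by rewrite in_simplex fsub0set.
by move=> u; rewrite in_simplex => us t tu; rewrite in_simplex (fsubset_trans tu).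
Qed.

Lemma simplex_bd_complex s : s != fset0 -> is_complex (simplex_bd s).
Proof.
move=> s0; split; first by rewrite in_simplex_bd fsub0set fsubset0.
move=> u; rewrite in_simplex_bd => /andP[us nsu] t tu.
rewrite in_simplex_bd (fsubset_trans tu us); apply: contra nsu => st.
exact: fsubset_trans tu.
Qed.

Lemma join_complex K L : is_complex K -> is_complex L -> is_complex (join K L).
Proof.
move=> cK cL; split.
  by apply/in_joinP; exists fset0, fset0; rewrite fsetU0 !complex0.
move=> _ /in_joinP[s [u [sK uL ->]]] t tsu.
apply/in_joinP; exists (t `&` s), (t `&` u); split.
- by apply: complexS cK _ sK; rewrite fsubsetIr.
- by apply: complexS cL _ uL; rewrite fsubsetIr.
by rewrite -fsetIUr; apply/esym/fsetIidPl.
Qed.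

Lemma link_complex K s : is_complex K -> s \in K -> is_complex (link K s).
Proof.
move=> cK sK; split.
  by rewrite in_link complex0 // fsetU0 sK fdisjointX0.
move=> u; rewrite in_link => /and3P[uK dsu suK] t tu; rewrite in_link.
rewrite (complexS cK tu uK) (fdisjointWr tu dsu) /=.
by apply: complexS cK _ suK; rewrite fsetUS.
Qed.

Lemma link0 K : link K fset0 = K.
Proof. by apply/fsetP=> t; rewrite in_link fset0U fdisjoint0X andbb. Qed.

Lemma join0 L : join [fset fset0] L = L.
Proof.
apply/fsetP=> t; apply/in_joinP/idP => [[s [u [/fset1P-> uL ->]]]|tL].
  by rewrite fset0U.
by exists fset0, t; rewrite inE fset0U.
Qed.

Lemma in_cone a K t : is_complex K -> a \notin vertices K ->
  (t \in cone a K) = (t `\ a \in K).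
Proof.
move=> cK aK; apply/in_joinP/idP => [[s [u [+ uK ->]]]|tK].
  rewrite in_simplex => sa; apply: complexS cK _ uK; fset_tac.
exists (t `&` [fset a]), (t `\ a); rewrite in_simplex fsubsetIr; split=> //.
by fset_tac.
Qed.

(** This eliminates the joins and links from the definition of a subdivision. A simplex through [v]
    is determined by the rest of it, which must span a simplex with [s] without containing [s]. *)
Lemma in_star K s v t : is_complex K -> s \in K -> v \notin vertices K ->
  (t \in stellar_subdivision K s v) =
    (t \in K) && ~~ (s `<=` t)
    || [&& v \in t, (t `\ v) `|` s \in K & ~~ (s `<=` t `\ v)].
Proof.
move=> cK sK vK; rewrite /stellar_subdivision !inE /=.
apply/idP/idP => [/orP[->//|]|].
  case/in_joinP=> x [_ [+ /in_joinP[y [l [+ + ->]]] ->]].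
  rewrite in_simplex in_simplex_bd in_link => xv /andP[ys nsy] /and3P[lK dsl slK].
  have vs := vertices_notin vK sK; have vl := vertices_notin vK lK.
  have vy : v \notin y by apply: contra vs; exact: (fsubsetP ys).
  have nsyl : ~~ (s `<=` y `|` l).
    apply: contra nsy => sy; apply/fsubsetP=> i i_s.
    move: (fsubsetP sy _ i_s); rewrite inE => /orP[//|il].
    by move/fdisjointP/(_ _ i_s): dsl; rewrite il.
  have ylK : s `|` (y `|` l) \in K.
    by rewrite fsetUA (fsetUidPl _ _ ys).
  case vx: (v \in x).
    have -> : (x `|` (y `|` l)) `\ v = y `|` l.
      apply/fsetP=> i; move/fsubsetP/(_ i): xv; rewrite !inE.
      by case: (eqVneq i v) => [->|_] /=; [rewrite (negbTE vl) (negbTE vy)|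
        case: (i \in x) => // /(_ isT)].
    by rewrite nsyl [_ `|` s]fsetUC ylK inE vx orbT.
  have -> : x `|` (y `|` l) = y `|` l.
    apply/fsetP=> i; move/fsubsetP/(_ i): xv; rewrite !inE.
    by case ix: (i \in x) => //= /(_ isT)/eqP iv; rewrite -iv ix in vx.
  by rewrite nsyl (complexS cK _ ylK) // fsubsetUr.
case/orP=> [->//|/and3P[vt tsK nst]]; apply/orP; right.
apply/in_joinP; exists [fset v], (t `\ v); split.
- by rewrite in_simplex.
- apply/in_joinP; exists ((t `\ v) `&` s), ((t `\ v) `\` s); split.
  + rewrite in_simplex_bd fsubsetIr; apply: contra nst => h.
    by apply: fsubset_trans h _; rewrite fsubsetIl.
  + rewrite in_link; apply/and3P; split.
    * by apply: complexS cK _ tsK; fset_tac.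
    * by apply/fdisjointP=> i is_; rewrite !inE is_.
    * by apply: complexS cK _ tsK; fset_tac.
  + by rewrite fsetID.
by rewrite fsetD1K.
Qed.

Lemma star_complex K s v : is_complex K -> s \in K -> s != fset0 ->
  v \notin vertices K -> is_complex (stellar_subdivision K s v).
Proof.
move=> cK sK s0 vK; split; first by rewrite in_star // complex0 //= fsubset0 s0.
move=> t; rewrite in_star // => /orP[/andP[tK nst]|/and3P[vt tsK nst]] u ut.
  rewrite in_star // (complexS cK ut) //=; apply/orP; left.
  by apply: contra nst => h; exact: fsubset_trans ut.
have utv : u `\ v `<=` t `\ v by fset_tac.
rewrite in_star //; case vu: (v \in u); last first.
  have uE : u `\ v = u by apply/fsetP=> i; rewrite !inE; case: eqP => //= ->; rewrite vu.
  rewrite uE in utv; rewrite orbF; apply/andP; split.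
    by apply: complexS cK _ tsK; fset_tac.
  by apply: contra nst => h; exact: fsubset_trans utv.
apply/orP; right; apply/and3P; split=> //.
  by apply: complexS cK _ tsK; rewrite fsetSU.
by apply: contra nst => h; exact: fsubset_trans utv.
Qed.

Lemma in_relabelP (V : choiceType) (f : V -> nat) (K : {fset {fset V}}) t :
  reflect (exists2 s, s \in K & t = f @` s) (t \in relabel f K).
Proof. exact: imfsetP. Qed.

Lemma relabel_complex (f : nat -> nat) K : is_complex K -> is_complex (relabel f K).
Proof.
move=> cK; split.
  by apply/in_relabelP; exists fset0; rewrite ?complex0 // imfset0.
move=> _ /in_relabelP[s sK ->] t tfs; apply/in_relabelP.
exists [fset i in s | f i \in t].
  by apply: complexS cK _ sK; apply/fsubsetP=> i; rewrite !inE /= => /andP[].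
apply/fsetP=> j; apply/idP/imfsetP => [jt|[i /=]].
  have /imfsetP[i /= is_ jE] := fsubsetP tfs _ jt; exists i => //.
  by rewrite !inE /= is_ -jE jt.
by rewrite !inE /= => /andP[_ h] ->.
Qed.

End Basic.

Section Links.
Implicit Types (K L : simplex_family) (s t u : {fset nat}).

Lemma in_linkE K t u : is_complex K ->
  (u \in link K t) = fdisjoint t u && (t `|` u \in K).
Proof.
move=> cK; rewrite in_link; case h: (t `|` u \in K); rewrite ?andbF // !andbT.
by rewrite (complexS cK _ h) // fsubsetUr.
Qed.

Lemma vertices_link K t : vertices (link K t) `<=` vertices K.
Proof.
apply/fsubsetP=> i /in_verticesP[s]; rewrite in_link => /and3P[sK _ _] si.
by apply/in_verticesP; exists s.
Qed.

Lemma fsetD1_notin (v : nat) s : v \notin s -> s `\ v = s.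
Proof. by move=> vs; apply/fsetDidPl; rewrite fdisjointX1. Qed.

(** This lemma and the next two treat all simplexes of a subdivision: those that do not span a
    simplex with [s], those that do, and those through the new vertex. *)
Lemma link_star_far K s v t : is_complex K -> s \in K -> s != fset0 ->
  v \notin vertices K -> t \in K -> t `|` s \notin K ->
  link (stellar_subdivision K s v) t = link K t.
Proof.
move=> cK sK s0 vK tK tsK; apply/fsetP=> u.
rewrite !in_linkE //; last exact: star_complex.
case dtu: (fdisjoint t u) => //=; rewrite in_star //.
have -> : (t `|` u) `\ v `|` s \in K = false.
  apply: contraNF tsK => /(complexS cK); apply.
  have vt := vertices_notin vK tK.
  apply/fsubsetP=> i; rewrite !inE => /orP[it|->]; last by rewrite orbT.
  by rewrite it /= andbT (memPn vt).
rewrite andbF orbF; case tuK: (t `|` u \in K) => //=.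
apply: contra tsK => h; apply: complexS cK _ tuK.
by rewrite fsubUset fsubsetUl.
Qed.

Lemma link_star_near K s v t : is_complex K -> s \in K -> s != fset0 ->
  v \notin vertices K -> t \in K -> ~~ (s `<=` t) -> t `|` s \in K ->
  [/\ s `\` t \in link K t, s `\` t != fset0 &
   link (stellar_subdivision K s v) t =
   stellar_subdivision (link K t) (s `\` t) v].
Proof.
move=> cK sK s0 vK tK nst tsK.
have stL : s `\` t \in link K t.
  rewrite in_linkE // (_ : t `|` s `\` t = t `|` s) ?tsK ?andbT; last by fset_tac.
  by apply/fdisjointP=> i it; rewrite !inE it.
have st0 : s `\` t != fset0 by rewrite fsetD_eq0.
split=> //; apply/fsetP=> u.
have vt := vertices_notin vK tK.
have vL : v \notin vertices (link K t).
  by apply: contra vK => /(fsubsetP (vertices_link K t)).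
rewrite in_star //; last exact: link_complex.
rewrite !in_linkE //; last exact: star_complex.
rewrite in_star //.
have E1 w : (s `\` t `<=` w) = (s `<=` t `|` w) by rewrite fsubDset.
have E2 : (t `|` u) `\ v = t `|` (u `\ v) by rewrite fsetDUl (fsetD1_notin vt).
have E3 : t `|` (u `\ v `|` s `\` t) = t `|` (u `\ v) `|` s by fset_tac.
have E4 : (v \in t `|` u) = (v \in u) by rewrite inE (negbTE vt).
have E5 : fdisjoint t (u `\ v `|` s `\` t) = fdisjoint t u.
  rewrite fdisjointXU [fdisjoint t (s `\` t)](_ : _ = true) ?andbT; last first.
    by apply/fdisjointP=> i it; rewrite !inE it.
  apply/fdisjointP/fdisjointP=> h i it; have := h i it; rewrite !inE.
    by rewrite (memPn vt _ it).
  by move/negbTE->; rewrite andbF.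
rewrite !E1 E2 E3 E4 E5; case: (fdisjoint t u) => //=.
by rewrite andbF.
Qed.

(** Such a [t] stands in for the larger simplex formed by [s] and the rest of [t]; its link gains as
    a join factor the boundary sphere that makes up for the difference in dimension. *)
Lemma link_star_new K s v t : is_complex K -> s \in K -> s != fset0 ->
  v \notin vertices K -> v \in t -> t \in stellar_subdivision K s v ->
  [/\ t `\ v `|` s \in K, ~~ (s `<=` t `\ v) &
  link (stellar_subdivision K s v) t =
    join (simplex_bd (s `\` (t `\ v))) (link K (t `\ v `|` s))].
Proof.
move=> cK sK s0 vK vt; rewrite in_star //.
have -> : t \in K = false by apply: contraTF vt; exact: vertices_notin.
rewrite vt /= => /andP[tsK nst]; split=> //; apply/fsetP=> u.
set t0 := t `\ v in tsK nst *.
rewrite in_linkE; last exact: star_complex.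
rewrite in_star //.
have -> : t `|` u \in K = false.
  by apply: contraTF vt => /(complexS cK (fsubsetUl _ _)); exact: vertices_notin.
rewrite inE vt /=.
have tE : t = v |` t0 by rewrite fsetD1K.
have vt0 : v \notin t0 by rewrite !inE eqxx.
have vs := vertices_notin vK sK.
apply/idP/in_joinP.
- case/and3P=> dtu; have vu : v \notin u by exact: (fdisjointP dtu).
  have -> : (t `|` u) `\ v = t0 `|` u by rewrite fsetDUl (fsetD1_notin vu).
  move=> tusK nstu; exists (u `&` s), (u `\` s); split; last by rewrite fsetID.
  + rewrite in_simplex_bd; apply/andP; split.
      apply/fsubsetP=> i; rewrite !inE => /andP[iu ->]; rewrite andbT.
      apply/negP; rewrite /t0 ?inE => /andP[_ it].
      by move/fdisjointP/(_ _ it): dtu; rewrite iu.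
    apply: contra nstu => h; apply/fsubsetP=> i is_; rewrite inE.
    case it: (i \in t0) => //=.
    have : i \in u `&` s by apply: (fsubsetP h); rewrite in_fsetD it.
    by rewrite inE => /andP[].
  + rewrite in_linkE //; apply/andP; split.
      apply/fdisjointP=> i; rewrite !inE => /orP[/andP[_ it]|->//].
      by rewrite negb_and (fdisjointP dtu _ it) orbT.
    by apply: complexS cK _ tusK; fset_tac.
- case=> x [l [+ + ->]]; rewrite in_simplex_bd in_linkE // => /andP[xs nsx] /andP[dl lK].
  have vl : v \notin l.
    apply: contra vK => vl; apply/in_verticesP; exists (t0 `|` s `|` l) => //.
    by rewrite inE vl orbT.
  have vx : v \notin x by apply: contra vs => /(fsubsetP xs); rewrite !inE => /andP[].
  have E : (t `|` (x `|` l)) `\ v = t0 `|` (x `|` l).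
    by rewrite fsetDUl (@fsetD1_notin _ (x `|` l)) // inE (negbTE vx).
  rewrite E; apply/and3P; split.
  + apply/fdisjointP=> i; rewrite tE !inE => /orP[/eqP->|it].
      by rewrite (negbTE vx).
    rewrite negb_or; apply/andP; split.
      by apply: contraL it => /(fsubsetP xs); rewrite !inE => /andP[].
    by apply: (fdisjointP dl); rewrite !inE it.
  + by apply: complexS cK _ lK; fset_tac.
  + apply: contra nsx => h; apply/fsubsetP=> i /[dup]; rewrite {1}inE => /andP[nit is_] _.
    move: (fsubsetP h _ is_); rewrite inE (negbTE nit) /= inE => /orP[//|il].
    have : i \in t0 `|` s by rewrite inE is_ orbT.
    by move/(fdisjointP dl); rewrite il.
Qed.

Lemma imfsetU_ (f : nat -> nat) s t : f @` (s `|` t) = f @` s `|` f @` t.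
Proof. exact: imfsetU. Qed.

Lemma in_relabel (f : nat -> nat) K s : {in vertices K &, injective f} ->
  s `<=` vertices K -> is_complex K -> (f @` s \in relabel f K) = (s \in K).
Proof.
move=> finj sV cK; apply/in_relabelP/idP => [[t tK E]|sK]; last by exists s.
suff -> : s = t by [].
have tV : t `<=` vertices K by apply/fsubsetP=> i it; apply/in_verticesP; exists t.
apply/fsetP=> i; apply/idP/idP => h.
  have : f i \in f @` t by rewrite -E; apply/imfsetP; exists i.
  by case/imfsetP=> j /= jt /finj-> //; [exact: (fsubsetP sV)|exact: (fsubsetP tV)].
have : f i \in f @` s by rewrite E; apply/imfsetP; exists i.
by case/imfsetP=> j /= jt /finj-> //; [exact: (fsubsetP tV)|exact: (fsubsetP sV)].
Qed.

Lemma link_relabel (f : nat -> nat) K t : is_complex K ->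
  {in vertices K &, injective f} -> t \in K ->
  link (relabel f K) (f @` t) = relabel f (link K t).
Proof.
move=> cK finj tK.
have subV s : s \in K -> s `<=` vertices K.
  by move=> sK; apply/fsubsetP=> i is_; apply/in_verticesP; exists s.
apply/fsetP=> u; rewrite in_link; apply/and3P/in_relabelP.
  case=> /in_relabelP[s sK ->] dts; rewrite -imfsetU_ in_relabel //; last first.
    by rewrite fsubUset !subV.
  move=> tsK; exists s => //; rewrite in_linkE // tsK andbT.
  apply/fdisjointP=> i it; apply/negP=> is_.
  have ft : f i \in f @` t by apply/imfsetP; exists i.
  move/fdisjointP/(_ _ ft)/negP: dts; apply.
  by apply/imfsetP; exists i.
case=> s; rewrite in_linkE // => /andP[dts tsK] ->.
have sK : s \in K by apply: complexS cK _ tsK; rewrite fsubsetUr.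
rewrite -imfsetU_ !in_relabel // ?fsubUset ?subV //; split=> //.
apply/fdisjointP=> _ /imfsetP[i /= it ->]; apply/negP=> /imfsetP[j /= js].
move/finj => ij; move/fdisjointP/(_ _ it)/negP: dts; apply.
by rewrite ij //; [exact: (fsubsetP (subV _ tK))|exact: (fsubsetP (subV _ sK))].
Qed.

Lemma card_imfset_in (f : nat -> nat) K s : {in vertices K &, injective f} ->
  s \in K -> #|` f @` s| = #|` s|.
Proof.
move=> finj sK; apply: card_in_imfset => i j /= is_ js; apply: finj.
  by apply/in_verticesP; exists s.
by apply/in_verticesP; exists s.
Qed.

End Links.

(** * Stellar invariance of properties of links *)

Section LocalInvariance.
Variable P : nat -> simplex_family -> Prop.

Definition star_invariant := forall k (L : simplex_family) s v,
  is_complex L -> s \in L -> s != fset0 -> v \notin vertices L ->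
  P k L <-> P k (stellar_subdivision L s v).

Definition relabel_invariant := forall k (L : simplex_family) (f : nat -> nat),
  is_complex L -> {in vertices L &, injective f} -> P k L <-> P k (relabel f L).

(** The first index is the number of vertices of the simplex whose link is considered. The boundary
    of [X] is an [m]-sphere, and by [link_star_new] it occurs as a join factor for a simplex with
    [m.+1] vertices fewer. *)
Definition join_stable := forall j m (L : simplex_family) (X : {fset nat}),
  is_complex L -> #|` X| = m.+2 -> fdisjoint X (vertices L) ->
  P (j + m.+1) L -> P j (join (simplex_bd X) L).

Definition locally (K : simplex_family) := forall t, t \in K -> P #|` t| (link K t).

Hypotheses (Pstar : star_invariant) (Prelabel : relabel_invariant)
           (Pjoin : join_stable).

Lemma locally_star (K : simplex_family) s v : is_complex K -> s \in K -> s != fset0 ->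
  v \notin vertices K -> locally K <-> locally (stellar_subdivision K s v).
Proof.
move=> cK sK s0 vK.
have cK' := star_complex cK sK s0 vK.
split=> PK t tK.
- case vt: (v \in t); last first.
    move: tK; rewrite in_star // vt orbF => /andP[tK nst].
    case tsK: (t `|` s \in K); last first.
      by rewrite link_star_far ?tsK //; exact: PK.
    have [sL st0 ->] := link_star_near cK sK s0 vK tK nst tsK.
    apply: (Pstar _ _ sL st0 _).1 (PK _ tK); first exact: link_complex.
    by apply: contra vK => /(fsubsetP (vertices_link K t)).
  have [tsK nst ->] := link_star_new cK sK s0 vK vt tK.
  set X := s `\` (t `\ v); have := PK _ tsK.
  have X0 : X != fset0 by rewrite fsetD_eq0.
  have E : #|` t `\ v `|` s| = (#|` t `\ v| + #|` X|)%N.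
    rewrite -cardfsUI (_ : (t `\ v) `&` X = fset0) ?cardfs0 ?addn0.
      by congr (#|` _|); rewrite /X; fset_tac.
    by rewrite /X; fset_tac.
  have Et : #|` t| = (#|` t `\ v|).+1 by rewrite (cardfsD1 v) vt.
  case cX: #|` X| => [|[|m]].
  + by move/eqP: cX; rewrite cardfs_eq0 (negbTE X0).
  + rewrite E cX addn1 -Et; have /cardfs1P[x ->] : #|` X| == 1%N by rewrite cX.
    rewrite (_ : simplex_bd [fset x] = [fset fset0]) ?join0 //.
    apply/fsetP=> y; rewrite in_simplex_bd inE fsub1set fsubset1.
    apply/idP/eqP => [/andP[/orP[/eqP->|/eqP//]]|->]; first by rewrite inE eqxx.
    by rewrite eqxx orbT inE.
  + move=> PL; apply: Pjoin; [exact: link_complex|exact: cX| |].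
      apply/fdisjointP=> i iX; apply/in_verticesP=> -[u].
      rewrite in_linkE // => /andP[/fdisjointP/(_ i) + _] iu.
      by move: iX; rewrite /X !inE iu => /andP[_ ->]; rewrite orbT => /(_ isT).
    by rewrite Et addSnnS -cX -E.
- case st: (s `<=` t); last first.
    have tK' : t \in stellar_subdivision K s v by rewrite in_star // tK st.
    have := PK _ tK'; case tsK: (t `|` s \in K); last first.
      by rewrite link_star_far ?tsK.
    have [sL st0 ->] := link_star_near cK sK s0 vK tK (negbT st) tsK.
    apply: (Pstar _ _ sL st0 _).2; first exact: link_complex.
    by apply: contra vK => /(fsubsetP (vertices_link K t)).
  have /fset0Pn[p ps] := s0.
  have pt := fsubsetP st _ ps.
  (* Exchanging a vertex [p] of [s] for [v] gives a simplex of the subdivision with as many vertices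
     and the same link: the sphere factor is the boundary of [p] alone, which is neutral for
     joins. *)
  pose t' := v |` (t `\ p); have vt := vertices_notin vK tK.
  have vt' : v \in t' by rewrite !inE eqxx.
  have E1 : t' `\ v = t `\ p.
    by apply/fsetP=> i; rewrite !inE; case: (eqVneq i v) => [->|_] //=; rewrite (negbTE vt) andbF.
  have E2 : t `\ p `|` s = t.
    apply/fsetP=> i; rewrite !inE; case: (eqVneq i p) => [->|_] /=; first by rewrite ps pt.
    by case is_: (i \in s); rewrite ?orbF ?orbT // (fsubsetP st _ is_).
  have nst : ~~ (s `<=` t `\ p).
    by apply/negP=> /fsubsetP/(_ _ ps); rewrite !inE eqxx.
  have tK' : t' \in stellar_subdivision K s v.
    by rewrite in_star // vt' E1 E2 tK nst orbT.
  have := PK _ tK'; have [_ _ ->] := link_star_new cK sK s0 vK vt' tK'.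
  rewrite E1 E2 (_ : s `\` (t `\ p) = [fset p]); last first.
    apply/fsetP=> i; rewrite !inE; case: (eqVneq i p) => [->|_] /=; first by rewrite ps.
    by case is_: (i \in s); rewrite ?andbF // (fsubsetP st _ is_).
  rewrite (_ : simplex_bd [fset p] = [fset fset0]) ?join0.
    suff -> : #|` t'| = #|` t| by [].
    by rewrite /t' cardfsU1 [RHS](cardfsD1 p) pt !inE (negbTE vt) andbF.
  apply/fsetP=> y; rewrite in_simplex_bd inE fsub1set fsubset1.
  apply/idP/eqP => [/andP[/orP[/eqP->|/eqP//]]|->]; first by rewrite inE eqxx.
  by rewrite eqxx orbT inE.
Qed.

Lemma locally_relabel (K : simplex_family) (f : nat -> nat) : is_complex K ->
  {in vertices K &, injective f} -> locally K <-> locally (relabel f K).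
Proof.
move=> cK finj; have injL t : {in vertices (link K t) &, injective f}.
  by move=> i j iL jL; apply: finj; exact: fsubsetP (vertices_link K t) _ _.
split=> PK t tK.
  case/in_relabelP: tK => {}t tK ->.
  rewrite link_relabel // (card_imfset_in finj tK).
  by apply: (Prelabel _ _ (@injL t)).1 (PK _ tK); exact: link_complex.
have ftK : f @` t \in relabel f K by apply/in_relabelP; exists t.
have := PK _ ftK; rewrite link_relabel // (card_imfset_in finj tK).
by apply: (Prelabel _ _ (@injL t)).2; exact: link_complex.
Qed.

Lemma locally_stellar (K L : simplex_family) : stellar_equiv K L -> locally K <-> locally L.
Proof.
elim=> {K L} [K L []|K|K L _|K L M _ IH1 _ IH2].
- by move=> s v cK sK s0 vK; exact: locally_star.
- by move=> f cK finj; exact: locally_relabel.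
- by [].
- by case.
- by split=> h; [apply/IH2/IH1|apply/IH1/IH2].
Qed.

End LocalInvariance.

(** * Z_2-cohomology in low degrees *)

Section Acyclicity.
Implicit Types (K L : simplex_family) (s t u X : {fset nat}).

Definition conn0 K := exists x, [fset x] \in K.

Definition conn1 K := conn0 K /\ forall f : nat -> bool,
  (forall x y, [fset x; y] \in K -> f x = f y) ->
  forall x y, [fset x] \in K -> [fset y] \in K -> f x = f y.

(* Taking degenerate triples into account makes [g] vanish on the diagonal and
   symmetric on the edges of [K]. *)
Definition cocycle K (g : nat -> nat -> bool) :=
  forall x y z, [fset x; y; z] \in K -> g x y (+) g y z = g x z.

Definition H1 K := forall g, cocycle K g ->
  exists f : nat -> bool, forall x y, [fset x; y] \in K -> g x y = f x (+) f y.

(** Reduced Z_2-cohomology vanishes in all degrees up to [k - 2], as for a sphere of dimension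
    [k - 1]; degrees above 1 are not recorded, and degree -1 means nonemptiness. *)
Definition acyclic k K :=
  match k with
  | 0 => True
  | 1 => conn0 K
  | 2 => conn1 K
  | _ => conn1 K /\ H1 K
  end.

Lemma acyclic_le k k' K : k' <= k -> acyclic k K -> acyclic k' K.
Proof.
by case: k' => [|[|[|k']]]; case: k => [|[|[|k]]] //= _; (try by case);
  case; case.
Qed.

Lemma cocycle_refl K g x : cocycle K g -> [fset x] \in K -> g x x = false.
Proof. by move=> gK xK; have := gK x x x; rewrite !fsetUid => /(_ xK); case: (g x x). Qed.

Lemma cocycle_sym K g x y : cocycle K g -> is_complex K -> [fset x; y] \in K ->
  g x y = g y x.
Proof.
move=> gK cK xyK; have := gK x y x.
rewrite (_ : [fset x; y; x] = [fset x; y]) => [/(_ xyK)|]; last by fset_tac.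
rewrite (cocycle_refl gK); last by apply: complexS cK _ xyK; fset_tac.
by case: (g x y); case: (g y x).
Qed.

Lemma image_fset1 (f : nat -> nat) x : f @` [fset x] = [fset f x].
Proof. exact: imfset_fset1. Qed.

Lemma image_fset2 (f : nat -> nat) x y : f @` [fset x; y] = [fset f x; f y].
Proof. by rewrite imfsetU_ !image_fset1. Qed.

Lemma image_fset3 (f : nat -> nat) x y z :
  f @` [fset x; y; z] = [fset f x; f y; f z].
Proof. by rewrite imfsetU_ image_fset2 image_fset1. Qed.

Section Relabel.
Variables (K : simplex_family) (f : nat -> nat).
Hypotheses (cK : is_complex K) (finj : {in vertices K &, injective f}).

Lemma left_inverse_on : exists h : nat -> nat,
  {in vertices K, forall i, h (f i) = i}.
Proof.
pose V : seq nat := vertices K.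
exists (fun j => nth 0%N V (index j (map f V))) => i iV.
have fiV : f i \in map f V by apply: map_f.
have ltV : index (f i) (map f V) < size V by rewrite -(size_map f) index_mem.
apply: finj => //; first exact: (mem_nth 0%N ltV).
by rewrite -(nth_map 0%N (f 0%N)) // nth_index.
Qed.

Lemma relabel_vertexP x : [fset x] \in relabel f K ->
  exists2 x', x = f x' & [fset x'] \in K.
Proof.
case/in_relabelP=> s sK E; have : x \in f @` s by rewrite -E inE.
case/imfsetP=> x' /= x's ->; exists x' => //.
by apply: complexS cK _ sK; rewrite fsub1set.
Qed.

Lemma relabel_edgeP x y : [fset x; y] \in relabel f K ->
  exists x' y', [/\ x = f x', y = f y' & [fset x'; y'] \in K].
Proof.
case/in_relabelP=> s sK E.
have : x \in f @` s by rewrite -E !inE eqxx.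
case/imfsetP=> x' /= x's ->; have : y \in f @` s by rewrite -E !inE eqxx orbT.
case/imfsetP=> y' /= y's ->; exists x', y'; split=> //.
by apply: complexS cK _ sK; rewrite fsubUset !fsub1set x's.
Qed.

Lemma in_relabel_of s : s \in K -> f @` s \in relabel f K.
Proof. by move=> sK; apply/in_relabelP; exists s. Qed.

Lemma conn0_relabel : conn0 K -> conn0 (relabel f K).
Proof. by case=> x /in_relabel_of; rewrite image_fset1; exists (f x). Qed.

Lemma conn1_relabel : conn1 K -> conn1 (relabel f K).
Proof.
case=> c0 c1; split=> [|F FK x y]; first exact: conn0_relabel.
case/relabel_vertexP=> x' -> x'K /relabel_vertexP[y' -> y'K].
apply: (c1 (F \o f)) => // u v /in_relabel_of; rewrite image_fset2; exact: FK.
Qed.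

Lemma H1_relabel : H1 K -> H1 (relabel f K).
Proof.
move=> hK g gK; have [|F FK] := hK (fun x y => g (f x) (f y)).
  by move=> x y z /in_relabel_of; rewrite image_fset3 => /gK.
have [h hf] := left_inverse_on; exists (F \o h) => _ _ /relabel_edgeP[x [y [-> -> xyK]]].
by rewrite (FK x y) //= !hf //; apply/in_verticesP; exists [fset x; y];
  rewrite // !inE eqxx ?orbT.
Qed.

End Relabel.

(** An injective relabelling is undone by another one, so preservation in one direction is
    enough. *)
Lemma relabel_iff (P : simplex_family -> Prop) :
  (forall K (f : nat -> nat), is_complex K -> {in vertices K &, injective f} ->
    P K -> P (relabel f K)) ->
  forall K (f : nat -> nat), is_complex K -> {in vertices K &, injective f} ->
    P K <-> P (relabel f K).
Proof.
move=> hP K f cK finj; split=> [|PfK]; first exact: hP.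
have [h hf] := left_inverse_on finj.
have hfs s : s \in K -> h @` (f @` s) = s.
  move=> sK; apply/fsetP=> i; apply/imfsetP/idP => [[_ /imfsetP[j /= js ->] ->]|is_].
    by rewrite hf //; apply/in_verticesP; exists s.
  have iV : i \in vertices K by apply/in_verticesP; exists s.
  by exists (f i); rewrite ?hf //; apply/imfsetP; exists i.
have -> : K = relabel h (relabel f K).
  apply/fsetP=> s; apply/idP/in_relabelP => [sK|[_ /in_relabelP[u uK ->] ->]].
    by exists (f @` s); [apply/in_relabelP; exists s|rewrite hfs].
  by rewrite hfs.
apply: hP => //; first exact: relabel_complex.
move=> i j /in_verticesP[_ /in_relabelP[s sK ->] /imfsetP[i' /= i's ->]].
case/in_verticesP=> _ /in_relabelP[t tK ->] /imfsetP[j' /= j't ->].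
rewrite !hf => [->//||]; apply/in_verticesP; by [exists s|exists t].
Qed.

Lemma acyclic_relabel k K (f : nat -> nat) : is_complex K ->
  {in vertices K &, injective f} -> acyclic k K <-> acyclic k (relabel f K).
Proof.
apply: relabel_iff => {}K {}f cK finj.
case: k => [|[|[|k]]] //=; first exact: conn0_relabel.
  exact: conn1_relabel.
by case=> c1 h1; split; [apply: conn1_relabel|apply: H1_relabel].
Qed.

(** This is the degenerate subdivision, in which [x] itself leaves the complex. Once it is settled,
    [s] has at least two vertices, and all of them survive. *)
Lemma star_vertex K x v : is_complex K -> [fset x] \in K -> v \notin vertices K ->
  stellar_subdivision K [fset x] v = relabel (fun i => if i == x then v else i) K.
Proof.
move=> cK xK vK; set f := fun i => _; have vx := vertices_notin vK xK.
have fE s : s \in K -> f @` s = if x \in s then v |` (s `\ x) else s.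
  move=> sK; have vs := vertices_notin vK sK.
  apply/fsetP=> i; apply/imfsetP/idP => [[j /= js ->]|].
    rewrite /f; case: eqVneq => [<-|jx]; first by rewrite js !inE eqxx.
    by case: ifP => // _; rewrite !inE jx js orbT.
  case: ifP => xs.
    rewrite !inE => /orP[/eqP->|/andP[ix is_]]; first by exists x; rewrite // /f eqxx.
    by exists i; rewrite // /f (negbTE ix).
  by move=> is_; exists i => //; rewrite /f; case: eqVneq => // ix; rewrite -ix is_ in xs.
apply/fsetP=> t; rewrite in_star // !fsub1set.
apply/idP/in_relabelP => [/orP[/andP[tK xt]|/and3P[vt txK xt]]|[s sK ->]].
- by exists t; rewrite ?fE ?(negbTE xt).
- exists (t `\ v `|` [fset x]) => //; rewrite fE // !inE eqxx orbT.
  apply/fsetP=> i; rewrite !inE; case: (eqVneq i v) => [->|iv] /=; first by rewrite vt.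
  case: (eqVneq i x) => [ix|] //=; last by rewrite orbF.
  by move: xt; rewrite !inE -ix iv /= => /negbTE->.
- rewrite fE //; case: ifP => xs; last by rewrite sK xs.
  have vs := vertices_notin vK sK.
  have E : (v |` s `\ x) `\ v = s `\ x.
    by apply/fsetP=> i; rewrite !inE; case: (eqVneq i v) => [->|] //=; rewrite (negbTE vs) andbF.
  have E' : s `\ x `|` [fset x] = s.
    by apply/fsetP=> i; rewrite !inE; case: (eqVneq i x) => [->|]; rewrite ?xs ?orbF.
  rewrite E E' sK !inE !eqxx /= ?orbT //.
Qed.

Lemma card_nsub s t : #|` t| < #|` s| -> ~~ (s `<=` t).
Proof. by move=> h; apply/negP=> /fsubset_leq_card; rewrite leqNgt h. Qed.

Lemma card_fset2_le (x y : nat) : #|` [fset x; y]| <= 2.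
Proof. by rewrite cardfs2; case: eqP. Qed.

Lemma card_fset3_le (x y z : nat) : #|` [fset x; y; z]| <= 3.
Proof.
apply: leq_trans (leq_card_fsetU _ _) _; rewrite cardfs1 addn1 ltnS.
exact: card_fset2_le.
Qed.

Section Star.
Variables (K : simplex_family) (s : {fset nat}) (v : nat).
Hypotheses (cK : is_complex K) (sK : s \in K) (s2 : 1 < #|` s|)
           (vK : v \notin vertices K).

Let K' := stellar_subdivision K s v.

Let in_old t : t \in K -> ~~ (s `<=` t) -> t \in K'.
Proof. by move=> tK nst; rewrite in_star // tK nst. Qed.

Let in_new t : t `|` s \in K -> ~~ (s `<=` t) -> v |` t \in K'.
Proof.
move=> tsK nst; rewrite in_star //.
have vt : v \notin t.
  by apply: contra vK => vt; apply/in_verticesP; exists (t `|` s); rewrite ?inE ?vt.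
have -> : (v |` t) `\ v = t.
  by apply/fsetP=> i; rewrite !inE; case: (eqVneq i v) => [->|] //=; rewrite (negbTE vt).
by rewrite !inE eqxx tsK nst orbT.
Qed.

Let s_gt0 : exists p, p \in s.
Proof. by apply/fset0Pn; rewrite -cardfs_gt0; exact: ltnW. Qed.

Let nsub1 x : ~~ (s `<=` [fset x]).
Proof. by apply: card_nsub => //; rewrite cardfs1. Qed.

Let v_edge x : [fset x] `|` s \in K -> [fset x; v] \in K'.
Proof. by move=> xsK; rewrite fsetUC; exact: in_new. Qed.

(** For [p] in [s] this is a simplicial map from the subdivision back to [K], along which functions
    and cocycles are pulled back. *)
Let collapse p i := if i == v then p else i.

Let collapseP p t : p \in s -> t \in K' -> collapse p @` t \in K.
Proof.
move=> ps; rewrite in_star // => /orP[/andP[tK _]|/and3P[vt tsK _]].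
  have -> : collapse p @` t = t; last by [].
  have vt := vertices_notin vK tK.
  apply/fsetP=> i; apply/imfsetP/idP => [[j /= jt ->]|it].
    by rewrite /collapse (negbTE (memPn vt _ jt)).
  by exists i; rewrite // /collapse (negbTE (memPn vt _ it)).
apply: complexS cK _ tsK; apply/fsubsetP=> _ /imfsetP[j /= jt ->].
rewrite /collapse; case: (eqVneq j v) => [_|jv]; first by rewrite in_fsetU ps orbT.
by rewrite !inE jv jt.
Qed.

Let old_vertex x : [fset x] \in K -> x != v.
Proof. by move=> xK; have := vertices_notin vK xK; rewrite inE eq_sym. Qed.

Let collapse_old p x : [fset x] \in K -> collapse p x = x.
Proof. by move/old_vertex; rewrite /collapse => /negbTE->. Qed.

Lemma conn0_star : conn0 K <-> conn0 K'.
Proof.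
split=> -[x xK]; first by exists x; exact: in_old.
have [p ps] := s_gt0; exists (collapse p x).
by rewrite -image_fset1; exact: collapseP.
Qed.

Lemma conn1_star : conn1 K <-> conn1 K'.
Proof.
have [p ps] := s_gt0; have pK : [fset p] \in K by rewrite (complexS cK _ sK) // fsub1set.
have [c01 c10] := conn0_star.
split=> -[c0 c1]; split; [exact: c01 c0| |exact: c10 c0|] => f fK.
- have fK0 x y : [fset x; y] \in K -> f x = f y.
    move=> xyK; case sxy: (s `<=` [fset x; y]); last by apply: fK; apply: in_old; rewrite ?sxy.
    rewrite (fK x v); last first.
      by apply: v_edge; apply: complexS cK _ xyK; rewrite fsubUset sxy andbT; fset_tac.
    apply/esym/fK/v_edge; apply: complexS cK _ xyK.
    by rewrite fsubUset sxy andbT; fset_tac.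
  have fE x : [fset x] \in K' -> exists2 y, [fset y] \in K & f x = f y.
    rewrite in_star // => /orP[/andP[xK _]|/and3P[]]; first by exists x.
    rewrite inE => /eqP<- _ _; exists p => //; apply/esym/fK/v_edge.
    by rewrite (fsetUidPr _ _ _) // fsub1set.
  move=> x y /fE[x' x'K ->] /fE[y' y'K ->]; exact: c1.
- move=> x y xK yK.
  rewrite -(@collapse_old p x) // -(@collapse_old p y) //.
  apply: (c1 (f \o collapse p)); [|exact: in_old|exact: in_old].
  by move=> u w uwK /=; apply: fK; rewrite -image_fset2; exact: collapseP.
Qed.

Let in_edge x y : [fset x; y] \in K -> ~~ (s `<=` [fset x; y]) -> [fset x; y] \in K'.
Proof. exact: in_old. Qed.

Lemma H1_star : H1 K <-> H1 K'.
Proof.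
have [p ps] := s_gt0; have pK : [fset p] \in K by rewrite (complexS cK _ sK) // fsub1set.
have cK' : is_complex K' by apply: star_complex; rewrite // -cardfs_gt0 ltnW.
split=> hK g gK.
(* When [s] is an edge it is missing from the subdivision; its value is then the sum over its two
   halves. As [s] has two vertices at least, the test can only succeed for that edge. *)
- pose g0 x y := if s `<=` [fset x; y] then g x v (+) g v y else g x y.
  have g0E x y z : [fset x; y; z] \in K -> s `<=` [fset x; y; z] ->
      g0 x y = g x v (+) g v y.
    move=> xyzK sxyz; rewrite /g0; case: ifP => // sxy; rewrite gK //.
    rewrite (_ : [fset x; v; y] = v |` [fset x; y]); last by fset_tac.
    apply: in_new; rewrite ?sxy //; apply: complexS cK _ xyzK.
    by rewrite fsubUset sxyz andbT; fset_tac.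
  have gv x : [fset x] `|` s \in K -> g x v = g v x.
    by move=> xsK; apply: (cocycle_sym gK) => //; exact: v_edge.
  have g0K : cocycle K g0.
    move=> x y z xyzK; case sxyz: (s `<=` [fset x; y; z]).
      rewrite (g0E _ _ _ xyzK sxyz) (g0E y z x) 1?(g0E x z y).
      - rewrite (gv y); first by case: (g x v); case: (g v y); case: (g v z).
        by apply: complexS cK _ xyzK; rewrite fsubUset sxyz andbT; fset_tac.
      - by rewrite (_ : [fset x; z; y] = [fset x; y; z]) //; fset_tac.
      - by rewrite (_ : [fset x; z; y] = [fset x; y; z]) //; fset_tac.
      - by rewrite (_ : [fset y; z; x] = [fset x; y; z]) //; fset_tac.
      - by rewrite (_ : [fset y; z; x] = [fset x; y; z]) //; fset_tac.
    have nsub (a b : nat) : [fset a; b] `<=` [fset x; y; z] -> s `<=` [fset a; b] = false.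
      by move=> ab; apply: contraFF sxyz => h; exact: fsubset_trans ab.
    rewrite /g0 !nsub; try by fset_tac.
    by apply: gK; apply: in_old; rewrite ?sxyz.
  have [f fK] := hK _ g0K.
  (* The potential at [v] is forced by the edge from [p]; [fv] checks that the other edges at [v]
     agree. *)
  exists (fun w => if w == v then f p (+) g p v else f w).
  have fv x : [fset x] `|` s \in K -> g x v = f x (+) (f p (+) g p v).
    move=> xsK; have xp : [fset x; p] \in K.
      by apply: complexS cK _ xsK; rewrite fsubUset !fsub1set !inE eqxx ps orbT.
    rewrite addbA -fK //.
    suff -> : g0 x p = g x v (+) g v p.
      rewrite -(gv p); last by rewrite (fsetUidPr _ _ _) // fsub1set.
      by case: (g x v); case: (g p v).
    rewrite /g0; case: ifP => // sxp; rewrite gK //.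
    rewrite (_ : [fset x; v; p] = v |` [fset x; p]); last by fset_tac.
    apply: in_new; rewrite ?sxp //; apply: complexS cK _ xsK.
    by rewrite fsubUset fsubsetUr fsubUset fsubsetUl fsub1set inE ps orbT.
  move=> x y xyK; rewrite /K' in_star // in xyK.
  have /orP[/andP[xyK0 nsxy]|/and3P[vxy xysK nsxy]] := xyK.
    have xK : [fset x] \in K by apply: complexS cK _ xyK0; fset_tac.
    have yK : [fset y] \in K by apply: complexS cK _ xyK0; fset_tac.
    by rewrite (negbTE (old_vertex xK)) (negbTE (old_vertex yK)) -fK // /g0 (negbTE nsxy).
  have psK : [fset p] `|` s \in K by rewrite (fsetUidPr _ _ _) // fsub1set.
  have vs : g v v = false by apply: (cocycle_refl gK); rewrite -[[fset v]]fsetU0; apply: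
      in_new; rewrite ?fset0U ?fsubset0 -?cardfs_gt0 // ltnW.
  case: (eqVneq x v) => [xv|xv]; case: (eqVneq y v) => [yv|yv].
  + by rewrite xv yv vs addbb.
  + rewrite xv -gv; last first.
      apply: complexS cK _ xysK; apply: fsetSU; rewrite fsub1set !inE yv eqxx orbT //.
    rewrite fv; last first.
      apply: complexS cK _ xysK; apply: fsetSU; rewrite fsub1set !inE yv eqxx orbT //.
    by rewrite addbC.
  + rewrite yv; apply: fv; apply: complexS cK _ xysK; apply: fsetSU.
    by rewrite fsub1set !inE xv eqxx.
  + by move: vxy; rewrite !inE ![v == _]eq_sym (negbTE xv) (negbTE yv).
- have [|f fK] := hK (fun x y => g (collapse p x) (collapse p y)).
    by move=> x y z /(collapseP ps); rewrite image_fset3; exact: gK.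
  exists f => x y xyK.
  have xK : [fset x] \in K by apply: complexS cK _ xyK; fset_tac.
  have yK : [fset y] \in K by apply: complexS cK _ xyK; fset_tac.
  (* If [xy] is the subdivided edge [s], then [f] has to be compared along the two halves, which the
     collapse sends to [xp] and [yp]; [p] is one of the ends. *)
  case sxy: (s `<=` [fset x; y]); last first.
    by rewrite -fK ?(collapse_old p xK) ?(collapse_old p yK) //; apply: in_old; rewrite ?sxy.
  have pv : collapse p v = p by rewrite /collapse eqxx.
  have xsK : [fset x] `|` s \in K by apply: complexS cK _ xyK; rewrite fsubUset sxy andbT;
      fset_tac.
  have ysK : [fset y] `|` s \in K by apply: complexS cK _ xyK; rewrite fsubUset sxy andbT;
      fset_tac.
  have gx : g x p = f x (+) f v.
    by rewrite -(fK _ _ (v_edge xsK)) pv collapse_old.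
  have gy : g y p = f y (+) f v.
    by rewrite -(fK _ _ (v_edge ysK)) pv collapse_old.
  have pxy : p \in [fset x; y] := fsubsetP sxy _ ps.
  have : g x p (+) g p y = g x y.
    apply: gK; apply: complexS cK _ xyK.
    by apply/fsubsetP=> i; rewrite !inE -orbA => /or3P[->|/eqP->|->]; rewrite ?orbT //; move:
        pxy; rewrite !inE.
  rewrite (@cocycle_sym _ _ p y gK) //; last first.
    by apply: complexS cK _ xyK; rewrite fsubUset !fsub1set pxy !inE eqxx orbT.
  by rewrite gx gy => <-; case: (f x); case: (f v); case: (f y).
Qed.

End Star.

Lemma acyclic_star k K s v : is_complex K -> s \in K -> s != fset0 ->
  v \notin vertices K -> acyclic k K <-> acyclic k (stellar_subdivision K s v).
Proof.
move=> cK sK s0 vK; case: (ltnP 1 #|` s|) => s2.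
  case: k => [|[|[|k]]] //=; [exact: conn0_star|exact: conn1_star|].
  by rewrite (conn1_star cK sK s2 vK) (H1_star cK sK s2 vK).
have /cardfs1P[x sE] : #|` s| == 1%N by rewrite eqn_leq s2 cardfs_gt0.
rewrite sE in sK *; rewrite star_vertex //; apply: acyclic_relabel => // i j iK jK.
case: eqVneq => [->|ix]; case: eqVneq => [->|jx] // ij.
  by rewrite ij jK in vK.
by rewrite -ij iK in vK.
Qed.

Section Join.
Variables (L : simplex_family) (X : {fset nat}).
Hypotheses (cL : is_complex L) (X2 : 1 < #|` X|) (XL : fdisjoint X (vertices L)).

Let J := join (simplex_bd X) L.

Let cJ : is_complex J.
Proof. by apply: join_complex => //; apply: simplex_bd_complex; rewrite -cardfs_gt0 ltnW. Qed.

Let inJ t u : t `<=` X -> #|` t| < #|` X| -> u \in L -> t `|` u \in J.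
Proof.
move=> tX ct uL; apply/in_joinP; exists t, u; split=> //.
by rewrite in_simplex_bd tX card_nsub.
Qed.

Let Jsplit t : t \in J -> t `\` X \in L.
Proof.
case/in_joinP=> s [u [+ uL ->]]; rewrite in_simplex_bd => /andP[sX _].
by apply: complexS cL _ uL; fset_tac.
Qed.

Let vertexJ w : [fset w] \in J -> w \in X \/ [fset w] \in L.
Proof.
move/Jsplit; case wX: (w \in X); [by left|right].
by rewrite -(_ : [fset w] `\` X = [fset w]) //; apply/fsetDidPl; rewrite fdisjoint1X wX.
Qed.

Let J1 x : x \in X -> [fset x] \in J.
Proof. by move=> xX; rewrite -[_ x]fsetU0; apply: inJ; rewrite ?fsub1set ?cardfs1 ?complex0. Qed.

Let J2 x l : x \in X -> [fset l] \in L -> [fset x; l] \in J.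
Proof. by move=> xX lL; apply: inJ; rewrite ?fsub1set ?cardfs1. Qed.

Let J3 x l l' : x \in X -> [fset l; l'] \in L -> [fset x; l; l'] \in J.
Proof. by move=> xX lL; rewrite -fsetUA; apply: inJ; rewrite ?fsub1set ?cardfs1. Qed.

Let J2X x y : 2 < #|` X| -> x \in X -> y \in X -> [fset x; y] \in J.
Proof.
move=> X3 xX yX; rewrite -[_ `|` _]fsetU0; apply: inJ; rewrite ?complex0 //.
  by rewrite fsubUset !fsub1set xX.
exact: leq_ltn_trans (card_fset2_le _ _) _.
Qed.

Let J3X x y l : 2 < #|` X| -> x \in X -> y \in X -> [fset l] \in L ->
  [fset x; y; l] \in J.
Proof.
move=> X3 xX yX lL; apply: inJ; rewrite ?fsubUset ?fsub1set ?xX //.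
exact: leq_ltn_trans (card_fset2_le _ _) _.
Qed.

Lemma conn0_join : conn0 J.
Proof.
have /fset0Pn[x xX] : X != fset0 by rewrite -cardfs_gt0 ltnW.
by exists x; exact: J1.
Qed.

Lemma conn1_join : 2 < #|` X| \/ conn0 L -> conn1 J.
Proof.
have /fset0Pn[x xX] : X != fset0 by rewrite -cardfs_gt0 ltnW.
move=> h; split=> [|f fJ]; first exact: conn0_join.
suff fE w : [fset w] \in J -> f w = f x by move=> u w /fE-> /fE->.
case/vertexJ=> [wX|wL]; last by apply/esym/fJ/J2.
case: h => [X3|[l lL]]; first by apply/fJ/J2X.
by rewrite (fJ w l) ?(fJ x l) //; exact: J2.
Qed.

Let LnX l : [fset l] \in L -> l \notin X.
Proof.
move=> lL; apply/negP=> lX; move/fdisjointP/(_ _ lX)/negP: XL; apply.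
by rewrite in_vertices.
Qed.

Let JnX t : t \in J -> ~~ (X `<=` t).
Proof.
case/in_joinP=> s [u [+ uL ->]]; rewrite in_simplex_bd => /andP[_ nXs].
apply: contra nXs => /fsubsetP h; apply/fsubsetP=> i iX.
move: (h i iX); rewrite inE => /orP[//|iu].
move/fdisjointP/(_ _ iX)/negP: XL; case.
by apply/in_verticesP; exists u.
Qed.

Lemma H1_join : [\/ 3 < #|` X|, 2 < #|` X| /\ conn0 L | conn1 L] -> H1 J.
Proof.
have /fset0Pn[x xX] : X != fset0 by rewrite -cardfs_gt0 ltnW.
move=> h g gJ.
have edgeJ (u w : nat) : [fset u; w] \in J -> [fset u] \in J /\ [fset w] \in J.
  by move=> uwJ; split; apply: complexS cJ _ uwJ; fset_tac.
have edgeL (u w : nat) : [fset u; w] \in J -> [fset u] \in L -> [fset w] \in L -> [fset u; w]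
    \in L.
  move=> uwJ uL wL; have := Jsplit uwJ; rewrite (_ : _ `\` X = [fset u; w]) //.
  by apply/fsetDidPl/fdisjointP=> i; rewrite !inE => /orP[] /eqP->; exact: LnX.
(* With three points in [X], the point [x] is adjacent to every vertex and [g x] is a potential.
   Only the triangle with all its vertices in [X] may be missing, when [X] has exactly three points;
   a vertex [l] of [L] then replaces it. *)
case: (ltnP 2 #|` X|) => X3.
  exists (g x) => u w uwJ; have [uJ wJ] := edgeJ _ _ uwJ.
  suff : g x u (+) g u w = g x w by move=> <-; case: (g x u); case: (g u w).
  case/vertexJ: uJ => [uX|uL]; case/vertexJ: wJ => [wX|wL].
  + case: (ltnP 3 #|` X|) => X4.
      apply: gJ; rewrite -[_ `|` _]fsetU0; apply: inJ; rewrite ?complex0 //.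
        by rewrite !fsubUset !fsub1set xX uX wX.
      exact: leq_ltn_trans (card_fset3_le _ _ _) _.
    have [l lL] : conn0 L by case: h => [|[]|[]] //; rewrite ltnNge X4.
    have := gJ x u l (J3X X3 xX uX lL); have := gJ u w l (J3X X3 uX wX lL).
    have := gJ x w l (J3X X3 xX wX lL).
    by case: (g x u); case: (g u w); case: (g x w); case: (g u l); case: (g w l); case: (g x l).
  + by apply: gJ; exact: J3X.
  + by apply: gJ; rewrite -fsetUA [[fset u; w]]fsetUC fsetUA; exact: J3X.
  + by apply: gJ; apply: J3 => //; exact: edgeL.
have [[l0 l0L] c1] : conn1 L by case: h => [|[]|//]; rewrite ltnNge ?X3 // ltnW.
(* Here the join is a suspension with non-adjacent poles. The value at the other pole is read along
   a path through [l0]; connectedness of [L] makes it independent of [l0]. *)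
exists (fun w => if w \in X then g w l0 (+) g x l0 else g x w) => u w uwJ.
have XLE (a l : nat) : a \in X -> [fset l] \in L -> g a l (+) g x l = g a l0 (+) g x l0.
  move=> aX lL; apply: (c1 (fun l => g a l (+) g x l)) => // i j ijL.
  rewrite -(gJ a i j) ?J3 // -(gJ x i j) ?J3 //.
  by case: (g a i); case: (g i j); case: (g x i).
have [uJ wJ] := edgeJ _ _ uwJ.
case/vertexJ: uJ => [uX|uL]; case/vertexJ: wJ => [wX|wL].
+ have -> : w = u.
    have := JnX uwJ; case: (eqVneq w u) => // wu /negP[].
    suff /eqP <- : [fset u; w] == X by [].
    by rewrite eqEfcard fsubUset !fsub1set uX wX cardfs2 eq_sym wu.
  by rewrite (cocycle_refl gJ) ?J1 // addbb.
+ rewrite uX (negbTE (LnX wL)) -(XLE u w) //.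
  by case: (g u w); case: (g x w).
+ rewrite wX (negbTE (LnX uL)) -(XLE w u) // (cocycle_sym gJ) //.
  by case: (g w u); case: (g x u).
+ rewrite (negbTE (LnX uL)) (negbTE (LnX wL)) -(gJ x u w); last by apply: J3 => //; exact: edgeL.
  by case: (g x u); case: (g u w).
Qed.

End Join.

(** Joining with an [m]-sphere raises the degree of reduced cohomology by [m + 1]. *)
Lemma acyclic_join k m L X : is_complex L -> #|` X| = m.+2 ->
  fdisjoint X (vertices L) -> acyclic k L ->
  acyclic (k + m.+1) (join (simplex_bd X) L).
Proof.
move=> cL cX XL; have X2 : 1 < #|` X| by rewrite cX.
have c0 : conn0 L -> 0 < k -> conn0 L by [].
case: k {c0} => [|[|k]] /=; rewrite ?add0n.
- case: m cX => [|[|m]] cX _ /=; first exact: conn0_join.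
    by apply: conn1_join; rewrite ?cX //; left.
  by split; [apply: conn1_join|apply: H1_join]; rewrite ?cX //; [left|apply: Or31].
- case: m cX => [|m] cX cL0 /=; first by apply: conn1_join => //; right.
  split; first by apply: conn1_join => //; right.
  by apply: H1_join => //; apply: Or32; rewrite cX.
- move=> ak; rewrite addnS /=; have c1 : conn1 L by case: k ak => // k [].
  split; first by apply: conn1_join => //; right; case: c1.
  by apply: H1_join => //; apply: Or33.
Qed.

End Acyclicity.

Lemma stellar_equiv_complex (K L : simplex_family) :
  stellar_equiv K L -> is_complex K <-> is_complex L.
Proof.
elim=> {K L} [K L []|K|K L _|K L M _ IH1 _ IH2].
- by move=> s v cK sK s0 vK; split=> // _; exact: star_complex.
- by move=> f cK finj; split=> // _; exact: relabel_complex.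
- by [].
- by case.
- by split=> h; [apply/IH2/IH1|apply/IH1/IH2].
Qed.

Lemma stellar_equiv_sym (K L : simplex_family) :
  stellar_equiv K L -> stellar_equiv L K.
Proof. exact: rst_sym. Qed.

Lemma stellar_equiv_trans (K L M : simplex_family) :
  stellar_equiv K L -> stellar_equiv L M -> stellar_equiv K M.
Proof. exact: rst_trans. Qed.

(** * Invariants of 2-spheres and of closed 3-manifolds *)

Section SphereInvariants.
Implicit Types (K L : simplex_family) (s t u X : {fset nat}).

Lemma H1_star_any K s v : is_complex K -> s \in K -> s != fset0 ->
  v \notin vertices K -> H1 K <-> H1 (stellar_subdivision K s v).
Proof.
move=> cK sK s0 vK; case: (ltnP 1 #|` s|) => s2; first exact: H1_star.
have /cardfs1P[x sE] : #|` s| == 1%N by rewrite eqn_leq s2 cardfs_gt0.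
rewrite sE in sK *; rewrite star_vertex //.
apply: (relabel_iff H1_relabel) => // i j iK jK.
case: eqVneq => [->|ix]; case: eqVneq => [->|jx] // ij.
  by rewrite ij jK in vK.
by rewrite -ij iK in vK.
Qed.

(** In a sphere of dimension [n - 1] the link of a simplex with [j] vertices is a sphere of
    dimension [n - 1 - j]. *)
Definition acyclic_link n j K := acyclic (n - j) K.

Lemma acyclic_link_star n : star_invariant (acyclic_link n).
Proof. by move=> k L s v cL sL s0 vL; exact: acyclic_star. Qed.

Lemma acyclic_link_relabel n : relabel_invariant (acyclic_link n).
Proof. by move=> k L f cL finj; exact: acyclic_relabel. Qed.

Lemma acyclic_link_join n : join_stable (acyclic_link n).
Proof.
move=> j m L X cL cX XL h.
apply: acyclic_le (acyclic_join cL cX XL h); lia.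
Qed.

(* In a closed 3-manifold the links of vertices are simply connected, but of
   the whole manifold only the first cohomology is recorded. *)
Definition manifold_link j K := if j is 0 then H1 K else acyclic_link 4 j K.

Lemma manifold_link_star : star_invariant manifold_link.
Proof.
move=> [|k] L s v cL sL s0 vL; first exact: H1_star_any.
exact: (@acyclic_link_star 4 k.+1).
Qed.

Lemma manifold_link_relabel : relabel_invariant manifold_link.
Proof.
move=> [|k] L f cL finj; first exact: (relabel_iff H1_relabel).
exact: (@acyclic_link_relabel 4 k.+1).
Qed.

Lemma manifold_link_join : join_stable manifold_link.
Proof.
move=> [|j] m L X cL cX XL; last exact: (@acyclic_link_join 4 j.+1).
move/(acyclic_join cL cX XL) => h.
have : acyclic 3 (join (simplex_bd X) L) by apply: acyclic_le h; lia.
by case.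
Qed.

(** Imposed on all links of a complex, this says that every edge lies in exactly two triangles,
    triangles are maximal, and no simplex is larger. *)
Definition thin_link j K :=
  match j with
  | 0 | 1 => True
  | 2 => exists p q, p != q /\ K = [fset fset0; [fset p]; [fset q]]
  | 3 => K = [fset fset0]
  | _ => False
  end.

Lemma thin_link_relabel : relabel_invariant thin_link.
Proof.
move=> k; apply: relabel_iff => L f cL finj; case: k => [|[|[|[|k]]]] //=.
- case=> p [q [pq LE]]; exists (f p), (f q); split.
    apply: contra_neq pq => /finj-> //; rewrite in_vertices // LE !inE eqxx ?orbT //.
  apply/fsetP=> t; apply/in_relabelP/idP => [[s + ->]|].
    rewrite LE !inE -orbA => /or3P[]/eqP->; rewrite ?imfset0 ?image_fset1 ?eqxx ?orbT //.
  rewrite !inE -orbA => /or3P[]/eqP->.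
  + by exists fset0; rewrite ?imfset0 // LE !inE eqxx.
  + by exists [fset p]; rewrite ?image_fset1 // LE !inE eqxx ?orbT.
  + by exists [fset q]; rewrite ?image_fset1 // LE !inE eqxx ?orbT.
- move=> ->; apply/fsetP=> t; apply/in_relabelP/idP => [[s + ->]|].
    by rewrite !inE => /eqP->; rewrite imfset0.
  by rewrite !inE => /eqP->; exists fset0; rewrite ?imfset0 // inE.
Qed.

Lemma card_thin p q t : t \in [fset fset0; [fset p]; [fset q]] -> #|` t| <= 1.
Proof. by rewrite !inE -orbA => /or3P[]/eqP->; rewrite ?cardfs0 ?cardfs1. Qed.

(** From index 2 on, the property allows no simplex with two vertices. A subdivision at a simplex
    with two vertices has [s] before it and the edge [pv] after it, so both sides fail. *)
Lemma thin_link_star : star_invariant thin_link.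
Proof.
move=> k L s v cL sL s0 vL; case: (ltnP 1 #|` s|) => s2; last first.
  have /cardfs1P[x sE] : #|` s| == 1%N by rewrite eqn_leq s2 cardfs_gt0.
  rewrite sE in sL *; rewrite star_vertex //.
  apply: thin_link_relabel => // i j iK jK.
  case: eqVneq => [->|ix]; case: eqVneq => [->|jx] // ij.
    by rewrite ij jK in vL.
  by rewrite -ij iK in vL.
have /fset0Pn[p ps] := s0; have vs := vertices_notin vL sL.
have pv : p != v by apply: contraTneq ps => ->.
have pvL : [fset p; v] \in stellar_subdivision L s v.
  rewrite in_star // (_ : [fset p; v] `\ v = [fset p]); last first.
    by apply/fsetP=> i; rewrite !inE; case: (eqVneq i v) => [->|]; rewrite ?orbF //= eq_sym
        (negbTE pv).
  have -> : [fset p] `|` s = s by apply/fsetUidPr; rewrite fsub1set.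
  by apply/orP; right; rewrite sL !inE eqxx orbT /=; apply: card_nsub; rewrite cardfs1.
have c2 : #|` [fset p; v]| = 2 by rewrite cardfs2 pv.
case: k => [|[|[|[|k]]]] //=; split.
- by case=> x [y [_ LE]]; rewrite LE in sL; move/card_thin: sL; rewrite leqNgt s2.
- by case=> x [y [_ LE]]; rewrite LE in pvL; move/card_thin: pvL; rewrite c2.
- by move=> LE; rewrite LE inE (negbTE s0) in sL.
- by move=> LE; rewrite LE inE in pvL; move/eqP: pvL => pvE; rewrite pvE cardfs0 in c2.
Qed.

Lemma simplex_bd0 x : simplex_bd [fset x] = [fset fset0].
Proof.
apply/fsetP=> y; rewrite in_simplex_bd inE fsub1set fsubset1.
apply/idP/eqP => [/andP[/orP[/eqP->|/eqP//]]|->]; first by rewrite inE eqxx.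
by rewrite eqxx orbT inE.
Qed.

Lemma joinx0 K : join K [fset fset0] = K.
Proof.
apply/fsetP=> t; apply/in_joinP/idP => [[s [u [sK /fset1P-> ->]]]|tK].
  by rewrite fsetU0.
by exists t, fset0; rewrite inE fsetU0.
Qed.

Lemma sub_fset2 (t : {fset nat}) (p q : nat) : t `<=` [fset p; q] ->
  t = (if p \in t then [fset p] else fset0) `|` (if q \in t then [fset q] else fset0).
Proof.
move=> /fsubsetP tpq; apply/fsetP=> i; apply/idP/idP => [it|].
  by have := tpq i it; rewrite !inE => /orP[]/eqP iE; rewrite -iE it inE eqxx ?orbT.
by rewrite inE => /orP[]; case: ifP => // pt; rewrite inE => /eqP->.
Qed.

Lemma simplex_bd2 (p q : nat) : p != q ->
  simplex_bd [fset p; q] = [fset fset0; [fset p]; [fset q]].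
Proof.
move=> pq; apply/fsetP=> t; rewrite in_simplex_bd !inE.
apply/andP/idP => [[/sub_fset2 tE]|].
  by rewrite fsubUset !fsub1set tE; case: (p \in t); case: (q \in t);
    rewrite ?fsetU0 ?fset0U ?inE ?eqxx ?orbT.
by rewrite -orbA => /or3P[]/eqP->; rewrite ?fsub0set ?fsub1set ?fsubUset ?fsub1set !inE ?eqxx
    ?orbT //=
  ?(eq_sym q) ?(negbTE pq) ?andbF.
Qed.

Lemma cardfs2E X : #|` X| = 2 -> exists p q, p != q /\ X = [fset p; q].
Proof.
move=> cX; have /fset0Pn[p pX] : X != fset0 by rewrite -cardfs_gt0 cX.
have /cardfs1P[q qE] : #|` X `\ p| == 1%N by move: cX; rewrite (cardfsD1 p) pX add1n => -[->].
have : q \in X `\ p by rewrite qE inE.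
rewrite !inE => /andP[qp qX]; exists p, q; split; first by rewrite eq_sym.
by rewrite -(fsetD1K pX) qE.
Qed.

Lemma thin_link_join : join_stable thin_link.
Proof.
move=> [|[|[|[|j]]]] m L X cL cX XL //=; case: m cX => [|m] //= cX LE.
rewrite LE joinx0; have [p [q [pq ->]]] := cardfs2E cX.
by exists p, q; rewrite simplex_bd2.
Qed.

Lemma link_simplex X t : t `<=` X -> link (simplex X) t = simplex (X `\` t).
Proof.
move=> tX; apply/fsetP=> u; rewrite in_linkE; last exact: simplex_complex.
rewrite !in_simplex fsubUset tX /= fsubsetD andbC fdisjoint_sym //.
Qed.

Lemma link_simplex_bd X t : t \in simplex_bd X ->
  link (simplex_bd X) t = simplex_bd (X `\` t).
Proof.
move=> tX; have := tX; rewrite in_simplex_bd => /andP[tX0 nXt].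
have X0 : X != fset0 by apply: contraNneq nXt => ->.
apply/fsetP=> u; rewrite in_linkE; last exact: simplex_bd_complex.
rewrite !in_simplex_bd fsubUset tX0 /= fsubsetD fdisjoint_sym fsubDset.
by rewrite andbA [fdisjoint _ _ && _]andbC.
Qed.

Lemma acyclic_simplex_bd X m : #|` X| = m.+1 -> acyclic m (simplex_bd X).
Proof.
case: m => [|m] // cX.
have c0 : is_complex [fset (fset0 : {fset nat})].
  by split=> [|s /fset1P-> t]; rewrite ?inE // fsubset0.
have := @acyclic_join 0 m _ X c0 cX; rewrite joinx0; apply=> //.
apply/fdisjointP=> i _; apply/in_verticesP=> -[s /fset1P->].
by rewrite inE.
Qed.

Lemma acyclic_simplex X m : X != fset0 -> acyclic m (simplex X).
Proof.
case/fset0Pn=> x xX; have c0 : conn0 (simplex X) by exists x; rewrite in_simplex fsub1set.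
have c1 : conn1 (simplex X).
  split=> // f fX y z; rewrite !in_simplex !fsub1set => yX zX; apply: fX.
  by rewrite in_simplex fsubUset !fsub1set yX.
case: m => [|[|[|m]]] //; split=> // g gX; exists (g x) => y z; rewrite in_simplex => yzX.
suff : g x y (+) g y z = g x z by move=> <-; case: (g x y); case: (g y z).
by apply: gX; rewrite in_simplex -fsetUA fsubUset fsub1set xX.
Qed.

Lemma link_link K s t : is_complex K -> fdisjoint s t -> s `|` t \in K ->
  link (link K s) t = link K (s `|` t).
Proof.
move=> cK dst stK; have sK : s \in K by apply: complexS cK _ stK; rewrite fsubsetUl.
apply/fsetP=> u; rewrite in_linkE; last exact: link_complex.
rewrite !in_linkE // fdisjointXU dst /= -fsetUA fdisjointUX.
by rewrite andbA [fdisjoint t u && _]andbC.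
Qed.

End SphereInvariants.

Section SphereStructure.
Implicit Types (s t u : {fset nat}).

Lemma locally_acyclic_ball_sphere (K : simplex_family) :
  stellar_ball 2 K \/ stellar_sphere 2 K -> locally (acyclic_link 3) K.
Proof.
have inv := locally_stellar (@acyclic_link_star 3) (@acyclic_link_relabel 3)
    (@acyclic_link_join 3).
case=> /inv -> t; rewrite /acyclic_link.
  rewrite in_simplex => tX; rewrite link_simplex //.
  have := fsubset_leq_card tX; rewrite (card_fseq _) /= => tc.
  have cD := cardfsDS tX; rewrite (card_fseq _) /= in cD.
  case: (ltnP #|` t| 3) => t3.
    by apply: acyclic_simplex; rewrite -cardfs_gt0 cD subn_gt0.
  by have /eqP-> : 3 - #|` t| == 0 by rewrite subn_eq0.
move=> tX; rewrite link_simplex_bd //; apply: acyclic_simplex_bd.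
have := tX; rewrite in_simplex_bd => /andP[tX0 nXt].
have cD := cardfsDS tX0; rewrite (card_fseq _) /= in cD.
have : 0 < #|` [fset i in iota 1 4] `\` t| by rewrite cardfs_gt0 fsetD_eq0.
by rewrite cD subn_gt0 ltnS => t3; rewrite subSn.
Qed.

Lemma thin_sphere (K : simplex_family) :
  stellar_sphere 2 K -> locally thin_link K.
Proof.
move/(locally_stellar thin_link_star thin_link_relabel thin_link_join) => -> t tX.
rewrite link_simplex_bd //.
have := tX; rewrite in_simplex_bd => /andP[tX0 nXt].
have cD := cardfsDS tX0; rewrite (card_fseq _) /= in cD.
have : 0 < #|` [fset i in iota 1 4] `\` t| by rewrite cardfs_gt0 fsetD_eq0.
rewrite cD => t4; case ct: #|` t| t4 cD => [|[|[|[|k]]]] //= _.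
  move/cardfs2E=> [p [q [pq ->]]]; exists p, q; rewrite simplex_bd2 //.
by move/eqP/cardfs1P=> [x ->]; rewrite simplex_bd0.
Qed.

(** Only the vertex links are given to be balls or spheres. The link of [t] is a link inside the
    link of one of its vertices, which explains the shift from 3 to 4 in the index. *)
Lemma manifold_locally (M : simplex_family) :
  stellar_manifold 3 M -> H1 M -> locally manifold_link M.
Proof.
case=> _ cM Mlink hM t tM.
case ct: #|` t| => [|j].
  by move/eqP: ct; rewrite cardfs_eq0 => /eqP->; rewrite link0.
have /fset0Pn[v vt] : t != fset0 by rewrite -cardfs_gt0 ct.
have vM : [fset v] \in M by apply: complexS cM _ tM; rewrite fsub1set.
have := Mlink v; rewrite in_vertices // => /(_ vM)/locally_acyclic_ball_sphere h.
have dvt : fdisjoint [fset v] (t `\ v) by rewrite fdisjoint1X !inE eqxx.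
have := h (t `\ v); rewrite link_link // ?fsetD1K //.
rewrite in_linkE // fsetD1K // dvt tM => /(_ isT).
by rewrite /acyclic_link /= (_ : #|` t `\ v| = j) //; move: ct; rewrite (cardfsD1 v) vt => -[].
Qed.

End SphereStructure.

(** * Simple connectivity and the first cohomology *)

Section Walks.
Variables (M : simplex_family) (g : nat -> nat -> bool).
Hypotheses (cM : is_complex M) (gM : cocycle M g).

Fixpoint walk (X : nat -> nat) n : bool :=
  if n is n'.+1 then walk X n' (+) g (X n') (X n'.+1) else false.

Lemma walkD X a b : walk X (a + b) = walk X a (+) walk (fun i => X (a + i)%N) b.
Proof. by elim: b => [|b IH]; rewrite ?addn0 ?addbF // !addnS /= IH addbA addnS. Qed.

Lemma eq_walk X Y n : (forall i, i <= n -> X i = Y i) -> walk X n = walk Y n.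
Proof.
elim: n => //= n IH XY; rewrite IH ?XY // => i ni.
by rewrite XY // (leq_trans ni).
Qed.

Lemma walk_telescope X n : [fset X 0] \in M ->
  (forall i, i < n -> [fset X 0; X i; X i.+1] \in M) -> walk X n = g (X 0) (X n).
Proof.
move=> X0; elim: n => [|n IH] XM /=; first by rewrite (cocycle_refl gM).
rewrite IH ?gM ?XM // => i ni; apply: XM; exact: ltnW.
Qed.

(** The Boolean is the sum of [g] along an edge walk. The inductive form makes concatenation and
    reversal immediate; [reach_walk] returns to sequences for the topological part. *)
Inductive reach (x : nat) : nat -> bool -> Prop :=
| reach_refl : [fset x] \in M -> reach x x false
| reach_step y z b : reach x y b -> [fset y; z] \in M -> reach x z (b (+) g y z).

Lemma reach_trans x y z b c : reach x y b -> reach y z c -> reach x z (b (+) c).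
Proof.
move=> xy; elim=> [_|{}z w {}c _ xz zw]; first by rewrite addbF.
by rewrite addbA; exact: reach_step xz zw.
Qed.

Lemma reach_sym x y b : reach x y b -> reach y x b.
Proof.
elim=> [xM|{}y z {}b xy yx yz]; first exact: reach_refl.
have zM : [fset z] \in M by apply: complexS cM _ yz; fset_tac.
have zy : [fset z; y] \in M by rewrite fsetUC.
rewrite addbC (cocycle_sym gM cM yz).
by apply: reach_trans yx; exact: (reach_step (reach_refl zM) zy).
Qed.

Lemma reach_walk x y b : reach x y b -> exists n X,
  [/\ X 0 = x, X n = y, forall i, i < n -> [fset X i; X i.+1] \in M & walk X n = b].
Proof.
elim=> [xM|{}y z {}b _ [n [X [X0 Xn XM Xb]]] yz].
  by exists 0%N, (fun=> x); split.
exists n.+1, (fun i => if i <= n then X i else z); rewrite ltnn; split=> //.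
  move=> i; rewrite ltnS => le_i; case: (eqVneq i n) => [->|ni].
    by rewrite leqnn ltnn Xn.
  have i_n : i < n by rewrite ltn_neqAle ni.
  by rewrite le_i i_n XM.
rewrite /= leqnn ltnn Xn -Xb; congr (_ (+) _).
by apply: eq_walk => i ->.
Qed.

Lemma loops_coboundary : (forall x b, reach x x b -> b = false) ->
  exists f : nat -> bool, forall x y, [fset x; y] \in M -> g x y = f x (+) f y.
Proof.
(* [r x] is a base point common to the whole component of [x], as it depends only on the set of
   vertices that reach [x]. The potential is the sum along any walk from it. *)
move=> loop; pose A x : set nat := fun r => exists b, reach r x b.
pose r x := xget 0%N (A x); exists (fun x => `[< reach (r x) x true >]) => x y xy.
have xM : [fset x] \in M by apply: complexS cM _ xy; fset_tac.
have yM : [fset y] \in M by apply: complexS cM _ xy; fset_tac.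
have rxy : r x = r y.
  rewrite /r; congr xget; apply: funext => u; apply: propext; split=> -[b ub].
    by exists (b (+) g x y); exact: reach_step ub xy.
  by exists (b (+) g y x); apply: reach_step ub _; rewrite fsetUC.
have [b rb] : A x (r x) by apply: (xgetPex 0%N); exists x, false; exact: reach_refl.
have fE z c : reach (r x) z c -> `[< reach (r x) z true >] = c.
  case: c => rc; first by apply/asboolP.
  apply/asboolP => rt; have := reach_trans rc (reach_sym rt).
  by move/loop.
rewrite -rxy (fE x b) // (fE y (b (+) g x y)); last exact: reach_step rb xy.
by case: b {rb}; case: (g x y).
Qed.

End Walks.

(** * Edge loops and null homotopies in the realization *)

Section NullHomotopy.
Import Order.TTheory GRing.Theory Num.Theory.
Local Open Scope classical_set_scope.
Local Open Scope ring_scope.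
Variable R : realType.

Definition square : set (R * R) := `[0, 1]%classic `*` `[0, 1]%classic.

(** Heine-Cantor on the square, with a modulus that can serve as the mesh of a grid. *)
Lemma uniformly_continuous_square (h : R * R -> R) (c : R) : 0 < c ->
  {within square, continuous h} ->
  exists N : nat, forall x y : R * R, square x -> square y ->
    `|x - y| <= N.+1%:R^-1 -> `|h x - h y| < c.
Proof.
move=> c0 /subspace_continuousP hc.
have cA : compact square by apply: compact_setX; exact: segment_compact.
move/compact_near_coveringP: cA => /(_ nat \oo (fun N x => forall y, square y ->
  square x -> `|x - y| <= N.+1%:R^-1 -> `|h x - h y| < c) _).
case=> [x Ax|N _ NP].
- have /cvgrPdist_lt/(_ (c / 2)) := hc x Ax; rewrite divr_gt0 // => /(_ isT).
  rewrite near_withinE => /nbhs_ballP[e /= e0 eP].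
  have [N Ne] : exists N : nat, N.+1%:R^-1 < e / 2.
    have e2 : 0 < e / 2 by rewrite divr_gt0.
    exists (Num.truncn (e / 2)^-1); rewrite invf_plt ?posrE //.
    by rewrite truncnS_gt.
  exists (ball x (e / 2), [set n | (N <= n)%N]).
    by split; [apply: nbhsx_ballx; rewrite divr_gt0|exists N].
  case=> x' n [/= xx' Nn] y Ay Ax' x'y.
  have hx' : `|h x - h x'| < c / 2.
    by apply: eP => //; apply: le_ball xx'; rewrite ler_pdivrMr // ler_pMr // ler1n.
  have hy : `|h x - h y| < c / 2.
    apply: eP => //; have x'ye : ball x' (e / 2) y.
      rewrite -ball_normE /ball_ /=; apply: le_lt_trans x'y (le_lt_trans _ Ne).
      by rewrite lef_pV2 ?posrE ?ltr0n // ler_nat.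
    by have := ball_triangle xx' x'ye; rewrite -splitr.
  rewrite (_ : h x' - h y = (h x - h y) - (h x - h x')); last by ring.
  by rewrite (le_lt_trans (ler_normB _ _)) // [ltRHS]splitr ltrD.
- by exists N => x y Ax Ay xy; apply: (NP N) => //=.
Qed.

(** The tent function max (0, 1 - |u|), written with absolute values so that it inherits the
    continuity of the norm. *)
Definition hat (u : R) : R := (1 - `|u| + `|1 - `|u| |) / 2.

Lemma hat_ge0 u : 0 <= hat u.
Proof.
by have := ler_norm (- (1 - `|u|)); rewrite normrN /hat => h; apply: divr_ge0; lra.
Qed.

Lemma hat_out u : 1 <= `|u| -> hat u = 0.
Proof. by move=> u1; rewrite /hat (@ler0_norm _ (1 - `|u|)); [ring|lra]. Qed.

Lemma hat_in u : `|u| <= 1 -> hat u = 1 - `|u|.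
Proof. by move=> u1; rewrite /hat (@ger0_norm _ (1 - `|u|)); [field|lra]. Qed.

Lemma hat_continuous (n i : nat) : continuous (fun t : R => hat (n%:R * t - i%:R) : R).
Proof.
move=> t; have h : (fun t : R => 1 - `|n%:R * t - i%:R| : R) @ t -->
    (1 - `|n%:R * t - i%:R| : R).
  apply: cvgB; first exact: cvg_cst.
  apply: cvg_norm; apply: cvgB; last exact: cvg_cst.
  by apply: cvgMr; exact: cvg_id.
by apply: cvgMl; apply: cvgD => //; exact: cvg_norm.
Qed.

(* The polygonal path through the vertices [X 0, ..., X n], with [X i] reached
   at time [i / n]. *)
Definition polygon (X : nat -> nat) n (t : R) : {ptws nat -> R} :=
  fun j => \sum_(i < n.+1) (if X i == j then hat (n%:R * t - i%:R) else 0).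

Lemma polygon_continuous X n (A : set R) : {within A, continuous polygon X n}.
Proof.
apply: continuous_subspaceT => t; apply/pointwise_cvgP => j.
have addc : continuous (fun x : R * R => x.1 + x.2) by exact: add_continuous.
have := @continuous_big R 'I_n.+1 (fun x y => x + y) 0 xpredT addc R (index_enum _)
  (fun (i : 'I_n.+1) u => if X i == j then hat (n%:R * u - i%:R) else 0).
apply=> i _ u; case: (X i == j); [exact: hat_continuous|exact: cvg_cst].
Qed.

Lemma segment_index n (u : R) : (0 < n)%N -> 0 <= u <= n%:R ->
  exists2 i, (i < n)%N & i%:R <= u <= i.+1%:R.
Proof.
case: n => // n _; elim: n => [|n IH] /andP[u0 un]; first by exists 0%N; rewrite // u0.
case: (lerP u n.+1%:R) => h.
  by have [|i i_n iu] := IH; [rewrite u0|exists i => //; exact: ltnW].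
by exists n.+1; rewrite // (ltW h).
Qed.

Section Segment.
Variables (X : nat -> nat) (n i : nat) (t : R).
Hypotheses (ltin : (i < n)%N) (it : i%:R <= n%:R * t <= i.+1%:R).

Let h k := hat (n%:R * t - k%:R).

Let h_far k : k != i -> k != i.+1 -> h k = 0.
Proof.
move=> ki ki1; apply: hat_out; case/andP: it => it1 it2.
case: (ltngtP k i) ki => // [ki|ik] _.
  have ki' : k%:R + 1 <= i%:R :> R by rewrite natr1 ler_nat.
  by have := ler_norm (n%:R * t - k%:R); lra.
have ik' : i.+1%:R + 1 <= k%:R :> R.
  by rewrite natr1 ler_nat ltn_neqAle eq_sym ki1.
by have := ler_norm (- (n%:R * t - k%:R)); rewrite normrN; lra.
Qed.

Let h_near : h i + h i.+1 = 1.
Proof.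
case/andP: it => it1 it2; rewrite -natr1 in it2; rewrite /h -natr1 !hat_in.
- rewrite ger0_norm ?subr_ge0 // ler0_norm; last by lra.
  by ring.
- by rewrite ler_norml; apply/andP; split; lra.
- by rewrite ger0_norm ?subr_ge0 //; lra.
Qed.

Lemma polygon_ge0 j : 0 <= polygon X n t j.
Proof. by apply: sumr_ge0 => k _; case: ifP => // _; exact: hat_ge0. Qed.

Lemma polygon_out j : j \notin [fset X i; X i.+1]%fset -> polygon X n t j = 0.
Proof.
rewrite !inE negb_or => /andP[ji ji1]; apply: big1 => k _; case: eqP => // kj.
by apply: h_far; [apply: contraNneq ji|apply: contraNneq ji1] => <-; apply/eqP.
Qed.

Lemma polygon_sum : \sum_(j <- [fset X i; X i.+1]%fset) polygon X n t j = 1.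
Proof.
set s := [fset _; _]%fset; rewrite exchange_big /=.
transitivity (\sum_(k < n.+1) h k).
  apply: eq_bigr => k _; case ks: (X k \in s).
    rewrite (bigD1_seq (X k)) ?fset_uniq //= eqxx big1 ?addr0 // => j jk.
    by rewrite eq_sym (negbTE jk).
  rewrite big_seq big1 => [|j js].
    apply/esym/h_far; apply: contraFneq ks => ->; by rewrite !inE eqxx ?orbT.
  by case: eqP => // kj; rewrite kj js in ks.
have i1 : (i < n.+1)%N by exact: leqW.
rewrite (bigD1 (Ordinal i1)) //= (bigD1 (Ordinal (ltin : i.+1 < n.+1)%N)) /=; last first.
  by rewrite -val_eqE /= gtn_eqF.
rewrite big1 ?addr0 ?h_near // => k /andP[ki ki1].
by apply: h_far; rewrite -val_eqE in ki ki1.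
Qed.

End Segment.

Lemma polygon_vertex X n i t j : n%:R * t = i%:R -> j != X i -> polygon X n t j = 0.
Proof.
move=> ti ji; apply: big1 => k _; case: eqP => // kj.
apply: hat_out; rewrite ti; have ki : (k : nat) != i by apply: contraNneq ji => <-; apply/eqP.
case: (ltngtP (k : nat) i) ki => // [ki|ik] _.
  have ki' : k%:R + 1 <= i%:R :> R by rewrite natr1 ler_nat.
  by have := ler_norm (i%:R - k%:R : R); lra.
have ik' : i%:R + 1 <= k%:R :> R by rewrite natr1 ler_nat.
by have := ler_norm (- (i%:R - k%:R : R)); rewrite normrN; lra.
Qed.

Variable M : simplex_family.
Hypothesis cM : is_complex M.

Let V : seq nat := vertices M.
(** At most [size V] coordinates, all of them smaller than [c], would have a sum below 1. *)
Let c : R := (size V).+1%:R^-1.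

Let c_gt0 : 0 < c. Proof. by rewrite invr_gt0 ltr0n. Qed.

(** A simplicial approximation: the chosen vertex has a coordinate bounded below by [c], so the
    coordinate stays positive at all points whose coordinates differ by less than [c]. *)
Definition label (p : {ptws nat -> R}) : nat := nth 0%N V (find (fun i => c <= p i) V).

Lemma labelP p : realization (R := R) M p -> label p \in V /\ c <= p (label p).
Proof.
case=> p0 [s [sM ps p1]].
have h : has (fun i => c <= p i) V; last first.
  by split; [apply: mem_nth; rewrite -has_find|exact: (nth_find 0%N h)].
apply/negPn/negP => /hasPn hV.
have : \sum_(i <- s) p i <= \sum_(i <- s) c.
  rewrite big_seq [leRHS]big_seq; apply: ler_sum => i is_.
  have := hV i; rewrite -ltNge => /(_ _)/ltW; apply.
  by apply/in_verticesP; exists s.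
rewrite p1 big_const_seq count_predT iter_addr_0 -mulr_natl => h1.
have : (size s)%:R * c < 1 :> R.
  rewrite /c ltr_pdivrMr ?ltr0n // mul1r ltr_nat ltnS.
  apply: uniq_leq_size; first exact: fset_uniq.
  by move=> i is_; apply/in_verticesP; exists s.
by rewrite ltNge h1.
Qed.

Lemma support_simplex p t : realization (R := R) M p -> (forall i, i \in t -> 0 < p i) -> t \in M.
Proof.
case=> p0 [s [sM ps p1]] pt; apply: complexS cM _ sM; apply/fsubsetP=> i it.
by apply/negPn/negP=> /ps pi0; have := pt i it; rewrite pi0 ltxx.
Qed.

Lemma uniform_coordinates (H : R * R -> {ptws nat -> R}) :
  {within square, continuous H} ->
  exists N : nat, forall x y : R * R, square x -> square y ->
    `|x - y| <= N.+1%:R^-1 -> forall j, j \in V -> `|H x j - H y j| < c.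
Proof.
move=> Hc; have Hj j : exists N : nat, forall x y : R * R, square x -> square y ->
    `|x - y| <= N.+1%:R^-1 -> `|H x j - H y j| < c.
  apply: uniformly_continuous_square => //.
  apply/subspace_continuousP => x Ax.
  by move/subspace_continuousP: Hc => /(_ x Ax)/pointwise_cvgP; apply.
elim: V => [|j W [N NP]]; first by exists 0%N.
have [N' NP'] := Hj j; exists (maxn N N') => x y Ax Ay xy k.
have le_N n : (n <= maxn N N')%N -> `|x - y| <= n.+1%:R^-1.
  move=> nN; apply: le_trans xy _.
  by rewrite lef_pV2 ?posrE ?ltr0n // ler_nat.
rewrite inE => /orP[/eqP->|kW].
  by apply: NP' => //; apply: le_N; rewrite leq_maxr.
by apply: NP => //; apply: le_N; rewrite leq_maxl.
Qed.

(** All three labels have a positive coordinate at the single point [H x], hence belong to its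
    supporting simplex. *)
Lemma square_close (H : R * R -> {ptws nat -> R}) (x y z : R * R) :
  H @` square `<=` realization (R := R) M -> square x -> square y -> square z ->
  (forall j, j \in V -> `|H x j - H y j| < c) ->
  (forall j, j \in V -> `|H x j - H z j| < c) ->
  [fset label (H x); label (H y); label (H z)]%fset \in M.
Proof.
move=> HM Ax Ay Az xy xz; have HR w : square w -> realization (R := R) M (H w).
  by move=> Aw; apply: HM; exists w.
apply: (support_simplex (HR x Ax)) => i; rewrite !inE -orbA => /or3P[]/eqP->.
- by have [_ h] := labelP (HR x Ax); apply: lt_le_trans h.
- have [hV h] := labelP (HR y Ay).
  by have := xy _ hV; rewrite ltr_norml => /andP[h1 _]; lra.
- have [hV h] := labelP (HR z Az).
  by have := xz _ hV; rewrite ltr_norml => /andP[h1 _]; lra.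
Qed.

Lemma label_edge p x y : realization (R := R) M p ->
  (forall j, j \notin [fset x; y]%fset -> p j = 0) -> label p \in [fset x; y]%fset.
Proof.
move=> /labelP[_ h] pxy; apply/negPn/negP=> /pxy p0.
by move: h; rewrite p0 leNgt c_gt0.
Qed.

Lemma point_mass (p : {ptws nat -> R}) x : realization (R := R) M p ->
  (forall j, j != x -> p j = 0) -> p = (fun j => if j == x then 1 else 0).
Proof.
case=> _ [s [_ ps p1]] px; apply: funext => j; case: eqP => [->|/eqP/px//].
rewrite -p1; case xs: (x \in s); last by rewrite ps ?xs // big_seq big1 // => i is_;
  apply: px; apply: contraTneq is_ => ->; rewrite xs.
by rewrite (bigD1_seq x) ?fset_uniq //= big1 ?addr0.
Qed.

Section Holonomy.
Variable g : nat -> nat -> bool.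
Hypothesis gM : cocycle M g.

Lemma grid_walk (G : nat -> nat -> nat) K :
  (forall i j i' j' i'' j'', (maxn i (maxn i' i'') <= K)%N ->
    (maxn j (maxn j' j'') <= K)%N ->
    (i' <= i.+1)%N -> (i'' <= i.+1)%N -> (i <= i')%N -> (i <= i'')%N ->
    (j' <= j.+1)%N -> (j'' <= j.+1)%N -> (j <= j')%N -> (j <= j'')%N ->
    [fset G i j; G i' j'; G i'' j'']%fset \in M) ->
  (forall i, (i <= K)%N -> G i 0%N = G 0%N 0%N /\ G i K = G 0%N 0%N) ->
  (forall j, (j <= K)%N -> G K j = G 0%N 0%N) ->
  walk g (G 0%N) K = false.
Proof.
move=> GM Gside Gtop.
(* The two triangles of a grid square share a diagonal, so consecutive rows differ only by the two
   edges that join their ends. *)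
have row i J : (i < K)%N -> (J <= K)%N -> walk g (G i) J (+) walk g (G i.+1) J =
    g (G i 0%N) (G i.+1 0%N) (+) g (G i J) (G i.+1 J).
  move=> iK; elim: J => [|J IH] JK /=; first by rewrite addbb.
  have h1 : g (G i J) (G i J.+1) (+) g (G i J.+1) (G i.+1 J.+1) = g (G i J) (G i.+1 J.+1).
    by apply: gM; apply: GM; lia.
  have h2 : g (G i J) (G i.+1 J) (+) g (G i.+1 J) (G i.+1 J.+1) = g (G i J) (G i.+1 J.+1).
    by apply: gM; apply: GM; lia.
  have := IH (ltnW JK); rewrite -h2 in h1.
  move: h1; case: (walk _ _ _); case: (walk _ _ _); case: (g (G i 0%N) _);
  case: (g (G i J) (G i J.+1)); case: (g (G i J.+1) (G i.+1 J.+1));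
  case: (g (G i J) (G i.+1 J)); by case: (g (G i.+1 J) (G i.+1 J.+1)).
have G0 : [fset G 0%N 0%N]%fset \in M.
  by have := GM 0%N 0%N 0%N 0%N 0%N 0%N; rewrite !fsetUid !maxnn; apply.
have g0 : g (G 0%N 0%N) (G 0%N 0%N) = false := cocycle_refl gM G0.
have rows i : (i <= K)%N -> walk g (G 0%N) K = walk g (G i) K.
  elim: i => // i IH iK; rewrite IH ?(ltnW iK) //.
  have := row i K iK (leqnn K).
  have [-> ->] := Gside i (ltnW iK); have [-> ->] := Gside i.+1 iK.
  by rewrite g0; case: (walk _ _ _); case: (walk _ _ _).
suff h J : (J <= K)%N -> walk g (G K) J = false by rewrite (rows K) // h.
elim: J => // J IH JK /=; by rewrite IH ?(ltnW JK) // !Gtop ?(ltnW JK).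
Qed.

Lemma closed_walk_trivial X n :
  simply_connected R (realization (R := R) M) ->
  (forall i, (i < n)%N -> [fset X i; X i.+1]%fset \in M) -> X n = X 0%N ->
  walk g X n = false.
Proof.
case: n => // n [_ sc] XM Xn; have n_gt0 : (0 < n.+1)%N by [].
pose f := polygon X n.+1.
have n0 : n.+1%:R != 0 :> R by rewrite pnatr_eq0.
have fR t : 0 <= t <= 1 -> realization (R := R) M (f t).
  move=> /andP[t0 t1]; have [|i i_n it] := @segment_index n.+1 (n.+1%:R * t) n_gt0.
    by rewrite mulr_ge0 ?ler0n //= ler_piMr // ler0n.
  split; first exact: polygon_ge0.
  exists [fset X i; X i.+1]%fset; split; [exact: XM|exact: polygon_out|].
  exact: polygon_sum.
have f01 : f 0 = f 1.
  rewrite [LHS](@point_mass _ (X 0%N)); first rewrite [RHS](@point_mass _ (X n.+1)).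
  - by rewrite Xn.
  - by apply: fR; rewrite ler01 lexx.
  - by move=> j; apply: polygon_vertex; rewrite mulr1.
  - by apply: fR; rewrite ler01 lexx.
  - by move=> j; apply: polygon_vertex; rewrite mulr0.
have [|H [Hc HM H0 H1 Hs]] := sc f _ f01.
  split; first exact: polygon_continuous.
  by move=> _ [t /= + <-]; rewrite in_itv /= => /fR.
have [N NP] := uniform_coordinates Hc.
(* Each of the [n.+1] edges of the walk is cut into [m] pieces. The vertices of the walk are then
   reached at grid points, and the mesh is at most [1 / m]. *)
pose m := N.+1; pose K := (n.+1 * m)%N.
have K_gt0 : (0 < K)%N by [].
have K0 : K%:R != 0 :> R by rewrite pnatr_eq0 -lt0n.
pose fr (i : nat) : R := i%:R / K%:R.
have fr01 i : (i <= K)%N -> 0 <= fr i <= 1.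
  by move=> iK; rewrite divr_ge0 ?ler0n //= ler_pdivrMr ?ltr0n // mul1r ler_nat.
have frI i : (i <= K)%N -> fr i \in `[0, 1] by move=> iK; rewrite in_itv /= fr01.
have frd i i' : (i <= i')%N -> (i' <= i.+1)%N -> `|fr i - fr i'| <= N.+1%:R^-1.
  move=> ii' i'i; rewrite distrC ger0_norm -?mulrBl ?divr_ge0 ?subr_ge0 ?ler_nat ?ler0n //.
  rewrite ler_pdivrMr ?ltr0n // /K mulnC natrM mulrA mulVf ?mul1r ?pnatr_eq0 //.
  have : i'%:R <= i.+1%:R :> R by rewrite ler_nat.
  rewrite -natr1 => h; have : 1 <= n.+1%:R :> R by rewrite ler1n.
  by lra.
have frsq i j : (i <= K)%N -> (j <= K)%N -> square (fr i, fr j).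
  by move=> iK jK; split; rewrite /= in_itv /= fr01.
have fr0 : fr 0%N = 0 by rewrite /fr mul0r.
have frK : fr K = 1 by rewrite /fr divff.
suff <- : walk g (fun j => label (f (fr j))) K = walk g X n.+1.
  pose G i j := label (H (fr i, fr j)).
  rewrite -(@eq_walk g (G 0%N)); last first.
    by move=> j jK; rewrite /G fr0 H0 // frI.
  apply: grid_walk.
  - move=> i j i' j' i'' j''; rewrite !geq_max => /and3P[iK i'K i''K] /and3P[jK j'K j''K].
    move=> h1 h2 h3 h4 h5 h6 h7 h8.
    have close a b : (a <= K)%N -> (b <= K)%N -> (i <= a)%N -> (a <= i.+1)%N -> (j <= b)%N ->
        (b <= j.+1)%N -> forall k, k \in V -> `|H (fr i, fr j) k - H (fr a, fr b) k| < c.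
      move=> aK bK ia ai jb bj; apply: NP; try exact: frsq.
      by rewrite prod_normE /= ge_max !frd.
    by apply: square_close => //; try exact: frsq; exact: close.
  - move=> i iK; have [] := Hs (fr i) (frI i iK).
    have [] := Hs (fr 0%N) (frI 0%N (leq0n _)).
    by rewrite /G frK fr0 => -> _ -> ->.
  - move=> j jK; rewrite /G frK H1 ?frI // fr0 H0 //.
    by rewrite in_itv /= lexx ler01.
have fseg i r : (i < n.+1)%N -> (r <= m)%N ->
    label (f (fr (i * m + r)%N)) \in [fset X i; X i.+1]%fset.
  move=> i_n rm; have imK : (i * m + r <= K)%N.
    apply: (@leq_trans (i * m + m)%N); first by rewrite leq_add2l.
    by rewrite -mulSnr leq_mul2r i_n orbT.
  apply: label_edge; first exact/fR/fr01.
  move=> k; apply: polygon_out => //.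
  rewrite /fr /K mulrA (mulrC n.+1%:R) natrM invfM mulrA -[_ * n.+1%:R / _]mulrA mulfV // mulr1.
  rewrite ler_pdivlMr ?ltr0n // ler_pdivrMr ?ltr0n // -!natrM !ler_nat.
  by rewrite leq_addr /= mulSnr leq_add2l.
have fvert i : (i <= n.+1)%N -> label (f (fr (i * m)%N)) = X i.
  move=> i_n; have imK : (i * m <= K)%N by rewrite leq_mul2r i_n orbT.
  suff : label (f (fr (i * m)%N)) \in [fset X i; X i]%fset by rewrite !inE orbb => /eqP.
  apply: label_edge; first exact/fR/fr01.
  move=> k; rewrite !inE orbb; apply: polygon_vertex.
  by rewrite /fr /K !natrM -mulf_div (@divff _ m%:R) ?pnatr_eq0 // mulr1 mulrCA divff // mulr1.
suff h i : (i <= n.+1)%N -> walk g (fun j => label (f (fr j))) (i * m) = walk g X i.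
  by rewrite h.
elim: i => // i IH i_n; rewrite mulSnr walkD IH ?(ltnW i_n) // [RHS]/=; congr (_ (+) _).
(* During one edge of the walk all labels are ends of that edge, so the sum over the [m] pieces
   telescopes to its value. *)
rewrite (@walk_telescope _ _ gM) addn0.
- by rewrite fvert ?(ltnW i_n) // -mulSnr fvert.
- rewrite fvert ?(ltnW i_n) //; apply: complexS cM _ (XM i i_n).
  by rewrite fsub1set !inE eqxx.
- move=> r rm; apply: complexS cM _ (XM i i_n).
  rewrite fvert ?(ltnW i_n) // !fsubUset !fsub1set !fseg // ?(ltnW rm) //.
  by rewrite !inE eqxx.
Qed.

End Holonomy.

(* A null homotopy of the loop of a closed edge walk is sampled on a grid so
   fine that the points of a grid square have a common simplex; walks along
   consecutive rows then have equal sums. *)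
Lemma simply_connected_H1 :
  simply_connected R (realization (R := R) M) -> H1 M.
Proof.
move=> sc g gM; apply: loops_coboundary => // x b xb.
have [n [X [X0 Xn XM <-]]] := reach_walk xb.
by apply: closed_walk_trivial; rewrite ?Xn ?X0.
Qed.

End NullHomotopy.

(** * Stellar 2-spheres *)

Section Surface.
Implicit Types (s t T : {fset nat}).

Record surface (S : simplex_family) : Prop := Surface {
  surface_complex : is_complex S;
  surface_acyclic : locally (acyclic_link 3) S;
  surface_thin : locally thin_link S
}.

Lemma sphere_surface S : stellar_sphere 2 S -> surface S.
Proof.
move=> sS; split; [|by apply: locally_acyclic_ball_sphere; right|exact: thin_sphere].
apply/(stellar_equiv_complex sS); apply: simplex_bd_complex.
by rewrite -cardfs_gt0 card_fseq.
Qed.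

Variable S : simplex_family.
Hypothesis sS : surface S.

Let cS := surface_complex sS.

Lemma surface_card t : t \in S -> #|` t| <= 3.
Proof. by move/(surface_thin sS); case: #|` t| => [|[|[|[|]]]]. Qed.

Lemma surface_edge s : s \in S -> #|` s| = 2 -> exists p q, [/\ p != q, p \notin s, q \notin s &
  forall r, r \notin s -> (r |` s \in S) = (r == p) || (r == q)].
Proof.
move=> sS' cs; have := surface_thin sS sS'; rewrite cs => -[p [q [pq lE]]].
have inl r : ([fset r] \in link S s) = (r \notin s) && (r |` s \in S).
  by rewrite in_linkE // fdisjointX1 fsetUC.
have E r : ([fset r] \in link S s) = (r == p) || (r == q).
  rewrite lE !inE !(inj_eq (@fset1_inj _)).
  by rewrite -cardfs_eq0 cardfs1.
exists p, q; split=> // [||r rs].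
- by have := inl p; rewrite E eqxx => /esym/andP[].
- by have := inl q; rewrite E eqxx orbT => /esym/andP[].
- by rewrite -E inl rs.
Qed.

Lemma surface_nonempty : exists v, [fset v] \in S.
Proof.
have := surface_acyclic sS (complex0 cS); rewrite cardfs0 link0.
by case=> -[].
Qed.

Lemma surface_extend1 t : t \in S -> #|` t| < 3 -> exists2 x, x \notin t & x |` t \in S.
Proof.
move=> tS t3; have : acyclic 1 (link S t).
  by apply: acyclic_le (surface_acyclic sS tS); rewrite subn_gt0.
by case=> x; rewrite in_linkE // fdisjointX1 fsetUC => /andP[xt xtS]; exists x.
Qed.

Lemma surface_extend t : t \in S -> exists T, [/\ T \in S, #|` T| = 3 & t `<=` T].
Proof.
move: {2}(3 - _)%N (erefl (3 - #|` t|)%N) => k; elim: k t => [|k IH] t tk tS.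
  exists t; split=> //; apply/eqP; rewrite eqn_leq surface_card //=.
  by rewrite -subn_eq0 tk.
have [x xt xtS] : exists2 x, x \notin t & x |` t \in S.
  by apply: surface_extend1; rewrite // -subn_gt0 tk.
have [||T [TS cT xtT]] := IH (x |` t) => //.
  by rewrite cardfsU1 xt add1n subnS tk.
by exists T; split=> //; apply: fsubset_trans xtT; exact: fsubsetUr.
Qed.

Lemma surface_top_card : top_card S = 3.
Proof.
apply/eqP; rewrite eqn_leq; apply/andP; split.
  by apply/bigmax_leqP_seq => t tS _; exact: surface_card.
have [v vS] := surface_nonempty; have [T [TS <- _]] := surface_extend vS.
by apply: (@leq_bigmax_seq _ _ xpredT (fun s : {fset nat} => #|` s|) T).
Qed.

Lemma in_generators T : (T \in generators S) = (T \in S) && (#|` T| == 3).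
Proof. by rewrite /generators !inE /= surface_top_card. Qed.

Lemma in_facets t : (t \in facets S) = (t \in S) && (#|` t| == 2).
Proof. by rewrite /facets !inE /= surface_top_card eqSS. Qed.

Definition triangle_at s : {fset nat} :=
  xget fset0 (fun T : {fset nat} => [/\ T \in S, #|` T| = 3 & s `<=` T]).

Lemma triangle_atP s : s \in S ->
  [/\ triangle_at s \in S, #|` triangle_at s| = 3 & s `<=` triangle_at s].
Proof.
case/surface_extend=> T hT.
exact: (@xgetPex _ fset0 (fun T : {fset nat} => [/\ T \in S, #|` T| = 3 & s `<=` T])
  (ex_intro _ T hT)).
Qed.

Lemma other_triangle T s : T \in S -> #|` T| = 3 -> #|` s| = 2 -> s `<=` T ->
  exists T', [/\ T' \in S, #|` T'| = 3, s `<=` T', T' != T &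
    forall U, U \in S -> #|` U| = 3 -> s `<=` U -> U = T \/ U = T'].
Proof.
move=> TS cT cs sT; have sS' : s \in S by apply: complexS cS sT TS.
have [p [q [pq ps qs E]]] := surface_edge sS' cs.
have ext U : U \in S -> #|` U| = 3 -> s `<=` U -> U = p |` s \/ U = q |` s.
  move=> US cU sU; have cD := cardfsDS sU; rewrite cU cs in cD.
  have /cardfs1P[r rE] : #|` U `\` s| == 1%N by rewrite cD.
  have : r \in U `\` s by rewrite rE inE.
  rewrite inE => /andP[rs rU].
  have UE : U = r |` s.
    apply/fsetP=> i; have : (i \in U `\` s) = (i == r) by rewrite rE inE.
    rewrite !inE => <-; case is_: (i \in s); last by rewrite orbF.
    by rewrite orbT (fsubsetP sU).
  have := E r rs; rewrite -UE US => /esym/orP[]/eqP rp; rewrite UE rp; by [left|right].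
have pS : p |` s \in S by rewrite E // eqxx.
have qS : q |` s \in S by rewrite E // eqxx orbT.
have cp : #|` p |` s| = 3 by rewrite cardfsU1 ps cs.
have cq : #|` q |` s| = 3 by rewrite cardfsU1 qs cs.
have npq : p |` s != q |` s.
  apply: contra_neq pq => /fsetP/(_ p); rewrite !inE eqxx (negbTE ps) !orbF.
  by move/esym/eqP.
case: (ext T TS cT sT) => TE.
  by exists (q |` s); split; rewrite ?fsubsetUr // TE 1?eq_sym.
exists (p |` s); split; rewrite ?fsubsetUr // TE //.
by move=> U US cU sU; case: (ext U US cU sU) => ->; [right|left].
Qed.

(* Connectedness, here of the star of [v], is stated throughout in terms of
   two-valued colourings. *)
Lemma star_connected v (c : {fset nat} -> bool) :
  (forall T T' s, T \in S -> T' \in S -> #|` T| = 3 -> #|` T'| = 3 ->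
    s `<=` T -> s `<=` T' -> #|` s| = 2 -> v \in s -> c T = c T') ->
  forall T T', T \in S -> T' \in S -> #|` T| = 3 -> #|` T'| = 3 ->
    v \in T -> v \in T' -> c T = c T'.
Proof.
move=> hc; have red T : T \in S -> #|` T| = 3 -> v \in T ->
    exists x, [/\ x != v, [fset v; x] \in S & c T = c (triangle_at [fset v; x])].
  move=> TS cT vT; have /fset0Pn[x] : T `\ v != fset0.
    by rewrite -cardfs_gt0; move: cT; rewrite (cardfsD1 v) vT add1n => -[->].
  rewrite !inE => /andP[xv xT]; exists x; have sT : [fset v; x] `<=` T.
    by rewrite fsubUset !fsub1set vT.
  have vxS := complexS cS sT TS; split=> //.
  have [US cU sU] := triangle_atP vxS; apply: (hc _ _ [fset v; x]) => //.
    by rewrite cardfs2 eq_sym xv.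
  by rewrite !inE eqxx.
move=> T T' TS TS' cT cT' vT vT'.
have vS : [fset v] \in S by apply: complexS cS _ TS; rewrite fsub1set.
have : acyclic 2 (link S [fset v]).
  by have := surface_acyclic sS vS; rewrite cardfs1.
(* The colouring of triangles becomes one of the vertices of the link of [v], a vertex [x] taking
   the colour of some triangle at the edge [vx]; the link is connected. *)
case=> _ /(_ (fun x => c (triangle_at [fset v; x]))) h.
have [x [xv vxS ->]] := red T TS cT vT; have [y [yv vyS ->]] := red T' TS' cT' vT'.
apply: h; last 2 first.
- by rewrite in_linkE // fdisjoint1X inE eq_sym xv.
- by rewrite in_linkE // fdisjoint1X inE eq_sym yv.
move=> x0 y0; rewrite in_linkE // fdisjoint1X !inE negb_or => /andP[/andP[vx vy] vxyS].
case: (eqVneq x0 y0) => [->//|xy].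
have c3 : #|` [fset v] `|` [fset x0; y0]| = 3.
  by rewrite cardfsU1 cardfs2 !inE xy negb_or vx vy.
have vx_S : [fset v; x0] \in S by apply: complexS cS _ vxyS; fset_tac.
have vy_S : [fset v; y0] \in S by apply: complexS cS _ vxyS; fset_tac.
have [TxS cTx sTx] := triangle_atP vx_S; have [TyS cTy sTy] := triangle_atP vy_S.
transitivity (c ([fset v] `|` [fset x0; y0])).
  apply: (hc _ _ [fset v; x0]); rewrite ?cardfs2 ?vx ?inE ?eqxx //; fset_tac.
apply: (hc _ _ [fset v; y0]); rewrite ?cardfs2 ?vy ?inE ?eqxx //; fset_tac.
Qed.

(** By [star_connected] each star has one colour, so the colour descends to the vertices of [S], and
    [S] is connected. *)
Lemma strongly_connected (c : {fset nat} -> bool) :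
  (forall T T' s, T \in S -> T' \in S -> #|` T| = 3 -> #|` T'| = 3 ->
    s `<=` T -> s `<=` T' -> #|` s| = 2 -> c T = c T') ->
  forall T T', T \in S -> T' \in S -> #|` T| = 3 -> #|` T'| = 3 -> c T = c T'.
Proof.
move=> hc; have star v T T' : T \in S -> T' \in S -> #|` T| = 3 -> #|` T'| = 3 ->
    v \in T -> v \in T' -> c T = c T'.
  by apply: star_connected => U U' s *; exact: (hc U U' s).
have : acyclic 3 S by have := surface_acyclic sS (complex0 cS); rewrite cardfs0 link0.
case=> -[_ /(_ (fun v => c (triangle_at [fset v]))) h] _.
have h' v w : [fset v] \in S -> [fset w] \in S ->
    c (triangle_at [fset v]) = c (triangle_at [fset w]).
  apply: h => x y xyS.
  have xS : [fset x] \in S by apply: complexS cS _ xyS; fset_tac.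
  have yS : [fset y] \in S by apply: complexS cS _ xyS; fset_tac.
  have [T1 c1 s1] := triangle_atP xS; have [T2 c2 s2] := triangle_atP yS.
  have [T3 c3 s3] := triangle_atP xyS; rewrite fsubUset !fsub1set in s3.
  rewrite !fsub1set in s1 s2; case/andP: s3 => x3 y3.
  by rewrite (star x _ _ T1 T3) // (star y _ _ T3 T2).
have red T : T \in S -> #|` T| = 3 ->
    exists2 v, [fset v] \in S & c T = c (triangle_at [fset v]).
  move=> TS cT; have /fset0Pn[v vT] : T != fset0 by rewrite -cardfs_gt0 cT.
  have vS : [fset v] \in S by apply: complexS cS _ TS; rewrite fsub1set.
  exists v => //; have [T1 c1] := triangle_atP vS; rewrite fsub1set => v1.
  exact: (star v).
move=> T T' TS TS' cT cT'; have [v vS ->] := red T TS cT.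
by have [w wS ->] := red T' TS' cT'; exact: h'.
Qed.

End Surface.

(** The last condition makes a simplex that is mapped to itself fixed vertex by vertex, so the fixed
    set of [phi] is a subcomplex; by the third it contains no triangle. *)
Record folding (S : simplex_family) (phi : nat -> nat) : Prop := Folding {
  folding_in : forall t, t \in S -> phi @` t \in S;
  folding_inv : forall v, v \in vertices S -> phi (phi v) = v;
  folding_triangle : forall T, T \in S -> #|` T| = 3 -> phi @` T != T;
  folding_regular : forall T v, T \in S -> v \in T -> phi v \in T -> phi v = v
}.

(** * The involution of a flat structure *)

Section Flat.
Variables (S : simplex_family) (e : regular_equiv S).
Hypothesis sS : surface S.
Implicit Types (s t T : {fset nat}) (v w : nat).

Let cS := surface_complex sS.

Definition vertex_eq v w :=
  v = w \/ [/\ v \in vertices S, w \in vertices S & vertex_equiv e v w].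

Lemma vertex_eq_refl v : vertex_eq v v. Proof. by left. Qed.

Lemma vertex_eq_sym v w : vertex_eq v w -> vertex_eq w v.
Proof.
case=> [->|[vS wS vw]]; [by left|right; split=> //].
have [vv h] := @vertex_equiv_rel S e _ _ _ vS wS vS; by rewrite -(h vw) vv.
Qed.

Lemma vertex_eq_trans u v w : vertex_eq u v -> vertex_eq v w -> vertex_eq u w.
Proof.
case=> [->//|[uS vS uv]] [<-|[_ wS vw]]; right; split=> //.
by have [_ ->] := @vertex_equiv_rel S e _ _ _ uS vS wS.
Qed.

Lemma triangle_vertices T v : T \in S -> v \in T -> v \in vertices S.
Proof. by move=> TS vT; apply/in_verticesP; exists T. Qed.

Lemma triangle_generators T : T \in S -> #|` T| = 3 -> T \in generators S.
Proof. by move=> TS cT; rewrite in_generators // TS cT eqxx. Qed.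

Lemma generators_triangle T : T \in generators S -> T \in S /\ #|` T| = 3.
Proof. by rewrite in_generators // => /andP[-> /eqP->]. Qed.

Lemma vertex_eq_eq T v w : T \in S -> v \in T -> w \in T -> vertex_eq v w -> v = w.
Proof.
move=> TS vT wT [//|[_ _ vw]]; have [T' [T'S cT' TT']] := surface_extend sS TS.
apply: (@gen_vertex_inj S e _ (triangle_generators T'S cT')) vw; exact: (fsubsetP TT').
Qed.

Variable p0 : {perm generators S}.
Hypotheses (p0P : is_p0 e p0) (p0N : fingroup.normal [set 1; p0]%g (Cox e p0)).

Definition partner T : {fset nat} :=
  if insub T is Some g then val (p0 g) else T.

Lemma partner_val (g : generators S) : partner (val g) = val (p0 g).
Proof. by rewrite /partner valK. Qed.

Lemma partnerP T : T \in S -> #|` T| = 3 ->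
  [/\ partner T \in S, #|` partner T| = 3, partner T != T & gen_equiv e (partner T) T].
Proof.
move=> TS cT; have TG := triangle_generators TS cT.
have := p0P (FSetSub TG); rewrite -partner_val /= => -[ne eq].
have E : partner T = val (p0 (FSetSub TG)) by rewrite -partner_val.
have : partner T \in generators S by rewrite E; exact: valP.
case/generators_triangle => h1 h2; split=> //.
by apply: contra_neq ne => h; apply: val_inj; rewrite -E.
Qed.

Lemma gen_equiv_sym T U : T \in generators S -> U \in generators S ->
  gen_equiv e T U -> gen_equiv e U T.
Proof. by move=> TG UG TU; have [TT h] := @gen_equiv_rel S e _ _ _ TG UG TG; rewrite -(h TU). Qed.

Lemma gen_equiv_partner T U : T \in S -> #|` T| = 3 -> U \in S -> #|` U| = 3 ->
  gen_equiv e T U -> U = T \/ U = partner T.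
Proof.
move=> TS cT US cU TU; have [PS cP PT PeT] := partnerP TS cT.
case: (eqVneq U T) => [->|UT]; [by left|right].
apply: (@gen_equiv_unique S e T) => //; try exact: triangle_generators.
by apply: gen_equiv_sym => //; exact: triangle_generators.
Qed.

Lemma partnerK T : T \in S -> #|` T| = 3 -> partner (partner T) = T.
Proof.
move=> TS cT; have [PS cP PT PeT] := partnerP TS cT.
have [_ _ PP _] := partnerP PS cP.
by case: (gen_equiv_partner PS cP TS cT PeT) => // h; rewrite -h eqxx in PT.
Qed.

Lemma partner_vertex T v : T \in S -> #|` T| = 3 -> v \in T ->
  exists2 w, w \in partner T & vertex_eq v w.
Proof.
move=> TS cT vT; have [PS cP PT PeT] := partnerP TS cT.
have [w wP] := @gen_equiv_vertices S e _ _ (triangle_generators TS cT)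
  (triangle_generators PS cP) PT PeT _ vT.
case=> [vw|vw]; exists w => //; [by left|right].
split=> //; [exact: triangle_vertices vT|exact: triangle_vertices wP].
Qed.

Definition transfer T v : nat := xget 0 [set w : nat | w \in partner T /\ vertex_eq v w]%classic.

Lemma transferP T v : T \in S -> #|` T| = 3 -> v \in T ->
  transfer T v \in partner T /\ vertex_eq v (transfer T v).
Proof.
move=> TS cT vT; have [w wP vw] := partner_vertex TS cT vT.
exact: (@xgetPex _ 0 [set w : nat | w \in partner T /\ vertex_eq v w]%classic
  (ex_intro _ w (conj wP vw))).
Qed.

Lemma transfer_unique T v w : T \in S -> #|` T| = 3 -> v \in T ->
  w \in partner T -> vertex_eq v w -> transfer T v = w.
Proof.
move=> TS cT vT wP vw; have [tP vt] := transferP TS cT vT.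
have [PS _ _ _] := partnerP TS cT.
by apply: (vertex_eq_eq PS) => //; apply: vertex_eq_trans vw; exact: vertex_eq_sym.
Qed.

Lemma transfer_inj T : T \in S -> #|` T| = 3 -> {in T &, injective (transfer T)}.
Proof.
move=> TS cT v w vT wT E; have [_ hv] := transferP TS cT vT.
have [_ hw] := transferP TS cT wT; apply: (vertex_eq_eq TS) => //.
by apply: vertex_eq_trans hv _; rewrite E; exact: vertex_eq_sym.
Qed.

Lemma transfer_face T s : T \in S -> #|` T| = 3 -> s `<=` T ->
  #|` transfer T @` s| = #|` s|.
Proof.
move=> TS cT sT; apply: card_in_imfset => v w /= vs ws.
by apply: (transfer_inj TS cT); exact: (fsubsetP sT).
Qed.

Lemma face_equiv_transfer T s : T \in S -> #|` T| = 3 -> s `<=` T ->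
  face_equiv e s (transfer T @` s).
Proof.
move=> TS cT sT; have [PS cP _ PeT] := partnerP TS cT.
have TG := triangle_generators TS cT; have PG := triangle_generators PS cP.
exists T, (partner T); split; split=> //; first exact: gen_equiv_sym.
- apply/fsubsetP=> _ /imfsetP[v /= vs ->].
  by have [] := transferP TS cT (fsubsetP sT _ vs).
- by rewrite transfer_face.
- move=> v vs; exists (transfer T v); first by apply/imfsetP; exists v.
  by have [_ [|[]]] := transferP TS cT (fsubsetP sT _ vs); [left|right].
Qed.

Definition vertex_eq_faces s t :=
  (forall v, v \in s -> exists2 w, w \in t & vertex_eq v w) /\
  (forall w, w \in t -> exists2 v, v \in s & vertex_eq v w).

(** The definition matches the vertices in one direction only. The matching is injective, because a
    generator has no two equivalent vertices, and equal cardinalities make it surjective. *)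
Lemma face_equiv_vertex_eq s t : face_equiv e s t -> vertex_eq_faces s t.
Proof.
case=> g [p [[gG pG gp] [sg tp cst st]]].
have [gS cg] := generators_triangle gG; have [pS cp] := generators_triangle pG.
have hst v : v \in s -> exists2 w, w \in t & vertex_eq v w.
  move=> vs; have [w wt [->|vw]] := st v vs; exists w => //; first by left.
  right; split=> //; apply: triangle_vertices; [exact: gS|exact: (fsubsetP sg)|exact: pS|].
  exact: (fsubsetP tp).
split=> // w wt.
pose k v := xget 0 [set w : nat | w \in t /\ vertex_eq v w]%classic.
have kP v : v \in s -> k v \in t /\ vertex_eq v (k v).
  move=> /hst[u ut vu].
  exact: (@xgetPex _ 0 [set w : nat | w \in t /\ vertex_eq v w]%classic
    (ex_intro _ u (conj ut vu))).
have kinj : {in s &, injective k}.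
  move=> v v' vs v's E; have [_ h] := kP v vs; have [_ h'] := kP v' v's.
  apply: (vertex_eq_eq gS); try exact: (fsubsetP sg).
  by apply: vertex_eq_trans h _; rewrite E; exact: vertex_eq_sym.
have kt : k @` s = t.
  apply/eqP; rewrite eqEfcard; apply/andP; split.
    by apply/fsubsetP=> _ /imfsetP[v /= vs ->]; have [] := kP v vs.
  by rewrite card_in_imfset // cst.
move: wt; rewrite -kt => /imfsetP[v /= vs ->]; exists v => //.
by have [] := kP v vs.
Qed.

Lemma in_facet_class s t : (t \in facet_class e s) = (t \in facets S) &&
  `[< clos_refl_sym_trans {fset nat}
     (fun x y => [/\ x \in facets S, y \in facets S & face_equiv e x y]) s t >].
Proof. by rewrite /facet_class; set F := facets S; rewrite !inE. Qed.

Lemma facet_class_vertex_eq s t : t \in facet_class e s -> vertex_eq_faces s t.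
Proof.
rewrite in_facet_class => /andP[_ /asboolP].
elim=> {s t} [s t [_ _]|s|s t _ [h1 h2]|s u t _ [h1 h2] _ [h3 h4]].
- exact: face_equiv_vertex_eq.
- by split=> v vs; exists v => //; left.
- split=> v.
    by move=> /h2[w ws wv]; exists w => //; exact: vertex_eq_sym.
  by move=> /h1[w wt vw]; exists w => //; exact: vertex_eq_sym.
- split=> v.
    by move=> /h1[w wu vw]; have [x xt wx] := h3 w wu; exists x => //; exact: vertex_eq_trans wx.
  by move=> /h4[w wu wv]; have [x xs xw] := h2 w wu; exists x => //; exact: vertex_eq_trans wv.
Qed.

Section Pivot.
Variable s0 : {fset nat}.
Hypothesis s0F : s0 \in facets S.
Let alpha := facet_class e s0.

Lemma facet_class_facet t : t \in alpha -> t \in S /\ #|` t| = 2.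
Proof.
by rewrite in_facet_class => /andP[+ _]; rewrite in_facets // => /andP[-> /eqP->].
Qed.

(** Faces in the same class have pairwise equivalent vertices, and equivalent vertices of one
    triangle coincide. *)
Lemma facet_class_unique T t t' : T \in S -> t \in alpha -> t' \in alpha ->
  t `<=` T -> t' `<=` T -> t = t'.
Proof.
move=> TS ta t'a tT t'T; have [h1 h2] := facet_class_vertex_eq ta.
have [h3 h4] := facet_class_vertex_eq t'a.
have sub : t `<=` t'.
  apply/fsubsetP=> v vt; have [w ws wv] := h2 v vt; have [u ut wu] := h3 w ws.
  rewrite (@vertex_eq_eq T v u) //; [exact: (fsubsetP tT)|exact: (fsubsetP t'T)|].
  by apply: vertex_eq_trans wu; exact: vertex_eq_sym.
have [_ ct] := facet_class_facet ta; have [_ ct'] := facet_class_facet t'a.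
by apply/eqP; rewrite eqEfcard sub ct ct'.
Qed.

Definition pivot_rel (g h : generators S) : Prop :=
  exists t, [/\ t \in alpha, t `<=` val g, t `<=` val h & h != g].

(** The Coxeter generator [p_alpha] for the class of [s0]; generators without a face in the class
    are fixed by default. *)
Definition pivot (g : generators S) : generators S := xget g (pivot_rel g).

Lemma pivot_rel_ex g t : t \in alpha -> t `<=` val g -> exists h, pivot_rel g h.
Proof.
move=> ta tg; have [gS cg] := generators_triangle (valP g).
have [_ ct] := facet_class_facet ta.
have [T [TS cT tT Tg _]] := other_triangle sS gS cg ct tg.
by exists (FSetSub (triangle_generators TS cT)), t; split.
Qed.

Lemma pivot_rel_unique g h h' : pivot_rel g h -> pivot_rel g h' -> h = h'.
Proof.
case=> t [ta tg th hg] [t' [t'a t'g t'h' h'g]].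
have [gS cg] := generators_triangle (valP g).
have E : t' = t by apply: (facet_class_unique gS).
subst t'; have [_ ct] := facet_class_facet ta.
have [T [TS cT tT Tg hT]] := other_triangle sS gS cg ct tg.
have side k : k != g -> t `<=` val k -> val k = T.
  move=> kg tk; have [kS ck] := generators_triangle (valP k).
  by case: (hT _ kS ck tk) => // /val_inj kE; rewrite kE eqxx in kg.
apply: val_inj; transitivity T; first exact: side hg th.
exact/esym/(side h' h'g t'h').
Qed.

Lemma pivotP g t : t \in alpha -> t `<=` val g -> pivot_rel g (pivot g).
Proof.
by move=> ta tg; have [h gh] := pivot_rel_ex ta tg; apply: (xgetPex g); exists h.
Qed.

Lemma pivot_out g : (forall t, t \in alpha -> ~~ (t `<=` val g)) -> pivot g = g.
Proof.
move=> hg; apply: xgetPN => h [t [ta tg _ _]].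
by have := hg t ta; rewrite tg.
Qed.

Lemma pivotK : involutive pivot.
Proof.
move=> g; case: (pselect (exists2 t, t \in alpha & t `<=` val g)) => [[t ta tg]|hg].
  have [u [ua ug uh hg]] := pivotP ta tg.
  apply: (@pivot_rel_unique (pivot g)); first exact: pivotP ua uh.
  by exists u; split; rewrite // eq_sym.
have gE : pivot g = g.
  by apply: pivot_out => t ta; apply/negP=> tg; apply: hg; exists t.
by rewrite !gE.
Qed.

Definition pivot_perm : {perm generators S} := perm (inv_inj pivotK).

Lemma pivot_perm_Cox : pivot_perm \in Cox e p0.
Proof.
apply: mem_gen; rewrite !inE; apply/orP; right; apply/asboolP; exists alpha.
  by apply/imfsetP; exists s0.
move=> g; split=> [t ta tg|hg]; rewrite permE; last exact: pivot_out.
have [u [ua ug uh hg]] := pivotP ta tg; split=> //.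
have [gS _] := generators_triangle (valP g).
by rewrite (facet_class_unique gS ta ua).
Qed.

(** A normal subgroup with two elements is central: the conjugate of [p0] lies in it and is not
    1. *)
Lemma pivot_commute g : pivot (p0 g) = p0 (pivot g).
Proof.
have /fintype.subsetP/(_ _ pivot_perm_Cox) := normal_norm p0N; rewrite inE => /fintype.subsetP h.
have : (p0 ^ pivot_perm)%g \in [set 1; p0]%g.
  by apply: h; rewrite memJ_conjg !inE eqxx orbT.
rewrite !inE => /orP[/eqP|/eqP].
  move/eqP; rewrite conjg_eq1 => /eqP p01; have [] := p0P g.
  by rewrite p01 perm1 eqxx.
move=> E; have : (p0 * pivot_perm = pivot_perm * p0)%g by rewrite -{2}E -conjgC.
by move/permP/(_ g); rewrite !permM !permE.
Qed.

End Pivot.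

(* The partner of the neighbour of [T] across an edge is the neighbour of the
   partner of [T] across the corresponding edge, so that [transfer] depends
   only on the vertex along a chain of triangles. *)
Lemma transfer_adjacent T T' s v : T \in S -> T' \in S -> #|` T| = 3 -> #|` T'| = 3 ->
  s `<=` T -> s `<=` T' -> #|` s| = 2 -> v \in s -> transfer T v = transfer T' v.
Proof.
move=> TS TS' cT cT' sT sT' cs vs; case: (eqVneq T' T) => [->//|T'T].
have sF : s \in facets S by rewrite in_facets // cs eqxx andbT (complexS cS sT TS).
pose g : generators S := FSetSub (triangle_generators TS cT).
have sa : s \in facet_class e s.
  by rewrite in_facet_class sF; apply/asboolP/rst_refl.
set t := transfer T @` s.
have ct : #|` t| = 2 by rewrite transfer_face.
have tP : t `<=` partner T.
  by apply/fsubsetP=> _ /imfsetP[u /= us ->]; have [] := transferP TS cT (fsubsetP sT _ us).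
have [PS cP _ _] := partnerP TS cT.
have tF : t \in facets S by rewrite in_facets // ct eqxx andbT (complexS cS tP PS).
have ta : t \in facet_class e s.
  rewrite in_facet_class tF; apply/asboolP/rst_step; split=> //.
  exact: face_equiv_transfer.
have [u [ua ug uh hg]] := pivotP sa (sT : s `<=` val g).
have us : s = u := facet_class_unique TS sa ua sT ug.
have pivE : val (pivot s g) = T'.
  have [hS ch] := generators_triangle (valP (pivot s g)).
  have [U [US cU sU UT hU]] := other_triangle sS TS cT cs sT.
  rewrite -us in uh; have [|->] := hU _ hS ch uh.
    by move=> h; case/eqP: hg; exact: val_inj.
  by have [h|->] := hU _ TS' cT' sT'; first by rewrite h eqxx in T'T.
have tp0 : t `<=` val (p0 g) by rewrite -partner_val.
have [w [wa wg wh _]] := pivotP ta tp0.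
have wt : w = t.
  by rewrite -partner_val in wg; exact: (facet_class_unique PS wa ta wg tP).
rewrite wt pivot_commute // -partner_val pivE in wh.
have [tvP vtv] := transferP TS cT (fsubsetP sT _ vs).
apply/esym/transfer_unique => //; first exact: (fsubsetP sT').
by apply: (fsubsetP wh); apply/imfsetP; exists v.
Qed.

Definition involution v : nat := transfer (triangle_at S [fset v]) v.

Lemma involutionE T v : T \in S -> #|` T| = 3 -> v \in T -> involution v = transfer T v.
Proof.
move=> TS cT vT; have vS : [fset v] \in S by apply: complexS cS _ TS; rewrite fsub1set.
have [US cU] := triangle_atP sS vS; rewrite fsub1set => vU.
(* Comparison with one fixed triangle turns the vertex-valued [transfer] into a two-valued colouring
   of the star. *)
pose c U := transfer U v == transfer T v.
have : c (triangle_at S [fset v]) = c T.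
  apply: (@star_connected _ sS v) => // U U' s *.
  by rewrite /c (@transfer_adjacent U U' s).
by rewrite /c eqxx => /eqP.
Qed.

Lemma involution_triangle T : T \in S -> #|` T| = 3 -> involution @` T = partner T.
Proof.
move=> TS cT; have [PS cP _ _] := partnerP TS cT.
have -> : involution @` T = transfer T @` T.
  by apply: eq_in_imfset => // v vT; exact: involutionE.
apply/eqP; rewrite eqEfcard transfer_face // cP cT andbT.
by apply/fsubsetP=> _ /imfsetP[v /= vT ->]; have [] := transferP TS cT vT.
Qed.

Lemma vertex_eq_involution v : v \in vertices S -> vertex_eq v (involution v).
Proof.
rewrite in_vertices // => vS; have [T [TS cT]] := surface_extend sS vS.
rewrite fsub1set => vT; rewrite (involutionE TS cT vT).
by have [] := transferP TS cT vT.
Qed.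

Lemma folding_involution : folding S involution.
Proof.
have vT v : v \in vertices S -> exists T, [/\ T \in S, #|` T| = 3 & v \in T].
  rewrite in_vertices // => vS; have [T [TS cT]] := surface_extend sS vS.
  by rewrite fsub1set; exists T.
split.
- move=> t tS; have [T [TS cT tT]] := surface_extend sS tS.
  have [PS _ _ _] := partnerP TS cT; apply: complexS cS _ PS.
  rewrite -(involution_triangle TS cT); apply/fsubsetP=> _ /imfsetP[v /= vt ->].
  by apply/imfsetP; exists v => //; exact: (fsubsetP tT).
- move=> v /vT[T [TS cT vT']]; have [PS cP _ _] := partnerP TS cT.
  have ivP : involution v \in partner T.
    by rewrite -(involution_triangle TS cT); apply/imfsetP; exists v.
  rewrite (involutionE PS cP ivP); apply: transfer_unique => //.
    by rewrite partnerK.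
  apply/vertex_eq_sym/vertex_eq_involution; exact: triangle_vertices vT'.
- move=> T TS cT; rewrite involution_triangle //.
  by have [] := partnerP TS cT.
- move=> T v TS vT' ivT; apply/esym/(@vertex_eq_eq T) => //.
  apply: vertex_eq_involution; exact: triangle_vertices vT'.
Qed.

End Flat.

(** * The cells of the cone quotient *)

Section Cells.
Variables (S : simplex_family) (e : regular_equiv S).
Hypothesis sS : surface S.
Variable p0 : {perm generators S}.
Hypotheses (p0P : is_p0 e p0) (p0N : fingroup.normal [set 1; p0]%g (Cox e p0)).
Variable a : nat.
Hypothesis aS : a \notin vertices S.
Implicit Types (s t x y z T : {fset nat}).

Let cS := surface_complex sS.
Let phi := involution e p0.
Let fphi : folding S phi := folding_involution sS p0P p0N.

Lemma a_notin x : x \in S -> a \notin x. Proof. exact: vertices_notin. Qed.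

Lemma coneE x : (x \in cone a S) = (x `\ a \in S). Proof. exact: in_cone. Qed.

Lemma cone_S x : x \in S -> x \in cone a S.
Proof. by move=> xS; rewrite coneE fsetD1_notin // a_notin. Qed.

Lemma cone_a x : x \in S -> a |` x \in cone a S.
Proof.
move=> xS; rewrite coneE; apply: complexS cS _ xS.
by apply/fsubsetP=> i; rewrite !inE => /andP[/negbTE-> ].
Qed.

Lemma cone_complex : is_complex (cone a S).
Proof. by apply: join_complex => //; exact: simplex_complex. Qed.

Lemma cone_notin x : x \in cone a S -> a \notin x -> x \in S.
Proof. by rewrite coneE => h ax; rewrite -(fsetD1_notin ax). Qed.

Lemma phi_S x : x \in S -> phi @` x \in S. Proof. exact: (folding_in fphi). Qed.

Lemma phi_K x : x \in S -> phi @` (phi @` x) = x.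
Proof.
move=> xS; apply/fsetP=> i; apply/imfsetP/idP => [[_ /imfsetP[j /= jx ->] ->]|ix].
  by rewrite (folding_inv fphi) //; apply/in_verticesP; exists x.
exists (phi i); first by apply/imfsetP; exists i.
by rewrite (folding_inv fphi) //; apply/in_verticesP; exists x.
Qed.

Lemma phi_card x : x \in S -> #|` phi @` x| = #|` x|.
Proof.
move=> xS; apply: card_in_imfset => i j /= ix jx ij.
rewrite -(folding_inv fphi (v := i)) ?ij ?(folding_inv fphi) //;
  by apply/in_verticesP; exists x.
Qed.

(** The closure of the identifications in explicit form. By flatness they are those of [phi], except
    that equivalent vertices need not be exchanged by [phi]; [no_pinching] excludes this last
    possibility. *)
Definition same_cell s t :=
  [\/ t = s, s \in S /\ t = phi @` s |
   exists v w, [/\ v \in vertices S, w \in vertices S, vertex_eq e v w,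
     s = [fset v] & t = [fset w]]].

Lemma same_cell_refl s : same_cell s s. Proof. exact: Or31. Qed.

Lemma same_cell_sym s t : same_cell s t -> same_cell t s.
Proof.
case=> [->|[sS' ->]|[v [w [vS wS vw -> ->]]]]; first exact: Or31.
  by apply: Or32; rewrite phi_S ?phi_K.
by apply: Or33; exists w, v; split=> //; exact: vertex_eq_sym.
Qed.

Lemma phi_vertex_eq v : v \in vertices S -> phi v \in vertices S /\ vertex_eq e v (phi v).
Proof.
move=> vS; split; last exact: vertex_eq_involution.
by move: vS; rewrite !in_vertices // => /phi_S; rewrite image_fset1.
Qed.

Lemma same_cell_trans s t u : same_cell s t -> same_cell t u -> same_cell s u.
Proof.
case=> [->//|[sS' ->]|[v [w [vS wS vw -> ->]]]].
  case=> [->|[_ ->]|[v [w [vS wS vw sE ->]]]].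
  - exact: Or32.
  - by rewrite phi_K //; exact: Or31.
  - have E : s = [fset phi v] by rewrite -[s]phi_K // sE image_fset1.
    have [pvS vpv] := phi_vertex_eq vS.
    apply: Or33; exists (phi v), w; split=> //.
    by apply: vertex_eq_trans vw; exact: vertex_eq_sym.
case=> [->|[_ ->]|[v' [w' [v'S w'S vw' /fset1_inj E ->]]]].
- by apply: Or33; exists v, w.
- have [pwS wpw] := phi_vertex_eq wS; rewrite image_fset1.
  by apply: Or33; exists v, (phi w); split=> //; exact: vertex_eq_trans wpw.
- subst v'; apply: Or33; exists v, w'; split=> //; exact: vertex_eq_trans vw'.
Qed.

Lemma identified_same_cell s t : identified e s t -> same_cell s t.
Proof.
case=> [[g [p [[gG pG gp] [sg tp cst st]]]]|[v [w [vS wS vw -> ->]]]]; last first.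
  by apply: Or33; exists v, w; split=> //; right.
have [gS cg] := generators_triangle sS gG; have [pS cp] := generators_triangle sS pG.
have stx v : v \in s -> exists2 w, w \in t & vertex_eq e v w.
  move=> vs; have [w wt [->|vw]] := st v vs; exists w => //; [by left|right].
  split=> //; apply/in_verticesP; first by exists g; rewrite ?(fsubsetP sg).
  by exists p; rewrite ?(fsubsetP tp).
have sS' : s \in S := complexS cS sg gS.
case: (gen_equiv_partner sS p0P gS cg pS cp gp) => pE.
- apply: Or31; apply/esym/eqP; rewrite eqEfcard cst leqnn andbT.
  apply/fsubsetP=> v vs; have [w wt vw] := stx v vs.
  rewrite (@vertex_eq_eq _ e sS g v w) //; first exact: (fsubsetP sg).
  by rewrite -pE; exact: (fsubsetP tp).
- apply: Or32; split=> //; apply/esym/eqP; rewrite eqEfcard phi_card // cst leqnn andbT.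
  apply/fsubsetP=> _ /imfsetP[v /= vs ->]; have [w wt vw] := stx v vs.
  have vS : v \in vertices S by apply/in_verticesP; exists s.
  have [_ vpv] := phi_vertex_eq vS.
  rewrite (@vertex_eq_eq _ e sS p (phi v) w) //.
  + rewrite pE -(involution_triangle sS p0P p0N) //; apply/imfsetP; exists v => //.
    exact: (fsubsetP sg).
  + exact: (fsubsetP tp).
  + by apply: vertex_eq_trans vw; exact: vertex_eq_sym.
Qed.

Lemma same_cellP s t : s != fset0 ->
  clos_refl_sym_trans {fset nat} (identified e) s t <-> same_cell s t.
Proof.
move=> s0; split.
  elim=> {s t s0} [s t|s|s t _|s t u _ h1 _ h2].
  - exact: identified_same_cell.
  - exact: same_cell_refl.
  - exact: same_cell_sym.
  - exact: same_cell_trans h2.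
case=> [->|[sS' ->]|[v [w [vS wS vw -> ->]]]]; first exact: rst_refl.
- apply: rst_step; left; have [T [TS cT sT]] := surface_extend sS sS'.
  have <- : transfer e p0 T @` s = phi @` s.
    apply: eq_in_imfset => // v vs; apply/esym/(involutionE sS p0P p0N TS cT).
    exact: (fsubsetP sT).
  exact: face_equiv_transfer.
- case: vw => [->|[_ _ vw]]; first exact: rst_refl.
  by apply: rst_step; right; exists v, w.
Qed.

Definition cell_label x : nat := choice.pickle (cell_of e a x).

Lemma same_cell0 s t : s != fset0 -> same_cell s t -> t != fset0.
Proof.
move=> s0 [->//|[sS' ->]|[v [w [_ _ _ _ ->]]]].
  by rewrite -cardfs_gt0 phi_card // cardfs_gt0.
by rewrite -cardfs_gt0 cardfs1.
Qed.

Lemma in_cell_of x t : (t \in cell_of e a x) = (t \in cone a S) &&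
  `[< clos_refl_sym_trans {fset nat} (identified e) x t >].
Proof. by rewrite /cell_of; set C := cone a S; rewrite !inE. Qed.

Lemma cell_label_eq x y : x \in cone a S -> x != fset0 -> y \in cone a S ->
  (cell_label x = cell_label y) <-> same_cell x y.
Proof.
move=> xC x0 yC; split=> [/(pcan_inj choice.pickleK)/fsetP/(_ y)|xy].
  have -> : y \in cell_of e a y by rewrite in_cell_of yC; apply/asboolP/rst_refl.
  by rewrite in_cell_of yC => /asboolP/(same_cellP _ x0).
congr choice.pickle; apply/fsetP=> t; rewrite !in_cell_of; congr (_ && _).
have xy' : clos_refl_sym_trans _ (identified e) x y by apply/same_cellP.
by apply/asboolP/asboolP => h; [apply: rst_trans h; exact: rst_sym|exact: rst_trans h].
Qed.

Definition cell_le i j := exists x y, [/\ x \in cone a S, y \in cone a S,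
  x != fset0 & [/\ cell_label x = i, cell_label y = j & x `<=` y]].

Definition is_cell i := exists x, [/\ x \in cone a S, x != fset0 & cell_label x = i].

(** Flags of cells are expressed through representatives, so that nothing below has to mention
    equivalence classes of simplexes. *)
Lemma cone_quotientP t : t \in cone_quotient e a <->
  (forall i, i \in t -> is_cell i) /\
  (forall i j, i \in t -> j \in t -> cell_le i j \/ cell_le j i).
Proof.
have fl c d x y : c = cell_of e a x -> d = cell_of e a y -> x \in cone a S ->
   y \in cone a S -> x != fset0 -> y != fset0 -> cell_face c d ->
   cell_le (cell_label x) (cell_label y).
  move=> -> -> xC yC x0 y0 [s [u [+ + su]]].
  rewrite !in_cell_of => /andP[sC /asboolP/(same_cellP _ x0) xs].
  move=> /andP[uC /asboolP/(same_cellP _ y0) yu].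
  exists s, u; split=> //; first exact: same_cell0 xs.
  by split=> //; apply/esym/cell_label_eq.
have cellP c : c \in cells e a -> exists x, [/\ x \in cone a S, x != fset0 & c = cell_of e a x].
  case/imfsetP=> x /=; set C := cone a S; rewrite !inE => /andP[xC x0] ->.
  by exists x.
split.
- case/in_relabelP=> F; rewrite !inE /= fpowersetE => /andP[/fsubsetP Fc /asboolP flF] ->.
  split=> [_ /imfsetP[c /= cF ->]|_ _ /imfsetP[c /= cF ->] /imfsetP[d /= dF ->]].
    by have [x [xC x0 ->]] := cellP c (Fc c cF); exists x.
  have [x [xC x0 cE]] := cellP c (Fc c cF); have [y [yC y0 dE]] := cellP d (Fc d dF).
  by rewrite cE dE; case: (flF c d cF dF) => h; [left|right]; exact: (fl _ _ _ _ _ _ _ _ _ _ h).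
- case=> lt ct; apply/in_relabelP; exists [fset c in cells e a | choice.pickle c \in t].
    rewrite !inE /= fpowersetE; apply/andP; split.
      by apply/fsubsetP=> c; set CC := cells e a; rewrite !inE => /andP[].
    apply/asboolP=> c d; set CC := cells e a; rewrite !inE => /andP[cC ct'] /andP[dC dt].
    have [x [xC x0 cE]] := cellP c cC; have [y [yC y0 dE]] := cellP d dC.
    have face c' d' : choice.pickle c' = choice.pickle c \/ True -> cell_le (choice.pickle c')
        (choice.pickle d') -> cell_face c' d'.
      move=> _ [s [u [sC uC s0 [/(pcan_inj choice.pickleK) <- /(pcan_inj choice.pickleK) <-
          su]]]].
      exists s, u; rewrite !in_cell_of sC uC; split=> //; apply/asboolP; exact: rst_refl.
    by case: (ct _ _ ct' dt) => h; [left|right]; apply: face h; right.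
  apply/fsetP=> i; apply/idP/imfsetP => [it|[c /=]].
    have [x [xC x0 xi]] := lt i it; exists (cell_of e a x) => //.
    rewrite !inE /=; apply/andP; split; last by rewrite -[choice.pickle _]/(cell_label x) xi.
    by apply/imfsetP; exists x => //=; set C := cone a S; rewrite !inE xC.
  by set CC := cells e a; rewrite !inE => /andP[_ h] ->.
Qed.

End Cells.

(** * Vertices are identified only by the involution *)

Section NoPinching.
Variables (S : simplex_family) (e : regular_equiv S).
Hypothesis sS : surface S.
Variable p0 : {perm generators S}.
Hypotheses (p0P : is_p0 e p0) (p0N : fingroup.normal [set 1; p0]%g (Cox e p0)).
Variable a : nat.
Hypothesis aS : a \notin vertices S.
Implicit Types (s t x y z T : {fset nat}).

Let cS := surface_complex sS.
Let phi := involution e p0.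
Let Q := cone_quotient e a.
Let lab := cell_label e a.
Let QP := @cone_quotientP S e sS p0 p0P p0N a.
Let labE := @cell_label_eq S e sS p0 p0P p0N a.

Lemma cell_le_label x y : x \in cone a S -> y \in cone a S -> x != fset0 ->
  x `<=` y -> cell_le e a (lab x) (lab y).
Proof. by move=> xC yC x0 xy; exists x, y. Qed.

Lemma label_cell x : x \in cone a S -> x != fset0 -> is_cell e a (lab x).
Proof. by move=> xC x0; exists x. Qed.

Lemma sub_neq0 x y : x != fset0 -> x `<=` y -> y != fset0.
Proof. by move=> x0 xy; apply: contra_neq x0 => y0; apply/eqP; rewrite -fsubset0 -y0. Qed.

Lemma cell_edge x y : x \in cone a S -> y \in cone a S -> x != fset0 ->
  x `<=` y -> [fset lab x; lab y] \in Q.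
Proof.
move=> xC yC x0 xy; have y0 := sub_neq0 x0 xy.
apply/QP; split=> [i|i j]; rewrite !inE => /orP[]/eqP->; try exact: label_cell;
  move=> /orP[]/eqP->; try by [left; apply: cell_le_label|right; apply: cell_le_label].
Qed.

(* If [v ~ w] but [w] is neither [v] nor [phi v], then the cell of [v] has a
   disconnected link; the cocycle that marks the edges from it to the cells
   around [v] and [phi v], but not to those around [w], is not a coboundary. *)
Lemma no_pinching : H1 Q -> forall v w, v \in vertices S -> w \in vertices S ->
  vertex_equiv e v w -> w = v \/ w = phi v.
Proof.
move=> hQ v w vS wS vw; apply: contrapT => hvw.
have wv : w <> v by move=> h1; apply: hvw; left.
have wpv : w <> phi v by move=> h1; apply: hvw; right.
have vwE : vertex_eq e v w by right.
have vS1 : [fset v] \in S by rewrite -in_vertices.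
have wS1 : [fset w] \in S by rewrite -in_vertices.
have vC := cone_S sS aS vS1.
have v0 : [fset v] != fset0 by rewrite -cardfs_gt0 cardfs1.
have w0 : [fset w] != fset0 by rewrite -cardfs_gt0 cardfs1.
have fphi : folding S phi := folding_involution sS p0P p0N.
pose i0 := lab [fset v].
pose ov x := (v \in x) || (phi v \in x).
pose h j := `[< exists2 y, y \in cone a S /\ lab y = j & ov y >].
have phi_in u x : u \in vertices S -> x \in S -> (phi u \in phi @` x) = (u \in x).
  move=> uS xS; apply/imfsetP/idP => [[u' /= u'x E]|ux]; last by exists u.
  rewrite -(folding_inv fphi uS) E (folding_inv fphi) //.
  by apply/in_verticesP; exists x.
have [pvS vpv] := phi_vertex_eq sS p0P p0N vS.
have single u : u \in vertices S -> vertex_eq e v u -> lab [fset u] = i0.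
  move=> uS vu; apply/labE; rewrite ?cone_S // -?in_vertices //; last first.
    by apply: Or33; exists u, v; split=> //; exact: vertex_eq_sym.
  by rewrite -cardfs_gt0 cardfs1.
have repr y y' u : y \in cone a S -> y' \in cone a S -> y != fset0 -> lab y = lab y' -> lab y
    != i0 ->
    u \in y -> u \in vertices S -> vertex_eq e v u -> u \in y' \/ phi u \in y'.
  move=> yC y'C y0 yy' yi0 uy uS vu; have /labE := yy'; case=> //.
  - by move=> ->; left.
  - by case=> yS ->; right; rewrite phi_in.
  - case=> x1 [x2 [x1S x2S x12 y1 y2]]; case/eqP: yi0; rewrite y1.
    by move: uy; rewrite y1 inE => /eqP <-; exact: single.
have ovP y y' : y \in cone a S -> y' \in cone a S -> y != fset0 -> lab y = lab y' -> lab y !=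
    i0 ->
    ov y -> ov y'.
  move=> yC y'C y0 yy' yi0 /orP[vy|pvy].
    by case: (repr y y' v yC y'C y0 yy' yi0 vy vS (vertex_eq_refl _ _)) => h1; rewrite /ov h1
        ?orbT.
  have := repr y y' (phi v) yC y'C y0 yy' yi0 pvy pvS vpv.
  by rewrite (folding_inv fphi vS) => -[] h1; rewrite /ov h1 ?orbT.
have ov0 y : ov y -> y != fset0.
  by move=> /orP[] h1; apply/fset0Pn; [exists v|exists (phi v)].
have hE y : y \in cone a S -> y != fset0 -> lab y != i0 -> h (lab y) = ov y.
  move=> yC y0 yi0; apply/asboolP/idP => [[y' [y'C E] oy']|oy]; last by exists y.
  by apply: (ovP y' y) => //; [exact: ov0|rewrite E].
have above y : cell_le e a i0 (lab y) \/ cell_le e a (lab y) i0 -> y \in cone a S -> y != fset0 ->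
    lab y != i0 -> exists2 u, u \in y & u \in vertices S /\ vertex_eq e v u.
  case=> -[x [z [xC zC x0 [xE zE xz]]]] yC y0 yi0; last first.
    have /labE : i0 = lab z by rewrite /lab zE.
    case=> // [zv|[_ zv]|[u1 [u2 [_ _ _ _ zv]]]]; case/eqP: yi0; rewrite -xE.
    - by rewrite /i0; congr lab; apply/eqP; move: xz; rewrite zv fsubset1 (negbTE x0) orbF.
    - rewrite -zE; congr lab; apply/eqP; move: xz; rewrite zv image_fset1 fsubset1 (negbTE x0)
        orbF //.
    - rewrite -zE; congr lab; apply/eqP; move: xz; rewrite zv fsubset1 (negbTE x0) orbF //.
  have [u [uS vu xu]] : exists u, [/\ u \in vertices S, vertex_eq e v u & x = [fset u]].
    have /labE : i0 = lab x by rewrite /lab xE.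
    case=> // [->|[_ ->]|[u1 [u2 [_ u2S u12 /fset1_inj-> ->]]]].
    - by exists v; split=> //; left.
    - by exists (phi v); rewrite image_fset1.
    - by exists u2.
  have uz : u \in z by move: xz; rewrite xu fsub1set.
  have z0 : z != fset0 by apply/fset0Pn; exists u.
  have [|uy|uy] := repr z y u zC yC z0 zE _ uz uS vu; first by rewrite /lab zE.
    by exists u.
  exists (phi u) => //; have [puS upu] := phi_vertex_eq sS p0P p0N uS.
  by split=> //; exact: vertex_eq_trans vu upu.
(* A simplex of the cone contains at most one vertex equivalent to [v]; if a face already contains
   one, it settles whether the simplex lies over [v]. *)
have ov_mono y z : y \in cone a S -> z \in cone a S -> y `<=` z -> y != fset0 ->
    (exists2 u, u \in y & u \in vertices S /\ vertex_eq e v u) -> ov y = ov z.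
  move=> yC zC yz y0 [u uy [uS vu]]; apply/idP/idP => [/orP[]/(fsubsetP yz) h1|].
  - by rewrite /ov h1.
  - by rewrite /ov h1 orbT.
  have [zaS uz] : z `\ a \in S /\ u \in z `\ a.
    rewrite coneE // in zC; split=> //; rewrite !inE (fsubsetP yz) // andbT.
    by apply: contraNneq aS => <-.
  have same v' : v' \in vertices S -> vertex_eq e v v' -> v' \in z -> v' = u.
    move=> v'S vv' v'z; apply: (@vertex_eq_eq _ e sS (z `\ a)) => //.
      by rewrite !inE v'z andbT; apply: contraNneq aS => <-.
    by apply: vertex_eq_trans vu; exact: vertex_eq_sym.
  case/orP=> [vz|pvz]; first by rewrite /ov (same v vS (vertex_eq_refl _ _) vz) uy.
  by rewrite /ov (same (phi v) pvS vpv pvz) uy orbT.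
pose g i j := ((i == i0) && (j != i0) && h j) (+) ((j == i0) && (i != i0) && h i).
(* In the link of the cell [i0] the mark [h] is constant along edges, which is all that the cocycle
   condition for [g] asks. *)
have hjk j k : is_cell e a j -> is_cell e a k ->
   (cell_le e a j k \/ cell_le e a k j) -> (cell_le e a i0 j \/ cell_le e a j i0) ->
   (cell_le e a i0 k \/ cell_le e a k i0) -> j != i0 -> k != i0 -> h j = h k.
  wlog : j k / cell_le e a j k => [wl jc kc|].
    by case=> jk h1 h2 h3 h4; [apply: wl|apply/esym/wl] => //; left.
  move=> [y [z [yC zC y0 [yE zE yz]]]] _ _ _ h1 h2 h3 h4; subst j k.
  have z0 := sub_neq0 y0 yz.
  rewrite !hE //; apply: ov_mono => //; exact: above.
have gQ : cocycle Q g.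
  move=> i j k /QP[cells cmp].
  have ci := cells i; have cj := cells j; have ck := cells k.
  have cij := cmp i j; have cik := cmp i k; have cjk := cmp j k.
  rewrite !inE !eqxx !orbT /= in ci cj ck cij cik cjk.
  have {}ci := ci isT; have {}cj := cj isT; have {}ck := ck isT.
  have {}cij := cij isT isT; have {}cik := cik isT isT; have {}cjk := cjk isT isT.
  rewrite /g; case: (eqVneq i i0) => [ii|ii]; case: (eqVneq j i0) => [jj|jj];
    case: (eqVneq k i0) => [kk|kk] //=; rewrite ?addbF ?addFb ?addbb //.
  + by rewrite (hjk j k) //; [rewrite -ii|rewrite -ii].
  + by rewrite (hjk i k) ?addbb //; [rewrite -jj; case: cij; [right|left]|rewrite -jj].
  + by rewrite (hjk i j) //; [rewrite -kk; case: cik; [right|left]|rewrite -kk; case: cjk;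
      [right|left]].
have [f fQ] := hQ g gQ.
have aC u : [fset u] \in S -> [fset a; u] \in cone a S by move=> uS; exact: cone_a.
have a0 : [fset a] != fset0 by rewrite -cardfs_gt0 cardfs1.
have aC1 : [fset a] \in cone a S.
  by rewrite -[_ a]fsetU0; apply: cone_a => //; exact: complex0.
have notv y : a \in y -> y \in cone a S -> lab y != i0.
  move=> ay yC; apply/eqP => /labE; have y0 : y != fset0 by apply/fset0Pn; exists a.
  case=> // [yE|[yS _]|[u1 [u2 [u1S _ _ yE _]]]].
  - by move: ay; rewrite -yE inE => /eqP av; apply: (negP aS); rewrite av.
  - by have := a_notin aS yS; rewrite ay.
  - by move: ay; rewrite yE inE => /eqP au; apply: (negP aS); rewrite au.
have fa u : [fset u] \in S -> f (lab [fset a; u]) = f (lab [fset a]).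
  move=> uS; have := fQ (lab [fset a]) (lab [fset a; u]).
  rewrite cell_edge ?aC //; last by rewrite fsubsetUl.
  move=> /(_ isT); rewrite /g (negbTE (notv _ _ (aC _ uS))) ?inE ?eqxx //.
  rewrite (negbTE (notv _ _ aC1)) ?inE ?eqxx //=.
  by case: (f _); case: (f _).
(* The cells of the edges [au] are all adjacent to that of [a] by edges on which [g] vanishes, so
   [f] is constant on them. Then [g] takes one value on the edges from [i0] to all of these,
   although [av] is marked and [aw] is not. *)
have gi u : [fset u] \in S -> vertex_eq e v u -> ov [fset a; u] = f i0 (+) f (lab [fset a]).
  move=> uS vu; rewrite -(fa u) // -fQ; last first.
    rewrite -(single u) -?in_vertices //; rewrite ?in_vertices //.
    apply: cell_edge; rewrite ?aC ?cone_S ?fsubsetUr //.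
    by rewrite -cardfs_gt0 cardfs1.
  have ni := notv _ _ (aC _ uS); rewrite /g eqxx (negbTE (ni _)) ?inE ?eqxx //=.
  rewrite hE ?addbF ?aC ?ni ?inE ?eqxx //.
  by apply/fset0Pn; exists a; rewrite !inE eqxx.
have := gi w wS1 vwE; rewrite -(gi v vS1 (vertex_eq_refl _ _)) /ov !inE eqxx !orbT.
have va : v != a by apply: contraNneq aS => <-.
have pva : phi v != a by apply: contraNneq aS => <-.
rewrite (negbTE va) (negbTE pva) /=.
by case/orP=> /eqP h1; [apply: wv|apply: wpv].
Qed.

End NoPinching.

(** * Two-colouring the triangles *)

Section Counting.

(** A connected graph has at most one vertex more than it has edges. Contracting the edge [xy] loses
    at most one vertex and preserves connectedness; contraposition yields nonconstant colourings. *)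
Lemma connected_card (X : choiceType) (V : {fset X}) (E : seq (X * X)) :
  (forall c : X -> bool, (forall p, p \in E -> c p.1 = c p.2) ->
     {in V &, forall x y, c x = c y}) -> #|` V| <= (size E).+1.
Proof.
move En: (size E) => n; elim: n E En V => [|n IH] [|[x y] E] //= => [_|[En]] V conn.
  case: (fset_0Vmem V) => [->|[x xV]]; first by rewrite cardfs0.
  have -> : V = [fset x]; last by rewrite cardfs1.
  apply/fsetP=> z; rewrite inE; apply/idP/eqP => [zV|->//].
  have h : pred1 x x = pred1 x z by apply: conn.
  by apply/eqP; move: h; rewrite /= eqxx => <-.
pose r z := if z == y then x else z.
have rx : r x = x by rewrite /r; case: eqP.
have VyV : V `\ y `<=` [fset r z | z in V].
  apply/fsubsetP=> z; rewrite !inE => /andP[zy zV].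
  by apply/imfsetP; exists z; rewrite // /r (negbTE zy).
have : #|` [fset r z | z in V]| <= n.+1.
  have := IH (map (fun p => (r p.1, r p.2)) E) _ (r @` V).
  rewrite size_map; apply=> // c cE _ _ /imfsetP[u /= uV ->] /imfsetP[w /= wV ->].
  apply: (conn (c \o r)) => // p; rewrite inE => /orP[/eqP->|pE] /=.
    by rewrite rx /r eqxx.
  exact: (cE _ (map_f _ pE)).
move=> h; rewrite (cardfsD1 y) -addn1 addnC; apply: leq_add; last by case: (y \in V).
by apply: leq_trans h; exact: fsubset_leq_card.
Qed.

Lemma involution_even (X : choiceType) (A : {fset X}) (h : X -> X) :
  {in A, forall x, [/\ h x \in A, h x != x & h (h x) = x]} -> ~~ odd #|` A|.
Proof.
move: {2}#|` A| (leqnn #|` A|) => n; elim: n A => [|n IH] A.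
  by rewrite leqn0 => /eqP->.
move=> An hA; case: (fset_0Vmem A) => [->|[x xA]]; first by rewrite cardfs0.
have [hxA hxx hhx] := hA x xA.
have cA : #|` A| = (#|` A `\ x `\ h x|).+2.
  by rewrite (cardfsD1 x) xA (cardfsD1 (h x) (A `\ x)) !inE hxx hxA.
rewrite cA /= negbK; apply: IH; first by move: An; rewrite cA ltnS => /ltnW.
move=> y; rewrite !inE => /and3P[yhx yx yA]; have [hyA hyy hhy] := hA y yA.
split=> //; rewrite hyA andbT; apply/andP; split.
  by apply: contra_neq yx => E; rewrite -hhy E.
by apply: contra_neq yhx => E; rewrite -hhy E.
Qed.

Lemma double_count (X Y : choiceType) (A : {fset X}) (B : {fset Y}) (r : X -> Y -> bool) :
  \sum_(x <- A) #|` [fset y in B | r x y]| = \sum_(y <- B) #|` [fset x in A | r x y]|.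
Proof.
have card_sum (Z : choiceType) (C : {fset Z}) (p : pred Z) :
    #|` [fset z in C | p z]| = \sum_(z <- C) p z.
  rewrite card_fset_sum1 (perm_big [seq z <- C | p z]) /=.
    by rewrite big_filter big_mkcond; apply: eq_bigr => z _; case: (p z).
  apply: uniq_perm; rewrite ?filter_uniq ?fset_uniq // => z.
  by rewrite mem_filter !inE andbC.
under eq_bigr do rewrite card_sum.
under [RHS]eq_bigr do rewrite card_sum.
exact: exchange_big.
Qed.

Lemma sum_const (X : choiceType) (A : {fset X}) (F : X -> nat) k :
  {in A, forall x, F x = k} -> \sum_(x <- A) F x = #|` A| * k.
Proof.
move=> h; rewrite big_seq (eq_bigr (fun=> k)) => [|x /h //].
by rewrite -big_seq big_const_seq count_predT iter_addn_0 mulnC.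
Qed.

End Counting.

(* [Q] is the first derived complex of the cone over [S] with apex [a] whose
   base is folded by [phi], and [lab] numbers its cells. *)
Record folded_cone (S : simplex_family) (phi : nat -> nat) (a : nat)
    (lab : {fset nat} -> nat) (Q : simplex_family) : Prop := FoldedCone {
  folded_surface : surface S;
  folded_folding : folding S phi;
  folded_apex : a \notin vertices S;
  folded_label : forall x y, x \in cone a S -> x != fset0 -> y \in cone a S ->
    lab x = lab y <-> y = x \/ x \in S /\ y = phi @` x;
  folded_simplex : forall t, t \in Q <->
    (forall i, i \in t -> exists x, [/\ x \in cone a S, x != fset0 & lab x = i]) /\
    (forall i j, i \in t -> j \in t -> exists x y,
      [/\ x \in cone a S, y \in cone a S, x != fset0, x `<=` y &
          (lab x = i /\ lab y = j) \/ (lab x = j /\ lab y = i)])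
}.

(** * Chains of cells, and fixed vertices *)

Section Folded.
Variables (S : simplex_family) (phi : nat -> nat) (a : nat)
  (lab : {fset nat} -> nat) (Q : simplex_family).
Hypothesis fQ : folded_cone S phi a lab Q.
Implicit Types (s t x y z T : {fset nat}).

Let sS := folded_surface fQ.
Let cS := surface_complex sS.
Let fphi := folded_folding fQ.
Let aS := folded_apex fQ.
Let labE := folded_label fQ.

Let phiS x : x \in S -> phi @` x \in S. Proof. exact: (folding_in fphi). Qed.

Lemma folding_vertex x v : x \in S -> v \in x -> phi (phi v) = v.
Proof. by move=> xS vx; apply: (folding_inv fphi); apply/in_verticesP; exists x. Qed.

Lemma foldingK x : x \in S -> phi @` (phi @` x) = x.
Proof.
move=> xS; apply/fsetP=> i; apply/imfsetP/idP => [[_ /imfsetP[j /= jx ->] ->]|ix].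
  by rewrite (folding_vertex xS jx).
exists (phi i); first by apply/imfsetP; exists i.
by rewrite (folding_vertex xS ix).
Qed.

Lemma folding_card x : x \in S -> #|` phi @` x| = #|` x|.
Proof.
move=> xS; apply: card_in_imfset => i j /= ix jx ij.
by rewrite -(folding_vertex xS ix) ij (folding_vertex xS jx).
Qed.

Lemma folding_sub x y : x `<=` y -> phi @` x `<=` phi @` y.
Proof.
move=> xy; apply/fsubsetP=> _ /imfsetP[v /= vx ->]; apply/imfsetP; exists v => //.
exact: (fsubsetP xy).
Qed.

Lemma folding_fixed x y : y \in S -> x `<=` y -> phi @` x `<=` y ->
  {in x, forall v, phi v = v} /\ phi @` x = x.
Proof.
move=> yS xy pxy; have fx : {in x, forall v, phi v = v}.
  move=> v vx; apply: (folding_regular fphi yS); first exact: (fsubsetP xy).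
  by apply: (fsubsetP pxy); apply/imfsetP; exists v.
split=> //; apply/fsetP=> i; apply/imfsetP/idP => [[j /= jx ->]|ix].
  by rewrite fx.
by exists i; rewrite ?fx.
Qed.

Let coneS x : x \in S -> x \in cone a S. Proof. exact: cone_S. Qed.
Let conea x : x \in S -> a |` x \in cone a S. Proof. exact: cone_a. Qed.
Let cC : is_complex (cone a S) := cone_complex sS a.

Let sub_neq0' x y : x != fset0 -> x `<=` y -> y != fset0.
Proof. exact: sub_neq0. Qed.

Lemma folded_complex : is_complex Q.
Proof.
split; first by apply/(folded_simplex fQ); split=> i; rewrite ?inE.
move=> t /(folded_simplex fQ)[h1 h2] u /fsubsetP ut; apply/(folded_simplex fQ).
by split=> [i /ut/h1//|i j /ut iu /ut ju]; exact: h2.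
Qed.

Lemma chain3_in x y z : x \in cone a S -> y \in cone a S -> z \in cone a S ->
  x != fset0 -> x `<=` y -> y `<=` z -> [fset lab x; lab y; lab z] \in Q.
Proof.
move=> xC yC zC x0 xy yz; have y0 := sub_neq0' x0 xy; have z0 := sub_neq0' y0 yz.
have xz := fsubset_trans xy yz.
apply/(folded_simplex fQ); split=> [i|i j]; rewrite !inE -!orbA.
  by case/or3P=> /eqP->; [exists x|exists y|exists z].
case/or3P=> /eqP-> /or3P[] /eqP->.
- by exists x, x; split=> //; left.
- by exists x, y; split=> //; left.
- by exists x, z; split=> //; left.
- by exists x, y; split=> //; right.
- by exists y, y; split=> //; left.
- by exists y, z; split=> //; left.
- by exists x, z; split=> //; right.
- by exists y, z; split=> //; right.
- by exists z, z; split=> //; left.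
Qed.

Lemma chain2_in x y : x \in cone a S -> y \in cone a S ->
  x != fset0 -> x `<=` y -> [fset lab x; lab y] \in Q.
Proof.
by move=> xC yC x0 xy; have := chain3_in xC xC yC x0 (fsubset_refl _) xy; rewrite fsetUid.
Qed.

Definition label_le i j := exists x y, [/\ x \in cone a S, y \in cone a S,
  x != fset0, x `<=` y & lab x = i /\ lab y = j].

(** The two inclusions may use different representatives of the middle cell; these are exchanged by
    [phi], which is then applied to the first inclusion. *)
Lemma label_le_chain i j k : label_le i j -> label_le j k -> exists x y z,
  [/\ x \in cone a S, y \in cone a S, z \in cone a S, x != fset0 &
  [/\ x `<=` y, y `<=` z, lab x = i, lab y = j & lab z = k]].
Proof.
case=> x [y [xC yC x0 xy [<- <-]]] [y' [z [y'C zC y'0 y'z [/esym E <-]]]].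
have y0 := sub_neq0' x0 xy.
case/labE: E => // [yE|[yS yE]]; subst y'; first by exists x, y, z.
have xS := complexS cS xy yS.
have pxC := coneS (phiS xS); have pyC := coneS (phiS yS).
exists (phi @` x), (phi @` y), z; split=> //.
  by rewrite -cardfs_gt0 folding_card // cardfs_gt0.
split=> //; first exact: folding_sub.
  by apply/esym/labE => //; right.
by apply/esym/labE => //; right.
Qed.

Lemma folded_comparable i j t : t \in Q -> i \in t -> j \in t ->
  label_le i j \/ label_le j i.
Proof.
move=> /(folded_simplex fQ)[_ h] it jt; have [x [y [xC yC x0 xy []]]] := h i j it jt.
  by left; exists x, y.
by right; exists x, y.
Qed.

Lemma label_card x y : x \in cone a S -> x != fset0 -> y \in cone a S ->
  lab x = lab y -> #|` x| = #|` y|.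
Proof. by move=> xC x0 yC /labE[]// => [->//|[xS ->]]; rewrite folding_card. Qed.

Lemma apex_sub x y : y \in cone a S -> x \in S -> x `<=` y -> x `<=` y `\ a.
Proof.
move=> yC xS xy; apply/fsubsetP=> i ix; rewrite !inE (fsubsetP xy) // andbT.
by apply: contraNneq aS => <-; apply/in_verticesP; exists x.
Qed.

(** A lift that is unchanged at one end and reflected at the other would put a simplex and its image
    into a common simplex, where regularity makes them equal. *)
Lemma chain_lift_unique x y x' y' : x \in cone a S -> y \in cone a S ->
  x' \in cone a S -> y' \in cone a S -> x != fset0 -> x `<=` y -> x' `<=` y' ->
  lab x = lab x' -> lab y = lab y' ->
  (x' = x /\ y' = y) \/ [/\ x \in S, y \in S, x' = phi @` x & y' = phi @` y].
Proof.
move=> xC yC x'C y'C x0 xy x'y' Ex Ey; have y0 := sub_neq0' x0 xy.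
have fix_in z : x \in S -> z \in cone a S -> x `<=` z -> phi @` x `<=` z -> phi @` x = x.
  move=> xS zC xz pxz; have zS : z `\ a \in S by rewrite -(coneE sS aS).
  by have [] := @folding_fixed x (z `\ a) zS; rewrite ?apex_sub // phiS.
case/labE: Ey => // [E|[yS E]]; subst y'.
  case/labE: Ex => // [->|[xS E]]; [by left|subst x'; left].
  by rewrite (fix_in y).
have xS := complexS cS xy yS; right; split=> //.
case/labE: Ex => // [E|[]//]; subst x'; apply/esym.
by apply: (fix_in (phi @` y)); rewrite ?folding_sub //; exact: coneS (phiS yS).
Qed.

Section Cocycle.
Variables (P : {fset nat} -> Prop) (d : {fset nat} -> {fset nat} -> bool).
Hypotheses
  (Pphi : forall x, x \in S -> P x -> P (phi @` x))
  (dadd : forall x y z, x \in cone a S -> y \in cone a S -> z \in cone a S ->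
    x != fset0 -> P x -> P y -> P z -> x `<=` y -> y `<=` z -> d x y (+) d y z = d x z)
  (dphi : forall x y, x \in S -> y \in S -> x != fset0 -> P x -> P y -> x `<=` y ->
    d (phi @` x) (phi @` y) = d x y).

(** Pushes a [phi]-invariant function of inclusions down to the edges of [Q]. The predicate [P]
    allows the function to be specified only on part of the cone, such as the star of a vertex. *)
Definition chain_cochain i j := `[< exists x y, [/\ x \in cone a S, y \in cone a S,
  x != fset0, x `<=` y & [/\ P x, P y, d x y &
    (lab x = i /\ lab y = j) \/ (lab x = j /\ lab y = i)]] >].

Lemma chain_cochainC i j : chain_cochain i j = chain_cochain j i.
Proof.
apply/asboolP/asboolP => -[x [y [xC yC x0 xy [Px Py dxy h]]]]; exists x, y; split=> //;
  by split=> //; case: h; [right|left].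
Qed.

Lemma chain_cochainE x y : x \in cone a S -> y \in cone a S -> x != fset0 ->
  x `<=` y -> P x -> P y -> chain_cochain (lab x) (lab y) = d x y.
Proof.
move=> xC yC x0 xy Px Py; have d0 z : z \in cone a S -> z != fset0 -> P z -> d z z = false.
  by move=> zC z0 Pz; have := dadd zC zC zC z0 Pz Pz Pz (fsubset_refl _) (fsubset_refl _);
      case: (d z z).
have y0 := sub_neq0' x0 xy.
apply/asboolP/idP => [[x' [y' [x'C y'C x'0 x'y' [Px' Py' dxy' []]]]]|dxy]; last first.
  by exists x, y; split=> //; split=> //; left.
- case=> Ex Ey; have cx := label_card x'C x'0 yC Ex.
  have y'0 := sub_neq0' x'0 x'y'; have cy := label_card y'C y'0 xC Ey.
  have E : x' = y'.
    apply/eqP; rewrite eqEfcard x'y' cx cy; exact: fsubset_leq_card.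
  by move: dxy'; rewrite E d0.
- case=> Ex Ey; case: (chain_lift_unique xC yC x'C y'C x0 xy x'y' (esym Ex) (esym Ey)) => [[xE
    yE]|[xS yS xE yE]]; subst x' y' => //.
  by rewrite -dphi.
Qed.

Lemma chain_cochain_cocycle (K : simplex_family) : {subset K <= Q} ->
  (forall t x, t \in K -> x \in cone a S -> x != fset0 -> lab x \in t -> P x) ->
  cocycle K chain_cochain.
Proof.
move=> KQ KP i j k tK; set t := [fset i; j; k] in tK; have tQ := KQ _ tK.
have add i' j' k' : i' \in t -> j' \in t -> k' \in t -> label_le i' j' -> label_le j' k' ->
    chain_cochain i' j' (+) chain_cochain j' k' = chain_cochain i' k'.
  move=> it jt kt ij jk.
  have [x [y [z [xC yC zC x0 [xy yz xE yE zE]]]]] := label_le_chain ij jk.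
  have y0 := sub_neq0' x0 xy; have z0 := sub_neq0' y0 yz; subst i' j' k'.
  have Px := KP t x tK xC x0 it; have Py := KP t y tK yC y0 jt.
  have Pz := KP t z tK zC z0 kt.
  by rewrite !chain_cochainE ?dadd //; exact: fsubset_trans yz.
have [it jt kt] : [/\ i \in t, j \in t & k \in t] by rewrite /t !inE !eqxx !orbT.
have := folded_comparable tQ it jt; have := folded_comparable tQ jt kt.
have := folded_comparable tQ it kt.
case=> [ik|ki] [jk|kj] [ij|ji].
- exact: add.
- by rewrite (chain_cochainC i j) -(add j i k) //; case: (chain_cochain j i); case:
    (chain_cochain i k).
- by rewrite -(add i k j) // (chain_cochainC j k); case: (chain_cochain i k); case:
    (chain_cochain k j).
- have := add k j i kt jt it kj ji.
  by rewrite (chain_cochainC i j) (chain_cochainC j k) (chain_cochainC i k) addbC.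
- exact: add.
- have := add j k i jt kt it jk ki.
  by rewrite (chain_cochainC i j) (chain_cochainC i k) => <-; case: (chain_cochain j k); case:
      (chain_cochain k i).
- have := add k i j kt it jt ki ij.
  by rewrite (chain_cochainC j k) (chain_cochainC i k) => <-; case: (chain_cochain k i); case:
      (chain_cochain i j).
- have := add k j i kt jt it kj ji.
  by rewrite (chain_cochainC i j) (chain_cochainC j k) (chain_cochainC i k) addbC.
Qed.

End Cocycle.

(** An arbitrary choice between [x] and its image, made by comparing codes. *)
Definition sheet x : bool := choice.pickle x < choice.pickle (phi @` x).

Lemma sheet_phi x : x \in S -> phi @` x != x -> sheet (phi @` x) = ~~ sheet x.
Proof.
move=> xS nx; rewrite /sheet foldingK // -leqNgt [RHS]leq_eqVlt.
case: eqP => //= h; case/eqP: nx; exact: (pcan_inj choice.pickleK).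
Qed.

(** Otherwise [phi] would act freely on the circle around [v], hence as the antipodal map. The link
    of the cell of [v] would be a disc with opposite boundary points identified, a projective plane,
    whose first cohomology is not zero. *)
Lemma no_isolated_fixed v :
  (forall i, [fset i] \in Q -> H1 (link Q [fset i])) ->
  v \in vertices S -> phi v = v ->
  exists w, [/\ w != v, [fset v; w] \in S & phi w = w].
Proof.
move=> hQ vS pv; apply: contrapT => nofix.
have vS1 : [fset v] \in S by rewrite -in_vertices.
have v0 : [fset v] != fset0 by rewrite -cardfs_gt0 cardfs1.
pose P x := v \in x /\ x != [fset v].
have nfix x : x \in S -> P x -> phi @` x != x.
  move=> xS [vx xv]; apply: contra_notN nofix => /eqP E.
  have /fset0Pn[w] : x `\ v != fset0.
    rewrite fsetD_eq0; apply: contra xv => h.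
    by rewrite eqEfsubset h fsub1set.
  rewrite !inE => /andP[wv wx]; exists w; split=> //.
    by apply: complexS cS _ xS; rewrite fsubUset !fsub1set vx.
  have [|h _] := @folding_fixed x x xS (fsubset_refl _); first by rewrite E.
  exact: h.
(* Upstairs [sh] is a potential for [d], but [phi] negates it on [S], so only the differences
   descend to the quotient. *)
pose sh x := (a \notin x) && sheet x.
pose d x y := sh x (+) sh y.
have aphi x : x \in S -> a \notin phi @` x by move=> xS; exact: a_notin (phiS xS).
have shphi x : x \in S -> P x -> sh (phi @` x) = ~~ sh x.
  by move=> xS Px; rewrite /sh aphi // (a_notin aS xS) sheet_phi // nfix.
have Pphi x : x \in S -> P x -> P (phi @` x).
  move=> xS [vx xv]; split; first by apply/imfsetP; exists v.
  by apply: contra_neq xv => E; rewrite -[x]foldingK // E image_fset1 pv.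
have cocy := @chain_cochain_cocycle P d _ _ (link Q [fset lab [fset v]]).
set L := link Q _ in cocy.
have vQ : [fset lab [fset v]] \in Q.
  by have := chain2_in (coneS vS1) (coneS vS1) v0 (fsubset_refl _); rewrite fsetUid.
have cQ := folded_complex.
have LP t x : t \in L -> x \in cone a S -> x != fset0 -> lab x \in t -> P x.
  rewrite in_linkE // fdisjoint1X => /andP[vt tQ] xC x0 xt.
  have xv : lab x != lab [fset v] by apply: contraNneq vt => <-.
  have it : lab [fset v] \in [fset lab [fset v]] `|` t by rewrite !inE eqxx.
  have jt : lab x \in [fset lab [fset v]] `|` t by rewrite inE xt orbT.
  case: (folded_comparable tQ it jt).
    case=> x1 [y1 [x1C y1C x10 xy1 [/esym E1 E2]]].
    have xE : x1 = [fset v].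
      case/labE: E1 => //; first exact: coneS.
      by case=> _ ->; rewrite image_fset1 pv.
    rewrite xE fsub1set in xy1; split; last by apply: contra_neq xv => ->.
    have y10 : y1 != fset0 by apply/fset0Pn; exists v.
    by case/labE: E2 => // [->//|[y1S ->]]; apply/imfsetP; exists v.
  case=> x1 [y1 [x1C y1C x10 xy1 [E1 /esym E2]]].
  have yE : y1 = [fset v].
    case/labE: E2 => //; first exact: coneS.
    by case=> _ ->; rewrite image_fset1 pv.
  move: xy1; rewrite yE fsubset1 (negbTE x10) orbF => /eqP xE.
  by rewrite -E1 xE eqxx in xv.
have gL : cocycle L (chain_cochain P d).
  apply: cocy => //.
  - by move=> *; rewrite /d; case: (sh _); case: (sh _); case: (sh _).
  - by move=> x y xS yS _ Px Py _; rewrite /d !shphi // addbN addNb negbK.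
  - by move=> t; rewrite in_link => /and3P[].
have [f fL] := hQ _ vQ _ gL.
have dL x y : x \in S -> y \in S -> P x -> P y -> x `<=` y ->
    sheet x (+) sheet y = f (lab x) (+) f (lab y).
  move=> xS yS Px Py xy; have x0 : x != fset0 by apply/fset0Pn; exists v; case: Px.
  rewrite -fL; last first.
    rewrite in_linkE // fdisjoint1X !inE !negb_or fsetUA.
    rewrite chain3_in ?coneS ?fsub1set //; last by case: Px.
    rewrite andbT; apply/andP; split; apply/eqP.
      by move/labE; case=> //; [exact: coneS|exact: coneS|case: Px => _ /eqP|case=> _; case: Px
          => _ /eqP; rewrite image_fset1 pv].
    by move/labE; case=> //; [exact: coneS|exact: coneS|case: Py => _ /eqP|case=> _; case: Py
        => _ /eqP; rewrite image_fset1 pv].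
  rewrite chain_cochainE ?coneS //.
  - by rewrite /d /sh !(a_notin aS).
  - by move=> *; rewrite /d; case: (sh _); case: (sh _); case: (sh _).
  - by move=> x' y' xS' yS' _ Px' Py' _; rewrite /d !shphi // addbN addNb negbK.
(* With a potential downstairs, [c] does not change across the edges at [v], yet [phi] negates it.
   This contradicts the connectedness of the star of [v]. *)
pose c T := f (lab T) (+) sheet T.
have big T : 1 < #|` T| -> T != [fset v] by apply: contraTneq => ->; rewrite cardfs1.
have cst := @star_connected _ sS v c.
have adj : forall T T' s, T \in S -> T' \in S -> #|` T| = 3 -> #|` T'| = 3 ->
    s `<=` T -> s `<=` T' -> #|` s| = 2 -> v \in s -> c T = c T'.
  move=> T T' s TS TS' cT cT' sT sT' cs vs.
  have sS' := complexS cS sT TS.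
  have Ps : P s by split=> //; apply: big; rewrite cs.
  have PT : P T by split; [exact: (fsubsetP sT)|apply: big; rewrite cT].
  have PT' : P T' by split; [exact: (fsubsetP sT')|apply: big; rewrite cT'].
  have := dL s T sS' TS Ps PT sT; have := dL s T' sS' TS' Ps PT' sT'.
  rewrite /c; case: (sheet s); case: (sheet T); case: (sheet T'); case: (f (lab s));
    case: (f (lab T)); by case: (f (lab T')).
have [T [TS cT]] := surface_extend sS vS1; rewrite fsub1set => vT.
have PT : P T by split=> //; apply: big; rewrite cT.
have vpT : v \in phi @` T by apply/imfsetP; exists v.
have := cst adj T (phi @` T) TS (phiS TS) cT; rewrite folding_card // => /(_ cT vT vpT).
have -> : c (phi @` T) = ~~ c T.
  rewrite /c sheet_phi ?nfix // addbN; congr (~~ (_ (+) _)); congr f.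
  apply/esym/labE; [exact: coneS| |exact: coneS (phiS TS)|by right].
  by apply/fset0Pn; exists v.
by case: (c T).
Qed.

End Folded.

(** * Local colourings around a fixed vertex *)

Section Coloring.
Variables (S : simplex_family) (phi : nat -> nat).
Hypotheses (sS : surface S) (fphi : folding S phi).
Implicit Types (s t T : {fset nat}).

Let cS := surface_complex sS.

Let phiS x : x \in S -> phi @` x \in S. Proof. exact: (folding_in fphi). Qed.

Lemma card_sep (X : choiceType) (A : {fset X}) (p : pred X) :
  (#|` [fset x in A | p x]| + #|` [fset x in A | ~~ p x]|)%N = #|` A|.
Proof.
have E1 : [fset x in A | p x] = A `&` [fset x in A | p x].
  by apply/fsetP=> x; rewrite !inE; case: (x \in A).
have E2 : [fset x in A | ~~ p x] = A `\` [fset x in A | p x].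
  by apply/fsetP=> x; rewrite !inE; case: (x \in A); rewrite ?andbT ?andbF.
by rewrite E2 {1}E1 cardfsID.
Qed.

Section FixedVertex.
Variable v : nat.
Hypotheses (vS : [fset v] \in S).

Definition triangles_at := [fset T in S | (#|` T| == 3) && (v \in T)].
Definition edges_at := [fset s in S | (#|` s| == 2) && (v \in s)].

Lemma in_triangles_at T : (T \in triangles_at) = [&& T \in S, #|` T| == 3 & v \in T].
Proof. by rewrite !inE. Qed.

Lemma in_edges_at s : (s \in edges_at) = [&& s \in S, #|` s| == 2 & v \in s].
Proof. by rewrite !inE. Qed.

(** Each triangle at [v] has two edges at [v], and each such edge lies in two triangles. *)
Lemma card_edges_triangles : #|` edges_at| = #|` triangles_at|.
Proof.
have := double_count triangles_at edges_at (fun T s => s `<=` T).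
rewrite (@sum_const _ _ _ 2) ?(@sum_const _ edges_at _ 2); first by lia.
- move=> s; rewrite in_edges_at => /and3P[sS' /eqP cs vs].
  have [T [TS cT sT]] := surface_extend sS sS'.
  have [U [US cU sU UT hU]] := other_triangle sS TS cT cs sT.
  have -> : [fset T in triangles_at | s `<=` T] = [fset T; U]; last by rewrite cardfs2 eq_sym UT.
  apply/fsetP=> W; rewrite in_fset /= !inE; apply/idP/idP.
    by case/andP=> /and3P[WS /eqP cW _] sW; have [->|->] := hU W WS cW sW; rewrite eqxx ?orbT.
  by case/orP=> /eqP->; rewrite ?TS ?US ?cT ?cU ?sT ?sU ?(fsubsetP sT _ vs) ?(fsubsetP sU _ vs)
      eqxx.
- move=> T; rewrite in_triangles_at => /and3P[TS /eqP cT vT].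
  have : #|` T `\ v| = 2 by move: cT; rewrite (cardfsD1 v) vT add1n => -[].
  case/cardfs2E=> x [y [xy TE]].
  have : x \in T `\ v by rewrite TE !inE eqxx.
  have : y \in T `\ v by rewrite TE !inE eqxx orbT.
  rewrite !inE => /andP[yv yT] /andP[xv xT].
  have -> : [fset s in edges_at | s `<=` T] = [fset [fset v; x]; [fset v; y]].
    apply/fsetP=> s; rewrite in_fset /= !inE; apply/idP/idP.
      case/andP=> /and3P[sS' /eqP cs vs] sT.
      have /cardfs1P[z zE] : #|` s `\ v| == 1%N by move: cs; rewrite (cardfsD1 v) vs add1n =>
          -[->].
      have : z \in T `\ v by apply: (fsubsetP (fsetSD _ sT)); rewrite zE inE.
      by rewrite TE !inE -(fsetD1K vs) zE => /orP[]/eqP->; rewrite eqxx ?orbT.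
    have pr z : z != v -> z \in T -> [&& [fset v; z] \in S, #|` [fset v; z]| == 2 & v \in [fset
        v; z]] && ([fset v; z] `<=` T).
      move=> zv zT; have sT : [fset v; z] `<=` T by rewrite fsubUset !fsub1set vT.
      by rewrite (complexS cS sT TS) sT cardfs2 (eq_sym v z) zv !inE eqxx.
    by case/orP=> /eqP->; have := pr x xv xT; have := pr y yv yT; rewrite !inE.
  rewrite cardfs2; case: eqP => // /fsetP/(_ x); rewrite !inE eqxx orbT (negbTE xv) /=.
  by rewrite (negbTE xy).
Qed.

Let folding_tri T : T \in S -> #|` T| = 3 ->
  [/\ phi @` T \in S, #|` phi @` T| = 3, phi @` T != T & phi @` (phi @` T) = T].
Proof.
move=> TS cT; have fv u : u \in T -> phi (phi u) = u.
  by move=> uT; apply: (folding_inv fphi); apply/in_verticesP; exists T.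
split; [exact: phiS| |exact: (folding_triangle fphi)|].
  by rewrite card_in_imfset // => i j /= iT jT ij; rewrite -(fv i iT) ij fv.
apply/fsetP=> i; apply/imfsetP/idP => [[_ /imfsetP[j /= jT ->] ->]|iT].
  by rewrite fv.
by exists (phi i); [apply/imfsetP; exists i|rewrite fv].
Qed.

(* Of the edges at a fixed vertex an even number is fixed, so if there is a
   fixed one, then removing the fixed ones disconnects the star. *)
Lemma local_coloring w0 : phi v = v -> w0 != v -> [fset v; w0] \in S -> phi w0 = w0 ->
  exists c : {fset nat} -> bool,
    (forall T, T \in S -> #|` T| = 3 -> v \in T -> c (phi @` T) = ~~ c T) /\
    (forall T T' s, T \in S -> T' \in S -> #|` T| = 3 -> #|` T'| = 3 ->
       s `<=` T -> s `<=` T' -> #|` s| = 2 -> v \in s -> phi @` s != s -> c T = c T').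
Proof.
move=> pv w0v vwS pw.
have phi_v t : v \in t -> v \in phi @` t by move=> vt; apply/imfsetP; exists v.
pose F := [fset s in edges_at | phi @` s == s].
pose N := [fset s in edges_at | phi @` s != s].
have inF s : (s \in F) = (s \in edges_at) && (phi @` s == s).
  by rewrite /F; set B := edges_at; rewrite !inE.
have inN s : (s \in N) = (s \in edges_at) && (phi @` s != s).
  by rewrite /N; set B := edges_at; rewrite !inE.
have cFN : (#|` F| + #|` N|)%N = #|` edges_at| by exact: card_sep.
have phiKS t : t \in S -> phi @` (phi @` t) = t.
  move=> tS; have fv u : u \in t -> phi (phi u) = u.
    by move=> ut; apply: (folding_inv fphi); apply/in_verticesP; exists t.
  apply/fsetP=> i; apply/imfsetP/idP => [[_ /imfsetP[j /= jT ->] ->]|iT].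
    by rewrite fv.
  by exists (phi i); [apply/imfsetP; exists i|rewrite fv].
have oT : ~~ odd #|` triangles_at|.
  apply: (@involution_even _ _ (fun t => phi @` t)) => T; rewrite !in_triangles_at => /and3P[TS
      /eqP cT vT].
  have [h1 h2 h3 h4] := folding_tri TS cT.
  by rewrite h1 h2 eqxx phi_v.
have phi_card2 s : s \in S -> #|` phi @` s| = #|` s|.
  move=> sS'; apply: card_in_imfset => i j /= is_ js ij.
  rewrite -(folding_inv fphi (v := i)) ?ij ?(folding_inv fphi) //;
    by apply/in_verticesP; exists s.
have oN : ~~ odd #|` N|.
  apply: (@involution_even _ _ (fun t => phi @` t)) => s; rewrite inN => /andP[].
  rewrite in_edges_at => /and3P[sS' cs vs] ns; rewrite inN in_edges_at.
  rewrite phiS // phi_card2 // cs phi_v // !phiKS //; split=> //=.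
  by rewrite eq_sym.
have F1 : [fset v; w0] \in F.
  rewrite inF in_edges_at vwS cardfs2 (eq_sym v) w0v !inE eqxx /=.
  by rewrite image_fset2 pv pw.
have F0 : 0 < #|` F| by rewrite cardfs_gt0; apply/fset0Pn; exists [fset v; w0].
(* There are as many edges as triangles at [v], an even number, and the number of edges that are not
   fixed is even too. So one fixed edge entails a second, and two edges at least are missing from
   [N]. *)
have NT : #|` N|.+1 < #|` triangles_at|.
  rewrite -card_edges_triangles -cFN; move: oT; rewrite -card_edges_triangles -cFN oddD.
  rewrite (negbTE oN) addbF; case: #|` F| F0 => [|[|k]] //= _ _.
  by rewrite addSn addSn !ltnS leq_addl.
(* Joined across the edges of [N] only, the triangles at [v] are too many to form a connected
   graph. *)
have [c cN [T1 [T2 [T1a T2a c12]]]] : exists2 c : {fset nat} -> bool,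
    (forall T T' s, T \in S -> T' \in S -> #|` T| = 3 -> #|` T'| = 3 ->
       s `<=` T -> s `<=` T' -> #|` s| = 2 -> v \in s -> phi @` s != s -> c T = c T') &
    exists T T', [/\ T \in triangles_at, T' \in triangles_at & c T <> c T'].
  apply: contrapT => hc; move: NT; rewrite ltnNge => /negP[].
  pose oth s := xget fset0 (fun U : {fset nat} =>
    [/\ U \in S, #|` U| = 3, s `<=` U & U != triangle_at S s]).
  pose E := [seq (triangle_at S s, oth s) | s <- enum_fset N].
  have -> : #|` N| = size E by rewrite size_map.
  apply: connected_card => c cE T T' Ta T'a; apply: contrapT => cTT'; apply: hc.
  exists c; last by exists T, T'.
  move=> U U' s US U'S cU cU' sU sU' cs vs ns.
  have sS' := complexS cS sU US.
  have [V0 cV sV] := triangle_atP sS sS'.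
  have [W [WS cW sW WV hW]] := other_triangle sS V0 cV cs sV.
  have oE : oth s = W.
    have [h1 h2 h3 h4] := @xgetPex _ fset0 (fun U : {fset nat} =>
      [/\ U \in S, #|` U| = 3, s `<=` U & U != triangle_at S s])
      (ex_intro _ W (And4 WS cW sW WV)).
    by case: (hW _ h1 h2 h3) => // h; rewrite h eqxx in h4.
  have cVW : c (triangle_at S s) = c W.
    rewrite -oE; apply: (cE (triangle_at S s, oth s)); apply: (map_f (fun s => (triangle_at S
        s, oth s))).
    by rewrite -[_ \in _]/(s \in N) inN in_edges_at sS' cs eqxx vs.
  by case: (hW U US cU sU) => ->; case: (hW U' U'S cU' sU') => ->.
exists c; split=> //.
(* [c'] is constant on the star. If it were false, [c] would also agree across fixed edges, whose
   two triangles are exchanged by [phi], and so be constant. Hence it is true, and [phi] negates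
   [c]. *)
pose c' T := c T (+) c (phi @` T).
have c'adj T T' s : T \in S -> T' \in S -> #|` T| = 3 -> #|` T'| = 3 ->
    s `<=` T -> s `<=` T' -> #|` s| = 2 -> v \in s -> c' T = c' T'.
  move=> TS T'S cT cT' sT sT' cs vs; have sS' := complexS cS sT TS.
  have [h1 h2 h3 h4] := folding_tri TS cT; have [h1' h2' _ _] := folding_tri T'S cT'.
  have psub U : s `<=` U -> phi @` s `<=` phi @` U.
    move=> sU; apply/fsubsetP=> _ /imfsetP[u /= us ->]; apply/imfsetP; exists u => //.
    exact: (fsubsetP sU).
  case: (eqVneq (phi @` s) s) => [ps|ns].
    have sp : s `<=` phi @` T by rewrite -ps psub.
    have [W [WS cW sW WT hW]] := other_triangle sS TS cT cs sT.
    have WE : phi @` T = W by case: (hW _ h1 h2 sp) => // h; rewrite h eqxx in h3.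
    case: (hW T' T'S cT' sT') => ->; first by [].
    by rewrite /c' -WE h4 addbC.
  rewrite /c' (cN T T' s) // (cN (phi @` T) (phi @` T') (phi @` s)) ?psub ?phi_card2 //.
    exact: phi_v.
  by rewrite phiKS // eq_sym.
have c'const := star_connected sS c'adj.
move: T1a T2a; rewrite !in_triangles_at => /and3P[T1S /eqP cT1 vT1] /and3P[T2S /eqP cT2 vT2].
case E : (c' T1).
  move=> T TS cT vT; have := c'const T T1 TS T1S cT cT1 vT vT1; rewrite E /c'.
  by case: (c T); case: (c _).
case: c12; apply: (star_connected sS (v := v)) => // T T' s TS T'S cT cT' sT sT' cs vs.
case: (eqVneq (phi @` s) s) => [ps|ns]; last exact: (cN T T' s).
have [h1 h2 h3 h4] := folding_tri TS cT.
have sp : s `<=` phi @` T.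
  rewrite -ps; apply/fsubsetP=> _ /imfsetP[u /= us ->]; apply/imfsetP; exists u => //.
  exact: (fsubsetP sT).
have [W [WS cW sW WT hW]] := other_triangle sS TS cT cs sT.
have WE : phi @` T = W by case: (hW _ h1 h2 sp) => // h; rewrite h eqxx in h3.
case: (hW T' T'S cT' sT') => ->; first by [].
have := c'const T T1 TS T1S cT cT1 (fsubsetP sT _ vs) vT1.
by rewrite E /c' WE; case: (c T); case: (c W).
Qed.

End FixedVertex.
End Coloring.

(** * From local colourings to a global one *)

Section GlobalColoring.
Variables (S : simplex_family) (phi : nat -> nat) (a : nat)
  (lab : {fset nat} -> nat) (Q : simplex_family).
Hypothesis fQ : folded_cone S phi a lab Q.
Implicit Types (s t x y T : {fset nat}).

Let sS := folded_surface fQ.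
Let cS := surface_complex sS.
Let fphi := folded_folding fQ.
Let aS := folded_apex fQ.

Let phiS x : x \in S -> phi @` x \in S. Proof. exact: (folding_in fphi). Qed.

Definition adjacent_triangles T T' s := [/\ T \in S, T' \in S, #|` T| = 3, #|` T'| = 3 &
  [/\ s `<=` T, s `<=` T' & #|` s| = 2]].

Definition good_coloring x (c : {fset nat} -> bool) :=
  (forall T, T \in S -> #|` T| = 3 -> x `<=` T -> c (phi @` T) = ~~ c T) /\
  (forall T T' s, adjacent_triangles T T' s -> x `<=` s -> phi @` s != s -> c T = c T').

Hypothesis HL : forall i, [fset i] \in Q -> H1 (link Q [fset i]).

Lemma good_coloring_exists x : x \in S -> x != fset0 -> phi @` x = x ->
  exists c, good_coloring x c.
Proof.
move=> xS x0 px.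
have [fx _] := @folding_fixed _ _ _ _ _ fQ x x xS (fsubset_refl _) ltac:(by rewrite px).
case cx: #|` x| => [|[|[|k]]].
- by move/eqP: cx; rewrite cardfs_eq0 (negbTE x0).
- move/eqP: cx => /cardfs1P[v xE]; rewrite {}xE in xS px fx *.
  have pv : phi v = v by apply: fx; rewrite inE.
  have [w [wv vwS pw]] := no_isolated_fixed fQ HL (etrans (in_vertices v cS) xS) pv.
  have [c [h1 h2]] := local_coloring sS fphi xS pv wv vwS pw.
  exists c; split=> [T TS cT|T T' s [TS T'S cT cT' [sT sT' cs]]]; rewrite fsub1set.
    exact: h1.
  by move=> vs ns; exact: (h2 T T' s).
(* At a fixed edge the second condition is void, since [s] would be the edge itself; and no triangle
   is fixed, so [phi] negates [sheet]. *)
- exists (sheet phi); split=> [T TS cT _|T T' s [TS T'S cT cT' [sT sT' cs]] xs ns].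
    by rewrite (sheet_phi fQ) // (folding_triangle fphi).
  suff xE : x = s by rewrite -xE px eqxx in ns.
  by apply/eqP; rewrite eqEfcard xs cx cs.
- have x3 : #|` x| = 3.
    by apply/eqP; rewrite eqn_leq (surface_card sS xS) cx.
  by have := folding_triangle fphi xS x3; rewrite px eqxx.
Qed.

(** If [x] is not fixed, all triangles at [x] get the sheet of [x] as colour. Either way [phi]
    negates the colour, and it does not change across edges that are not fixed. *)
Definition chi x T := if phi @` x == x then xget (fun=> false) (good_coloring x) T
  else sheet phi x.

Lemma chi_phi x T : x \in S -> x != fset0 -> T \in S -> #|` T| = 3 -> x `<=` T ->
  chi (phi @` x) (phi @` T) = ~~ chi x T.
Proof.
move=> xS x0 TS cT xT; rewrite /chi (foldingK fQ) // (eq_sym x).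
case: eqP => [px|/eqP npx]; last by rewrite (sheet_phi fQ).
have [c gc] := good_coloring_exists xS x0 px; rewrite px.
by have [h _] := @xgetPex _ (fun=> false) (good_coloring x) (ex_intro _ c gc); exact: h.
Qed.

Lemma chi_adjacent x T T' s : adjacent_triangles T T' s -> x != fset0 -> x `<=` s ->
  phi @` s != s -> chi x T = chi x T'.
Proof.
move=> adj x0 xs ns; have [TS _ _ _ [sT _ _]] := adj.
have xS : x \in S := complexS cS (fsubset_trans xs sT) TS.
rewrite /chi; case: eqP => // px.
have [c gc] := good_coloring_exists xS x0 px.
have [_ h] := @xgetPex _ (fun=> false) (good_coloring x) (ex_intro _ c gc).
exact: (h T T' s).
Qed.

Definition jump x y := chi x (triangle_at S y) (+) chi y (triangle_at S y).

(** Across a fixed edge both colourings change, across any other edge neither does; so their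
    difference does not depend on the triangle. *)
Lemma jumpE x y T : x != fset0 -> x `<=` y -> y `<=` T -> T \in S -> #|` T| = 3 ->
  jump x y = chi x T (+) chi y T.
Proof.
move=> x0 xy yT TS cT; have yS := complexS cS yT TS.
have y0 := sub_neq0 x0 xy.
have [US cU yU] := triangle_atP sS yS; rewrite /jump; set U := triangle_at S y in US cU yU *.
case cy: #|` y| => [|[|[|k]]].
- by move/eqP: cy; rewrite cardfs_eq0 (negbTE y0).
- suff -> : x = y by rewrite !addbb.
  apply/eqP; rewrite eqEfcard xy cy cardfs_gt0; exact: x0.
- have adj : adjacent_triangles U T y by [].
  case: (eqVneq (phi @` y) y) => [py|ny]; last first.
    by rewrite (chi_adjacent adj) // (chi_adjacent (x := y) adj).
  have pUS := phiS US; have pUU := folding_triangle fphi US cU.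
  have cpU : #|` phi @` U| = 3 by rewrite (folding_card fQ).
  have ypU : y `<=` phi @` U by rewrite -py (folding_sub phi).
  have [|_ px] := @folding_fixed _ _ _ _ _ fQ x y yS xy.
    by rewrite -[X in _ `<=` X]py (folding_sub phi).
  have [W [WS cW yW WU hW]] := other_triangle sS US cU cy yU.
  have WE : phi @` U = W by case: (hW _ pUS cpU ypU) => // h; rewrite h eqxx in pUU.
  case: (hW T TS cT yT) => [->//|->].
  have xS := complexS cS xy yS.
  have := chi_phi xS x0 US cU (fsubset_trans xy yU); rewrite px WE => ->.
  have := chi_phi yS y0 US cU yU; rewrite py WE => ->.
  by rewrite addbN addNb negbK.
- suff -> : U = T by [].
  have /eqP <- : y == U by rewrite eqEfcard yU cU cy.
  by apply/eqP; rewrite eqEfcard yT cT cy.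
Qed.

(** On [S] the jumps have a potential because [S] has no first cohomology. The potential need not be
    [phi]-invariant; it serves to extend the jumps over the interior of the cone. *)
Lemma jump_potential : exists psi : {fset nat} -> bool, forall x y,
  x != fset0 -> x `<=` y -> y \in S -> jump x y = psi x (+) psi y.
Proof.
have : acyclic 3 S by have := surface_acyclic sS (complex0 cS); rewrite cardfs0 link0.
case=> _ hS.
have n1 (u : nat) : [fset u] != fset0 by rewrite -cardfs_gt0 cardfs1.
(* The values at vertices suffice: an edge [uw] is crossed through its midpoint, and a general
   simplex is later reached from one chosen vertex of it. *)
pose g u w := jump [fset u] [fset u; w] (+) jump [fset w] [fset u; w].
have gE u w T : [fset u; w] `<=` T -> T \in S -> #|` T| = 3 ->
    g u w = chi [fset u] T (+) chi [fset w] T.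
  move=> uwT TS cT; rewrite /g !(jumpE _ _ uwT) ?fsubsetUl ?fsubsetUr //.
  by case: (chi [fset u] T); case: (chi [fset w] T); case: (chi _ T).
have [f fS] : exists f : nat -> bool, forall u w, [fset u; w] \in S -> g u w = f u (+) f w.
  apply: hS => u w z uwzS; have [TS cT uwzT] := triangle_atP sS uwzS.
  have sub (i j : nat) : [fset i; j] `<=` [fset u; w; z] -> [fset i; j] `<=` triangle_at S
      [fset u; w; z].
    by move=> h; exact: fsubset_trans uwzT.
  rewrite !(gE _ _ _ _ TS cT) ?sub //; try by fset_tac.
  by case: (chi [fset u] _); case: (chi [fset w] _); case: (chi [fset z] _).
pose pt x : nat := xget 0 [set u : nat | u \in x]%classic.
have ptP x : x != fset0 -> pt x \in x.
  by case/fset0Pn=> u ux; exact: (@xgetPex _ 0 [set u : nat | u \in x]%classic (ex_intro _ u ux)).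
exists (fun x => f (pt x) (+) jump [fset pt x] x) => x y x0 xy yS.
have y0 := sub_neq0 x0 xy; have [TS cT yT] := triangle_atP sS yS.
have px := ptP x x0; have py := ptP y y0.
have xT := fsubset_trans xy yT.
rewrite (jumpE x0 xy yT TS cT) (jumpE (n1 _) _ xT TS cT) ?fsub1set //.
rewrite (jumpE (n1 _) _ yT TS cT) ?fsub1set //.
have pxy : [fset pt x; pt y] `<=` triangle_at S y.
  by rewrite fsubUset !fsub1set (fsubsetP xT) // (fsubsetP yT).
have := fS _ _ (complexS cS pxy TS); rewrite (gE _ _ _ pxy TS cT).
case: (f (pt x)); case: (f (pt y)); case: (chi [fset pt x] _); case: (chi [fset pt y] _) => //;
  by case: (chi x _); case: (chi y _).
Qed.

(* The local colourings differ along inclusions by a cocycle of [Q]; a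
   potential of it makes them coherent. *)
Lemma global_coloring : H1 Q -> exists c : {fset nat} -> bool,
  (forall T, T \in S -> #|` T| = 3 -> c (phi @` T) = ~~ c T) /\
  (forall T T' s, adjacent_triangles T T' s -> phi @` s != s -> c T = c T').
Proof.
move=> hQ; have [psi psiP] := jump_potential.
(* An inclusion into a simplex with apex [a] takes the value [psi x], so that each chain passing
   from [S] into the cone satisfies the cocycle condition. *)
pose d x y := if a \notin y then jump x y else if a \notin x then psi x else false.
have coneN x : x \in cone a S -> a \notin x -> x \in S by move=> *; exact: (cone_notin sS aS).
have subN x y : x `<=` y -> a \notin y -> a \notin x.
  by move=> xy; apply: contra; exact: (fsubsetP xy).
have dadd x y z : x \in cone a S -> y \in cone a S -> z \in cone a S ->
    x != fset0 -> True -> True -> True -> x `<=` y -> y `<=` z -> d x y (+) d y z = d x z.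
  move=> xC yC zC x0 _ _ _ xy yz; have y0 := sub_neq0 x0 xy; rewrite /d.
  case az: (a \in z) => /=; last first.
    have ay := subN y z yz (negbT az); have ax := subN x y xy ay.
    rewrite ay !psiP ?(coneN _ zC) ?az ?(coneN _ yC) //; last exact: fsubset_trans yz.
    by case: (psi x); case: (psi y); case: (psi z).
  case ay: (a \in y) => /=; first by rewrite addbF.
  rewrite (subN x y xy) ?ay // psiP ?(coneN _ yC) ?ay //.
  by case: (psi x); case: (psi y).
have dphi x y : x \in S -> y \in S -> x != fset0 -> True -> True -> x `<=` y ->
    d (phi @` x) (phi @` y) = d x y.
  move=> xS yS x0 _ _ xy; rewrite /d !(a_notin aS) ?phiS //.
  have [TS cT yT] := triangle_atP sS yS; have y0 := sub_neq0 x0 xy.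
  have px0 : phi @` x != fset0 by rewrite -cardfs_gt0 (folding_card fQ) // cardfs_gt0.
  rewrite (jumpE x0 xy yT TS cT) (@jumpE _ _ (phi @` (triangle_at S y))) ?(folding_sub phi)
      ?phiS ?(folding_card fQ) //.
  rewrite !chi_phi //; last exact: fsubset_trans yT.
  by rewrite addbN addNb negbK.
have [f fE] : exists f : nat -> bool, forall i j, [fset i; j] \in Q ->
    chain_cochain S a lab (fun=> True) d i j = f i (+) f j.
  apply: hQ; apply: (chain_cochain_cocycle fQ (P := fun=> True)) => //.
(* Triangles are not fixed, so their local colouring is [sheet]. The correction [f] is the same for
   [T] and its image, and at an edge that is not fixed it makes both adjacent triangles agree with
   the edge. *)
exists (fun T => sheet phi T (+) f (lab T)); split=> [T TS cT|T T' s [TS T'S cT cT' [sT sT'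
    cs]] ns].
  have nT := folding_triangle fphi TS cT.
  rewrite (sheet_phi fQ) // addNb; congr (~~ (_ (+) _)); congr f.
  apply/esym/(folded_label fQ); [exact: (cone_S sS aS)| |apply: (cone_S sS aS); exact: phiS|by
      right].
  by rewrite -cardfs_gt0 cT.
have s0 : s != fset0 by rewrite -cardfs_gt0 cs.
have sS' := complexS cS sT TS.
suff h U : U \in S -> #|` U| = 3 -> s `<=` U -> sheet phi U (+) f (lab U) = sheet phi s (+) f
    (lab s).
  by rewrite !h.
move=> US cU sU; have sC := cone_S sS aS sS'; have UC := cone_S sS aS US.
have := fE _ _ (chain2_in fQ sC UC s0 sU).
rewrite (chain_cochainE fQ dadd dphi) // /d (a_notin aS US) (jumpE s0 sU (fsubset_refl _) US cU).
have nU := folding_triangle fphi US cU.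
rewrite /chi (negbTE ns) (negbTE nU).
by case: (sheet phi s); case: (sheet phi U); case: (f _); case: (f _).
Qed.

End GlobalColoring.

(** * Shelling discs *)

Section Discs.
Implicit Types (D E : simplex_family) (e s t T : {fset nat}) (x y z u v w : nat).

Definition closure_of D : simplex_family := \bigcup_(T <- D) fpowerset T.

Lemma in_closureP D t : reflect (exists2 T, T \in D & t `<=` T) (t \in closure_of D).
Proof.
apply: (iffP (bigfcupP _ _ _ _)) => [[T /andP[TD _]]|[T TD tT]].
  by rewrite fpowersetE; exists T.
by exists T; rewrite ?TD ?fpowersetE.
Qed.

Definition deg D e := #|` [fset T in D | e `<=` T]|.

Lemma in_cofaces D e T : (T \in [fset T in D | e `<=` T]) = (T \in D) && (e `<=` T).
Proof. by rewrite !inE. Qed.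

Lemma deg_gt0P D e : reflect (exists2 T, T \in D & e `<=` T) (0 < deg D e).
Proof.
rewrite cardfs_gt0; apply: (iffP (fset0Pn _)) => [[T]|[T TD eT]].
  by rewrite in_cofaces => /andP[TD eT]; exists T.
by exists T; rewrite in_cofaces TD.
Qed.

Lemma deg_add D T e : T \notin D -> deg (T |` D) e = ((e `<=` T) + deg D e)%N.
Proof.
move=> TD; rewrite /deg; case eT: (e `<=` T).
  rewrite (_ : [fset _ in _ | _] = T |` [fset U in D | e `<=` U]).
    by rewrite cardfsU1 in_cofaces (negbTE TD).
  by apply/fsetP=> U; rewrite !inE; case: (eqVneq U T) => // ->; rewrite eT.
rewrite add0n; congr #|` _|%N.
by apply/fsetP=> U; rewrite !inE; case: (eqVneq U T) => //= ->; rewrite eT andbF.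
Qed.

Lemma deg_rem D T e : T \in D -> deg D e = ((e `<=` T) + deg (D `\ T) e)%N.
Proof. by move=> TD; rewrite -deg_add ?fsetD1K // !inE eqxx. Qed.

Lemma deg_sub D D' e : D `<=` D' -> deg D e <= deg D' e.
Proof.
move=> DD'; apply: fsubset_leq_card; apply/fsubsetP=> T.
by rewrite !in_cofaces => /andP[/(fsubsetP DD') -> ->].
Qed.

Lemma deg1_unique D e T T' : deg D e = 1 -> T \in D -> T' \in D ->
  e `<=` T -> e `<=` T' -> T' = T.
Proof.
move=> d1 TD T'D eT eT'; apply/eqP/negPn/negP => TT'.
move: d1; rewrite (deg_rem _ TD) eT => -[] /eqP; apply/negP; rewrite -lt0n.
by apply/deg_gt0P; exists T'; rewrite // !inE TT'.
Qed.

Lemma deg2_other D e T : deg D e = 2 -> T \in D -> e `<=` T ->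
  exists T', [/\ T' \in D, T' != T, e `<=` T' &
    forall U, U \in D -> e `<=` U -> U = T \/ U = T'].
Proof.
move=> d2 TD eT; have d1 : deg (D `\ T) e = 1 by move: d2; rewrite (deg_rem _ TD) eT => -[].
have /deg_gt0P[T' + eT'] : 0 < deg (D `\ T) e by rewrite d1.
rewrite !inE => /andP[T'T T'D]; exists T'; split=> // U UD eU.
case: (eqVneq U T) => [->|UT]; [by left|right].
by apply: (deg1_unique d1) => //; rewrite !inE ?T'T ?UT.
Qed.

(** A compact surface with connected stars, nonempty boundary and no first cohomology is a disc.
    Only what is needed for removing triangles one at a time is recorded. *)
Record disc D : Prop := Disc {
  disc_card : forall T, T \in D -> #|` T| = 3;
  disc_deg : forall e, #|` e| = 2 -> deg D e <= 2;
  disc_star : forall v (c : {fset nat} -> bool),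
    (forall T T' e, T \in D -> T' \in D -> e `<=` T -> e `<=` T' -> #|` e| = 2 ->
      v \in e -> c T = c T') ->
    forall T T', T \in D -> T' \in D -> v \in T -> v \in T' -> c T = c T';
  disc_strong : forall c : {fset nat} -> bool,
    (forall T T' e, T \in D -> T' \in D -> e `<=` T -> e `<=` T' -> #|` e| = 2 ->
      c T = c T') ->
    forall T T', T \in D -> T' \in D -> c T = c T';
  disc_H1 : H1 (closure_of D);
  disc_boundary : exists2 e, #|` e| = 2 & deg D e = 1
}.

Lemma closure_complex D : D != fset0 -> is_complex (closure_of D).
Proof.
move=> /fset0Pn[T TD]; split; first by apply/in_closureP; exists T; rewrite ?fsub0set.
move=> s /in_closureP[U UD sU] t ts; apply/in_closureP; exists U => //.
exact: fsubset_trans sU.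
Qed.

Lemma disc_neq0 D : disc D -> D != fset0.
Proof.
case=> _ _ _ _ _ [e _ d1]; have /deg_gt0P[T TD _] : 0 < deg D e by rewrite d1.
by apply/fset0Pn; exists T.
Qed.

Section VertexCounts.
Variables (D : simplex_family) (v : nat).
Hypothesis D3 : forall T, T \in D -> #|` T| = 3.

Definition star_triangles := [fset T in D | v \in T].
Definition star_edges := [fset e in closure_of D | (#|` e| == 2) && (v \in e)].

Lemma in_star_triangles T : (T \in star_triangles) = (T \in D) && (v \in T).
Proof. by rewrite !inE. Qed.

Lemma in_star_edges e : (e \in star_edges) = [&& e \in closure_of D, #|` e| == 2 & v \in e].
Proof. by rewrite /star_edges; set C := closure_of D; rewrite !inE. Qed.

Lemma in_star_edges_deg e : (e \in star_edges) = [&& 0 < deg D e, #|` e| == 2 & v \in e].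
Proof. by rewrite in_star_edges; congr (_ && _); apply/in_closureP/deg_gt0P. Qed.

Lemma triangle_star_edges T : T \in D -> v \in T ->
  exists x y, [/\ x != y, x != v, y != v, T = [fset v; x; y] &
    [fset e in star_edges | e `<=` T] = [fset [fset v; x]; [fset v; y]]].
Proof.
move=> TD vT; have cT := D3 TD.
have : #|` T `\ v| = 2 by move: cT; rewrite (cardfsD1 v) vT add1n => -[].
case/cardfs2E=> x [y [xy TE]]; exists x, y.
have : x \in T `\ v by rewrite TE !inE eqxx.
have : y \in T `\ v by rewrite TE !inE eqxx orbT.
rewrite !inE => /andP[yv yT] /andP[xv xT]; split=> //; first by rewrite -fsetUA -TE fsetD1K.
apply/fsetP=> s; rewrite [LHS](_ : _ = (s \in star_edges) && (s `<=` T)); last first.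
  by set B := star_edges; rewrite !inE.
rewrite in_star_edges in_fset2; apply/idP/idP.
  case/andP=> /and3P[sS' /eqP cs vs] sT.
  have /cardfs1P[z zE] : #|` s `\ v| == 1%N by move: cs; rewrite (cardfsD1 v) vs add1n => -[->].
  have : z \in T `\ v by apply: (fsubsetP (fsetSD _ sT)); rewrite zE inE.
  by rewrite TE !inE -(fsetD1K vs) zE => /orP[]/eqP->; rewrite eqxx ?orbT.
have pr z : z != v -> z \in T -> [&& [fset v; z] \in closure_of D, #|` [fset v; z]| == 2 & v
    \in [fset v; z]] && ([fset v; z] `<=` T).
  move=> zv zT; have sT : [fset v; z] `<=` T by rewrite fsubUset !fsub1set vT.
  rewrite sT cardfs2 (eq_sym v z) zv !inE eqxx andbT; apply/andP; split=> //.
  by apply/in_closureP; exists T.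
by case/orP=> /eqP->; [exact: (pr x)|exact: (pr y)].
Qed.

Lemma star_count (A : simplex_family) : A `<=` star_triangles ->
  \sum_(e <- star_edges) deg A e = (#|` A| * 2)%N.
Proof.
move=> Astar; rewrite -(@sum_const _ A (fun T => #|` [fset e in star_edges | e `<=` T]|) 2).
  by rewrite double_count.
move=> T /(fsubsetP Astar); rewrite in_star_triangles => /andP[TD vT].
have [x [y [xy xv yv TE ->]]] := triangle_star_edges TD vT.
rewrite cardfs2; case: eqP => // /fsetP/(_ x); rewrite !inE eqxx orbT (negbTE xv) /=.
by rewrite (negbTE xy).
Qed.

Lemma star_deg e : v \in e -> deg star_triangles e = deg D e.
Proof.
move=> ve; congr #|` _|%N; apply/fsetP=> T; rewrite !in_cofaces in_star_triangles.
by case: (T \in D) => //=; case eT: (e `<=` T); rewrite ?andbF // (fsubsetP eT).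
Qed.

Definition inner_edges := [fset e in star_edges | deg D e != 1].
Definition outer_edges := [fset e in star_edges | deg D e == 1].

Lemma in_inner_edges e : (e \in inner_edges) = (e \in star_edges) && (deg D e != 1).
Proof. by rewrite /inner_edges; set B := star_edges; rewrite !inE. Qed.

Lemma in_outer_edges e : (e \in outer_edges) = (e \in star_edges) && (deg D e == 1).
Proof. by rewrite /outer_edges; set B := star_edges; rewrite !inE. Qed.

Hypothesis D2 : forall e, #|` e| = 2 -> deg D e <= 2.

(** Each triangle at [v] contributes two edges at [v]; an edge is counted once on the boundary and
    twice elsewhere. *)
Lemma inner_outer_count :
  (#|` inner_edges| * 2 + #|` outer_edges|)%N = (#|` star_triangles| * 2)%N.
Proof.
rewrite -(star_count (fsubset_refl _)).
have E e : e \in star_edges -> deg star_triangles e = ((deg D e != 1) * 2 + (deg D e == 1))%N.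
  rewrite in_star_edges_deg => /and3P[d0 /eqP ce ve]; rewrite star_deg //.
  by have := D2 ce; case: (deg D e) d0 => [|[|[|]]].
rewrite big_seq (eq_bigr _ E) -big_seq big_split /= -big_distrl /=.
have cnt (p : pred {fset nat}) : #|` [fset e in star_edges | p e]| = \sum_(e <- star_edges) p e.
  rewrite card_fset_sum1 (perm_big [seq e <- star_edges | p e]) /=.
    by rewrite big_filter big_mkcond; apply: eq_bigr => e _; case: (p e).
  apply: uniq_perm; rewrite ?filter_uniq ?fset_uniq // => e.
  by rewrite mem_filter andbC; set B := star_edges; rewrite !inE.
by rewrite -!cnt.
Qed.

End VertexCounts.
End Discs.

(** * Removing a boundary triangle from a disc *)

Section Removal.
Implicit Types (D E : simplex_family) (e s t T : {fset nat}) (x y z u v w : nat).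

Lemma triangle_edge x y z e : #|` e| = 2 -> e `<=` [fset x; y; z] ->
  [\/ e = [fset x; y], e = [fset x; z] | e = [fset y; z]].
Proof.
case/cardfs2E=> p [q [pq ->]]; rewrite fsubUset !fsub1set !inE -!orbA.
move=> /andP[/or3P[] /eqP pE /or3P[] /eqP qE]; subst p q; rewrite ?eqxx // in pq *.
all: solve [apply: Or31; fset_tac|apply: Or32; fset_tac|apply: Or33; fset_tac].
Qed.

Lemma triangle_edges x y z : [/\ [fset x; y] `<=` [fset x; y; z],
  [fset x; z] `<=` [fset x; y; z] & [fset y; z] `<=` [fset x; y; z]].
Proof. by split; fset_tac. Qed.

Lemma deg_remove D T e : T \in D -> e `<=` T -> deg (D `\ T) e = (deg D e).-1.
Proof. by move=> TD eT; rewrite (deg_rem _ TD) eT. Qed.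

Lemma deg1_remove D T T' e : T \in D -> e `<=` T -> deg D e = 1 -> T' \in D `\ T ->
  e `<=` T' -> False.
Proof.
move=> TD eT d1 T'D eT'; have := deg_remove TD eT; rewrite d1 => d0.
suff: 0 < deg (D `\ T) e by rewrite d0.
by apply/deg_gt0P; exists T'.
Qed.

Lemma cardfs3_neq (i j k : nat) : i != j -> j != k -> i != k -> #|` [fset i; j; k]| = 3.
Proof.
move=> ij jk ik; rewrite fsetUC cardfsU1 !inE !(eq_sym k) (negbTE jk) (negbTE ik).
by rewrite cardfs2 ij.
Qed.

Lemma cocycle_intro (K : simplex_family) (h : nat -> nat -> bool) : is_complex K ->
  (forall u v, [fset u; v] \in K -> h u v = h v u) -> (forall u, h u u = false) ->
  (forall i j k, i != j -> j != k -> i != k -> [fset i; j; k] \in K ->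
    h i j (+) h j k = h i k) -> cocycle K h.
Proof.
move=> cK hC h0 hd i j k tK.
have [<-|ij] := eqVneq i j; first by rewrite h0.
have [<-|jk] := eqVneq j k; first by rewrite h0 addbF.
have [ik|ik] := eqVneq i k; last exact: hd.
rewrite -ik h0 -(hC i j) ?addbb //; apply: complexS cK _ tK; fset_tac.
Qed.

Section Triangle.
Variables (D : simplex_family) (x y z : nat).
Let T0 := [fset x; y; z].
Hypotheses (dD : disc D) (T0D : T0 \in D) (xy : x != y) (xz : x != z) (yz : y != z)
  (dxy : deg D [fset x; y] = 1) (dxz : deg D [fset x; z] = 2).

Let xyT : [fset x; y] `<=` T0. Proof. by case: (triangle_edges x y z). Qed.
Let xzT : [fset x; z] `<=` T0. Proof. by case: (triangle_edges x y z). Qed.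
Let D'D T : T \in D `\ T0 -> T \in D. Proof. by rewrite !inE => /andP[]. Qed.

(** A colouring of the remaining triangles extends over the removed one as soon as the neighbours of
    the latter agree. Connectedness of the rest thus comes down to a statement about these
    neighbours. *)
Lemma disc_remove :
  (forall v (c : {fset nat} -> bool),
    (forall T T' e, T \in D `\ T0 -> T' \in D `\ T0 -> e `<=` T -> e `<=` T' ->
      #|` e| = 2 -> v \in e -> c T = c T') ->
    exists k, forall e T, e `<=` T0 -> #|` e| = 2 -> v \in e -> T \in D `\ T0 ->
      e `<=` T -> c T = k) ->
  H1 (closure_of (D `\ T0)) -> disc (D `\ T0).
Proof.
move=> HS HG.
have ext (P : {fset nat} -> Prop) (c : {fset nat} -> bool) k :
    (forall T T' e, T \in D `\ T0 -> T' \in D `\ T0 -> e `<=` T -> e `<=` T' ->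
      #|` e| = 2 -> P e -> c T = c T') ->
    (forall e T, e `<=` T0 -> #|` e| = 2 -> P e -> T \in D `\ T0 -> e `<=` T -> c T = k) ->
    forall T T' e, T \in D -> T' \in D -> e `<=` T -> e `<=` T' -> #|` e| = 2 -> P e ->
      (if T == T0 then k else c T) = (if T' == T0 then k else c T').
  move=> h1 h2 T T' e TD T'D eT eT' ce Pe.
  case: (eqVneq T T0) => [TE|nT]; case: (eqVneq T' T0) => [TE'|nT'] //.
  - by apply/esym/(h2 e); rewrite ?in_fsetD1 ?nT' -?TE.
  - by apply: (h2 e); rewrite ?in_fsetD1 ?nT -?TE'.
  - by apply: (h1 _ _ e); rewrite // in_fsetD1 ?nT ?nT'.
split=> //.
- by move=> T /D'D; exact: disc_card.
- by move=> e ce; apply: leq_trans (disc_deg dD ce); apply: deg_sub; exact: fsubD1set.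
- move=> v c hc T T' TD T'D vT vT'; have [k hk] := HS v c hc.
  have := disc_star dD (ext (fun e => v \in e) c k hc hk) (D'D TD) (D'D T'D) vT vT'.
  by move: TD T'D; rewrite !inE => /andP[/negbTE-> _] /andP[/negbTE-> _].
- move=> c hc T T' TD T'D.
  (* As [xy] is a boundary edge, the removed triangle has neighbours only across edges at [z], and
     the star condition at [z] covers them. *)
  have hz U U' e : U \in D `\ T0 -> U' \in D `\ T0 -> e `<=` U -> e `<=` U' ->
    #|` e| = 2 -> z \in e -> c U = c U' by move=> ? ? ? ? ? _; exact: (hc _ _ e).
  have [k hk] := HS z c hz.
  have := @ext (fun=> True) c k _ _ T T'.
  have h U U' e : U \in D `\ T0 -> U' \in D `\ T0 -> e `<=` U -> e `<=` U' ->
    #|` e| = 2 -> True -> c U = c U' by move=> ? ? ? ? ? _; exact: (hc _ _ e).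
  have h' e U : e `<=` T0 -> #|` e| = 2 -> True -> U \in D `\ T0 -> e `<=` U -> c U = k.
    move=> eT ce _ UD eU; case: (triangle_edge ce eT) => eE; last 2 first.
    - by apply: (hk e) => //; rewrite eE !inE eqxx orbT.
    - by apply: (hk e) => //; rewrite eE !inE eqxx orbT.
    by rewrite eE in eU; case: (deg1_remove T0D xyT dxy UD eU).
  have E := fun U U' e a b i j l => ext (fun=> True) c k h h' U U' e a b i j l I.
  have := disc_strong dD E (D'D TD) (D'D T'D).
  by move: TD T'D; rewrite !inE => /andP[/negbTE-> _] /andP[/negbTE-> _].
by exists [fset x; z]; rewrite ?cardfs2 ?xz // deg_remove // dxz.
Qed.

Lemma across : exists T1, [/\ T1 \in D `\ T0, [fset x; z] `<=` T1 &
  forall T, T \in D `\ T0 -> [fset x; z] `<=` T -> T = T1].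
Proof.
have [T1 [T1D T1T0 sT1 u]] := deg2_other dxz T0D xzT; exists T1.
split=> // [|T]; first by rewrite !inE T1T0.
by rewrite !inE => /andP[nT TD] sT; case: (u T TD sT) => // E; rewrite E eqxx in nT.
Qed.

Lemma remove_free : (forall T, T \in D `\ T0 -> y \notin T) -> disc (D `\ T0).
Proof.
move=> yD; have [T1 [T1D xzT1 uT1]] := across.
apply: disc_remove => [v c _|g gD].
  exists (c T1) => e T eT0 ce _ TD eT; have [nx|] := boolP (y \in e).
    by have := yD T TD; rewrite (fsubsetP eT).
  case: (triangle_edge ce eT0) => eE; rewrite eE !inE ?eqxx ?orbT // => _.
  by rewrite (uT1 T) // -eE.
(* Collapsing [y] to [x] retracts the disc onto the rest: the removed triangle goes to its edge
   [xz], and no other triangle contains [y]. *)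
pose r v := if v == y then x else v.
have rD t : t \in closure_of D -> r @` t \in closure_of (D `\ T0).
  case/in_closureP=> T TD tT; have [TE|nT] := eqVneq T T0.
    apply/in_closureP; exists T1 => //; apply: fsubset_trans xzT1.
    apply/fsubsetP=> _ /imfsetP[i /= /(fsubsetP tT) + ->].
    by rewrite TE !inE /r -orbA => /or3P[] /eqP->; rewrite ?eqxx ?(negbTE xy) ?(eq_sym z y)
        ?(negbTE yz) ?eqxx ?orbT.
  have TD' : T \in D `\ T0 by rewrite !inE nT.
  apply/in_closureP; exists T => //; apply/fsubsetP=> _ /imfsetP[i /= /(fsubsetP tT) iT ->].
  by rewrite /r; case: eqP => // iy; have := yD T TD'; rewrite -iy iT.
have gr : cocycle (closure_of D) (fun u v => g (r u) (r v)).
  by move=> i j k /rD; rewrite image_fset3; exact: gD.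
have [f fE] := disc_H1 dD gr; exists f => i j ij.
have /in_closureP[T TD sT] := ij.
have ni w : w \in [fset i; j] -> r w = w.
  by move/(fsubsetP sT); rewrite /r; case: eqP => // ->; rewrite (negbTE (yD T TD)).
rewrite -fE ?ni ?inE ?eqxx ?orbT //; apply/in_closureP; exists T => //; exact: D'D.
Qed.

End Triangle.

(* The star of [z] stays connected: a colour class of the triangles at [z]
   different from the removed one has an even number of edge incidences, so it
   contains both or none of the neighbours of the removed triangle. *)
Lemma remove_closed D x y z : disc D -> [fset x; y; z] \in D ->
  x != y -> x != z -> y != z -> deg D [fset x; y] = 1 -> deg D [fset x; z] = 2 ->
  deg D [fset y; z] = 2 -> (forall e, #|` e| = 2 -> z \in e -> deg D e != 1) ->
  disc (D `\ [fset x; y; z]).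
Proof.
move=> dD T0D xy xz yz dxy dxz dyz zint; set T0 := [fset x; y; z] in T0D *.
have [xyT xzT yzT] := triangle_edges x y z.
have D'D T : T \in D `\ T0 -> T \in D by rewrite !inE => /andP[].
have [T1 [T1D xzT1 uT1]] := across T0D dxz.
have T0E : [fset y; x; z] = T0 by rewrite /T0; fset_tac.
have [|T2] := @across D y x z _ dyz; first by rewrite T0E.
rewrite T0E => -[T2D yzT2 uT2].
have xy0 T : T \in D `\ T0 -> [fset x; y] `<=` T -> False by exact: deg1_remove dxy.
have same12 (c : {fset nat} -> bool) :
    (forall T T' e, T \in D `\ T0 -> T' \in D `\ T0 -> e `<=` T -> e `<=` T' ->
      #|` e| = 2 -> z \in e -> c T = c T') -> c T1 = c T2.
  move=> hc; apply/eqP/negPn/negP => c12.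
  pose A := [fset T in D `\ T0 | (z \in T) && (c T == c T1)].
  have inA T : (T \in A) = [&& T \in D `\ T0, z \in T & c T == c T1].
    by rewrite /A; set B := D `\ T0; rewrite !inE.
  have AS : A `<=` star_triangles D z.
    by apply/fsubsetP=> T; rewrite inA in_star_triangles => /and3P[/D'D-> ->].
  have := star_count (disc_card dD) AS.
  have xzS : [fset x; z] \in star_edges D z.
    by rewrite in_star_edges_deg dxz cardfs2 xz !inE eqxx orbT.
  rewrite (big_fsetD1 _ xzS) /= => sumE.
  have d1 : deg A [fset x; z] = 1%N.
    rewrite /deg (_ : [fset _ in A | _] = [fset T1]) ?cardfs1 //; apply/fsetP=> T; rewrite
        in_cofaces inA inE; apply/idP/eqP.
      by case/andP=> /and3P[TD _ _] sT; exact: uT1.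
    by move=> ->; rewrite T1D xzT1 eqxx (fsubsetP xzT1) // !inE eqxx orbT.
  have even e : e \in star_edges D z `\ [fset x; z] -> ~~ odd (deg A e).
    rewrite in_fsetD1 in_star_edges_deg => /and4P[exz de /eqP ce ze].
    have [->//|] := posnP (deg A e); case/deg_gt0P=> T TA eT.
    have := TA; rewrite inA => /and3P[TD zT cT].
    have e2 : deg D e = 2.
      by have := zint e ce ze; have := disc_deg dD ce; case: (deg D e) de => [|[|[|]]].
    have eT0 : ~~ (e `<=` T0).
      apply/negP => eT0; case: (triangle_edge ce eT0) => eE.
      - by rewrite eE in eT; exact: xy0 TD eT.
      - by rewrite eE eqxx in exz.
      by move: c12; rewrite eE in eT; rewrite -(uT2 _ TD eT) eq_sym cT.
    suff E : deg A e = deg D e by rewrite E e2.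
    rewrite /deg; congr (#|` _|); apply/fsetP=> U.
    rewrite !in_cofaces inA; case eU: (e `<=` U); rewrite ?andbF // !andbT.
    rewrite (fsubsetP eU) //= in_fsetD1; case UD: (U \in D); rewrite ?andbF //= andbT.
    have nU : U != T0 by apply: contraNneq eT0 => <-.
    rewrite nU /= (hc U T e) //; by rewrite in_fsetD1 nU.
  (* If [T2] is not in the class of [T1], then [xz] is the only edge with an odd number of triangles
     of the class; but the total is twice the number of these triangles. *)
  have : odd (#|` A| * 2) by rewrite -sumE d1 oddD /= big_seq; elim/big_rec: _ => // e n eS;
      rewrite oddD (negbTE (even e eS)).
  by rewrite oddM andbF.
apply: disc_remove => // [v c hc|g gD].
  case: (eqVneq v z) => [vz|vz].
    subst v; exists (c T1) => e T eT0 ce ze TD eT; case: (triangle_edge ce eT0) => eE; rewrite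
        eE in eT.
    - by case: (xy0 T TD eT).
    - by rewrite (uT1 T).
    by rewrite (same12 c hc) (uT2 T).
  case: (eqVneq v y) => [vy|vy].
    subst v; exists (c T2) => e T eT0 ce ye TD eT; case: (triangle_edge ce eT0) => eE; rewrite
        eE in eT ye.
    - by case: (xy0 T TD eT).
    - by move: ye; rewrite !inE eq_sym (negbTE xy) (negbTE yz).
    by rewrite (uT2 T).
  exists (c T1) => e T eT0 ce ve TD eT; case: (triangle_edge ce eT0) => eE; rewrite eE in eT ve.
  - by case: (xy0 T TD eT).
  - by rewrite (uT1 T).
  by move: ve; rewrite !inE (negbTE vz) (negbTE vy).
have D'0 : D `\ T0 != fset0 by apply/fset0Pn; exists T1.
have cD' := closure_complex D'0.
(* The cocycle is carried over to the missing edge [xy] by its sum along [xz] and [zy], the only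
   value for which the removed triangle satisfies the cocycle condition. *)
pose h u v := if u == v then false else
  if [fset u; v] == [fset x; y] then g x z (+) g z y else g u v.
have xzK : [fset x; z] \in closure_of (D `\ T0) by apply/in_closureP; exists T1.
have zyK : [fset z; y] \in closure_of (D `\ T0).
  by apply/in_closureP; exists T2 => //; rewrite (_ : [fset z; y] = [fset y; z]) //; fset_tac.
have cD := closure_complex (disc_neq0 dD).
have old t : t \in closure_of D -> ~~ ([fset x; y] `<=` t) -> #|` t| = 2 \/ #|` t| = 3 ->
    t \in closure_of (D `\ T0).
  case/in_closureP=> T TD tT xyt ct; have [TE|nT] := eqVneq T T0; last first.
    by apply/in_closureP; exists T => //; rewrite in_fsetD1 nT.
  rewrite TE in tT; case: ct => ct.
    case: (triangle_edge ct tT) xyt => ->; rewrite ?fsubset_refl // => _.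
    by rewrite (_ : [fset y; z] = [fset z; y]) //; fset_tac.
  have tE : t = T0 by apply/eqP; rewrite eqEfcard tT ct card_fset3_le.
  by rewrite tE xyT in xyt.
have hg u v : u != v -> [fset u; v] != [fset x; y] -> h u v = g u v.
  by rewrite /h => /negbTE-> /negbTE->.
have hxy : h x y = g x z (+) g z y by rewrite /h (negbTE xy) eqxx.
have hC u v : [fset u; v] \in closure_of D -> h u v = h v u.
  move=> uvK; rewrite /h (eq_sym v) (fsetUC [fset v]).
  case: eqVneq => // uv; case: eqVneq => // nuv.
  apply: cocycle_sym gD cD' _; apply: old => //; last by left; rewrite cardfs2 uv.
  apply: contra nuv => s; rewrite eq_sym eqEfcard s (cardfs2 x) xy; exact: card_fset2_le.
have hD : cocycle (closure_of D) h.
  apply: cocycle_intro => // [u|i j k ij jk ik tK]; first by rewrite /h eqxx.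
  have c3 : #|` [fset i; j; k]| = 3 by rewrite cardfs3_neq.
  have [st|nst] := boolP ([fset x; y] `<=` [fset i; j; k]).
    have tE : [fset i; j; k] = T0.
      have [T TD tT] := in_closureP _ _ tK.
      have TE := deg1_unique dxy T0D TD xyT (fsubset_trans st tT).
      by apply/eqP; rewrite eqEfcard -TE tT c3 (disc_card dD TD).
    have sub3 p q : p \in T0 -> q \in T0 -> h p q = h q p.
      move=> pT qT; apply: hC; apply/in_closureP; exists T0 => //.
      by rewrite fsubUset !fsub1set pT.
    have [xT yT zT] : [/\ x \in T0, y \in T0 & z \in T0] by rewrite /T0 !inE !eqxx !orbT.
    have hxz : h x z = g x z.
      by apply: hg => //; apply/eqP => /fsetP/(_ z); rewrite !inE eqxx orbT !(eq_sym z) (negbTE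
          xz) (negbTE yz).
    have hzy : h z y = g z y.
      by apply: hg; rewrite 1?eq_sym //; apply/eqP => /fsetP/(_ z); rewrite !inE eqxx !(eq_sym
          z) (negbTE xz) (negbTE yz).
    have [iT jT kT] : [/\ i \in T0, j \in T0 & k \in T0] by rewrite -tE !inE !eqxx !orbT.
    have key : h x y = h x z (+) h z y by rewrite hxy hxz hzy.
    move: iT jT kT ij jk ik; rewrite /T0 !inE -!orbA.
    case/or3P=> /eqP-> /or3P[] /eqP-> /or3P[] /eqP->; rewrite ?eqxx // => _ _ _;
      rewrite ?(sub3 y x) ?(sub3 z x) ?(sub3 y z) // ?key; try by case: (h x z); case: (h z y).
  have nsub p q : p \in [fset i; j; k] -> q \in [fset i; j; k] -> [fset p; q] != [fset x; y].
    move=> pt qt; apply: contraNneq nst => <-; by rewrite fsubUset !fsub1set pt.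
  rewrite !hg ?nsub ?inE ?eqxx ?orbT //; apply: gD; apply: old => //; by right.
have [f fE] := disc_H1 dD hD; exists f => u v uvK.
have uvD : [fset u; v] \in closure_of D.
  by case/in_closureP: uvK => T TD tT; apply/in_closureP; exists T => //; exact: D'D.
rewrite -fE // /h; case: eqVneq => [uv|uv].
  by subst v; rewrite (cocycle_refl gD) // -(fsetUid [fset u]).
by case: eqVneq => // uvE; case/in_closureP: uvK => T TD; rewrite uvE => /(xy0 T TD).
Qed.

End Removal.

(** * Existence of a removable triangle *)

Section Shelling.
Implicit Types (D E : simplex_family) (e s t T : {fset nat}) (x y z u v w : nat).

Lemma triangle_of_edge D T x y : T \in D -> #|` T| = 3 -> x != y -> [fset x; y] `<=` T ->
  exists z, [/\ x != z, y != z & T = [fset x; y; z]].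
Proof.
move=> TD cT xy xyT; have : #|` T `\` [fset x; y]| = 1.
  by rewrite cardfsD (fsetIidPr xyT) cT cardfs2 xy.
move/eqP/cardfs1P => [z zE].
have : z \in T `\` [fset x; y] by rewrite zE inE.
rewrite !inE negb_or => /andP[/andP[zx zy] zT]; exists z; split; rewrite 1?eq_sym //.
by rewrite -zE fsetUDl fsetDv fsetD0; apply/esym/fsetUidPr.
Qed.

(** By [inner_outer_count] the number of boundary edges at [v] is even. *)
Lemma boundary_even D v e : disc D -> e \in outer_edges D v -> 1 < #|` outer_edges D v|.
Proof.
move=> dD eo; have := inner_outer_count v (disc_card dD) (disc_deg dD).
have : 0 < #|` outer_edges D v| by rewrite cardfs_gt0; apply/fset0Pn; exists e.
move: #|` _| #|` inner_edges _ _| #|` star_triangles _ _|; lia.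
Qed.

Lemma in_outer D v e : (e \in outer_edges D v) = [&& v \in e, #|` e| == 2 & deg D e == 1].
Proof.
rewrite in_outer_edges in_star_edges_deg; case: (deg D e) => [|n]; rewrite ?andbF //=.
by case: (v \in e); case: (#|` e| == 2).
Qed.

(* As [z] is on the boundary, counting edges shows that the star of [z] becomes
   disconnected once the triangle is removed.  Marking the edges from [z] to
   one of its parts and the edge [xy] gives a cocycle; [h] is its potential. *)
Lemma chord_split D x y z : disc D -> [fset x; y; z] \in D ->
  x != y -> x != z -> y != z -> deg D [fset x; y] = 1 -> deg D [fset x; z] = 2 ->
  deg D [fset y; z] = 2 -> (exists e, [/\ #|` e| = 2, z \in e & deg D e = 1]) ->
  exists h : nat -> bool, h x != h y /\
    forall T, T \in D `\ [fset x; y; z] -> {in T &, forall u v, u != z -> v != z -> h u = h v}.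
Proof.
move=> dD T0D xy xz yz dxy dxz dyz [e0 [ce0 ze0 de0]]; set T0 := [fset x; y; z] in T0D *.
have [xyT xzT yzT] := triangle_edges x y z.
have D'D T : T \in D `\ T0 -> T \in D by rewrite !inE => /andP[].
have [T1 [T1D xzT1 uT1]] := across T0D dxz.
have T0E : [fset y; x; z] = T0 by rewrite /T0; fset_tac.
have [|T2] := @across D y x z _ dyz; first by rewrite T0E.
rewrite T0E => -[T2D yzT2 uT2].
have xy0 T : T \in D `\ T0 -> [fset x; y] `<=` T -> False by exact: deg1_remove dxy.
have zT0 : z \in T0 by rewrite /T0 !inE eqxx orbT.
pose V := star_triangles D z `\ T0.
pose N := inner_edges D z `\ [fset x; z] `\ [fset y; z].
have xzi : [fset x; z] \in inner_edges D z.
  by rewrite in_inner_edges in_star_edges_deg dxz cardfs2 xz !inE eqxx orbT.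
have yzi : [fset y; z] \in inner_edges D z `\ [fset x; z].
  rewrite in_fsetD1 in_inner_edges in_star_edges_deg dyz cardfs2 yz !inE eqxx orbT !andbT.
  by apply/eqP => /fsetP/(_ y); rewrite !inE eqxx (eq_sym y x) (negbTE xy) (negbTE yz).
(* With a boundary edge at [z] there are more triangles than inner edges. Removing one triangle and
   two inner edges leaves the graph of the punctured star one edge short of being connected. *)
have lt : #|` N|.+1 < #|` V|.
  have := inner_outer_count z (disc_card dD) (disc_deg dD).
  have : 0 < #|` outer_edges D z|.
    by rewrite cardfs_gt0; apply/fset0Pn; exists e0; rewrite in_outer ze0 ce0 de0.
  rewrite (cardfsD1 [fset x; z] (inner_edges _ _)) xzi (cardfsD1 [fset y; z] (_ `\ [fset x;
      z])) yzi.
  rewrite (cardfsD1 T0 (star_triangles _ _)) in_star_triangles T0D zT0 -/V -/N /=.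
  move: #|` outer_edges _ _| #|` N| #|` V|; lia.
have inV T : (T \in V) = (T \in D `\ T0) && (z \in T).
  by rewrite /V in_fsetD1 in_star_triangles in_fsetD1 andbA.
have [c cN [U1 [U2 [U1V U2V c12']]]] : exists2 c : {fset nat} -> bool,
    (forall T T' e, T \in D `\ T0 -> T' \in D `\ T0 -> e `<=` T -> e `<=` T' ->
       #|` e| = 2 -> z \in e -> c T = c T') &
    exists T T', [/\ T \in V, T' \in V & c T <> c T'].
  apply: contrapT => hc; move: lt; rewrite ltnNge => /negP[].
  pose pr e : {fset nat} * {fset nat} := xget (fset0, fset0) (fun p =>
    forall T, T \in D `\ T0 -> e `<=` T -> T = p.1 \/ T = p.2).
  pose E := [seq pr e | e <- enum_fset N].
  have -> : #|` N| = size E by rewrite size_map.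
  apply: connected_card => c cE T T' TV T'V; apply: contrapT => cTT'; apply: hc.
  exists c; last by exists T, T'.
  move=> W W' e WD W'D eW eW' ce ze.
  have [d1|d1] := eqVneq (deg D e) 1.
    by congr c; apply: (deg1_unique d1); rewrite ?D'D.
  have [eE|exz] := eqVneq e [fset x; z].
    by rewrite (uT1 W) -?eE // (uT1 W') -?eE.
  have [eE|eyz] := eqVneq e [fset y; z].
    by rewrite (uT2 W) -?eE // (uT2 W') -?eE.
  have d0 : 0 < deg D e by apply/deg_gt0P; exists W; rewrite ?D'D.
  have d2 : deg D e = 2 by have := disc_deg dD ce; case: (deg D e) d0 d1 => [|[|[|]]].
  have [W'' [W''D W''W eW'' hW]] := deg2_other d2 (D'D W WD) eW.
  have prE : forall T, T \in D `\ T0 -> e `<=` T -> T = (pr e).1 \/ T = (pr e).2.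
    apply: (@xgetPex _ (fset0, fset0) (fun p : {fset nat} * {fset nat} =>
      forall T, T \in D `\ T0 -> e `<=` T -> T = p.1 \/ T = p.2)).
    by exists (W, W'') => U /D'D; exact: hW.
  have cpr : c (pr e).1 = c (pr e).2.
    apply: cE; apply: (map_f pr); rewrite -[_ \in _]/(e \in N) !in_fsetD1 eyz exz.
    by rewrite in_inner_edges in_star_edges_deg d0 ce ze d1.
  by case: (prE W WD eW) => ->; case: (prE W' W'D eW') => ->.
(* If the two neighbours had the same colour, [c] would extend over the removed triangle and be
   constant on the whole star. *)
have c12 : c T1 != c T2.
  apply/negP => /eqP c12; apply: c12'.
  pose c' T := if T == T0 then c T1 else c T.
  have c'E T : T \in D `\ T0 -> c' T = c T by rewrite !inE /c' => /andP[/negbTE->].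
  move: U1V U2V; rewrite !inV => /andP[U1D zU1] /andP[U2D zU2].
  rewrite -(c'E U1) // -(c'E U2) //; apply: (disc_star dD (v := z)) => //; rewrite ?D'D //.
  have h0 T e : T \in D `\ T0 -> e `<=` T -> e `<=` T0 -> #|` e| = 2 -> c T = c T1.
    move=> TD eT eT0 ce; case: (triangle_edge ce eT0) => eE; rewrite eE in eT.
    - by case: (xy0 T).
    - by rewrite (uT1 T).
    by rewrite (uT2 T).
  move=> T T' e TD T'D eT eT' ce ze; rewrite /c'.
  case: (eqVneq T T0) => [TE|nT]; case: (eqVneq T' T0) => [TE'|nT'] //.
  - by apply/esym/(h0 _ e); rewrite ?in_fsetD1 ?nT' -?TE.
  - by apply: (h0 _ e); rewrite ?in_fsetD1 ?nT -?TE'.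
  by apply: (cN _ _ e); rewrite // in_fsetD1 ?nT ?nT'.
pose G s := (s == [fset x; y]) ||
  ((#|` s| == 2) && (z \in s) && has c [seq T <- enum_fset (D `\ T0) | s `<=` T]).
pose g u v := G [fset u; v].
have GE T s : T \in D `\ T0 -> s `<=` T -> #|` s| = 2 -> G s = (z \in s) && c T.
  move=> TD sT cs; rewrite /G cs eqxx /=; case: eqVneq => [sE|_].
    by rewrite sE in sT; case: (xy0 T).
  case zs: (z \in s) => //=; apply/hasP/idP => [[T']|cT].
    by rewrite mem_filter => /andP[sT' T'D]; rewrite (cN T' T s).
  by exists T => //; rewrite mem_filter sT.
have Gxy : G [fset x; y] by rewrite /G eqxx.
have cD := closure_complex (disc_neq0 dD).
have gD : cocycle (closure_of D) g.
  apply: cocycle_intro => // [u v _|u|i j k ij jk ik].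
  - by rewrite /g fsetUC.
  - rewrite /g fsetUid /G cardfs1 /= orbF; apply/negbTE/eqP => /(congr1 (fun A : {fset nat} =>
      #|` A|)).
    by rewrite cardfs1 cardfs2 xy.
  case/in_closureP=> T TD tT; have [TE|nT] := eqVneq T T0; last first.
    have TD' : T \in D `\ T0 by rewrite in_fsetD1 nT.
    have [h1 h2 h3] := triangle_edges i j k.
    rewrite /g !(GE T) ?cardfs2 ?ij ?ik ?jk //; try exact: fsubset_trans tT.
    rewrite !inE; case: (eqVneq z i) ij ik => [<-|zi] ij ik.
      by rewrite (negbTE ij) (negbTE ik) /= addbF.
    case: (eqVneq z j) jk => [<-|zj] jk /=; first by rewrite (negbTE jk) addbb.
    by case: (eqVneq z k).
  have gC p q : g p q = g q p by rewrite /g fsetUC.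
  have gxz : g x z = c T1 by rewrite /g (GE T1) ?cardfs2 ?xz // !inE eqxx orbT.
  have gyz : g y z = c T2 by rewrite /g (GE T2) ?cardfs2 ?yz // !inE eqxx orbT.
  have gxy : g x y by [].
  have key : g x y = g x z (+) g z y.
    by rewrite gxy (gC z y) gxz gyz; move: c12; case: (c T1); case: (c T2).
  have [iT jT kT] : [/\ i \in T0, j \in T0 & k \in T0].
    by split; rewrite -TE; apply: (fsubsetP tT); rewrite !inE eqxx ?orbT.
  move: iT jT kT ij jk ik; rewrite /T0 !inE -!orbA.
  case/or3P=> /eqP-> /or3P[] /eqP-> /or3P[] /eqP->; rewrite ?eqxx // => _ _ _;
    by rewrite ?(gC y x) ?(gC z x) ?(gC y z) // ?key; try by case: (g x z); case: (g z y).
have [f fE] := disc_H1 dD gD; exists f; split.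
  have : g x y = f x (+) f y by apply: fE; apply/in_closureP; exists T0.
  by rewrite /g Gxy; case: (f x); case: (f y).
move=> T TD u v uT vT uz vz; have [->//|uv] := eqVneq u v.
have uvT : [fset u; v] `<=` T by rewrite fsubUset !fsub1set uT.
have : g u v = f u (+) f v by apply: fE; apply/in_closureP; exists T; rewrite ?D'D.
rewrite /g (GE T) ?cardfs2 ?uv // !inE !(eq_sym z) (negbTE uz) (negbTE vz) /=.
by case: (f u); case: (f v).
Qed.

(** The triangle meets the rest either in [xz] alone, [y] being free, or in both edges at an
    interior vertex [z]. If [z] were on the boundary in the second situation, the rest would be
    pinched at [z]. *)
Definition removable D x y z :=
  [/\ [fset x; y; z] \in D, x != y, x != z, y != z &
    [/\ deg D [fset x; y] = 1, deg D [fset x; z] = 2 &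
      (forall T, T \in D `\ [fset x; y; z] -> y \notin T) \/
      deg D [fset y; z] = 2 /\ forall e, #|` e| = 2 -> z \in e -> deg D e != 1]].

Lemma boundary_triangle D x y z : disc D -> [fset x; y; z] \in D ->
  x != y -> x != z -> y != z -> deg D [fset x; y] = 1 ->
  [\/ D = [fset [fset x; y; z]], exists p q r, removable D p q r |
   [/\ deg D [fset x; z] = 2, deg D [fset y; z] = 2 &
     exists e, [/\ #|` e| = 2, z \in e & deg D e = 1]]].
Proof.
move=> dD T0D xy xz yz dxy; set T0 := [fset x; y; z].
have [xyT xzT yzT] := triangle_edges x y z.
have d12 e : e `<=` T0 -> #|` e| = 2 -> deg D e = 1 \/ deg D e = 2.
  move=> eT ce; have : 0 < deg D e by apply/deg_gt0P; exists T0.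
  by have := disc_deg dD ce; case: (deg D e) => [|[|[|]]] //; [left|right].
have free p : p \in T0 -> (forall e, e `<=` T0 -> #|` e| = 2 -> p \in e -> deg D e = 1) ->
    forall T, T \in D `\ T0 -> p \notin T.
  move=> pT0 h T; rewrite in_fsetD1 => /andP[TT0 TD]; apply: contraNN TT0 => pT.
  rewrite (disc_star dD (v := p) (c := fun T => T == T0) _ TD T0D) //.
  move=> U U' e UD U'D eU eU' ce pe; case: (eqVneq U T0) => [UE|nU]; case: (eqVneq U' T0) =>
      [UE'|nU'] //.
    by case/eqP: nU'; apply: (deg1_unique (h e _ ce pe)); rewrite // -?UE.
  by case/eqP: nU; apply: (deg1_unique (h e _ ce pe)); rewrite // -?UE'.
have cxz : #|` [fset x; z]| = 2 by rewrite cardfs2 xz.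
have cyz : #|` [fset y; z]| = 2 by rewrite cardfs2 yz.
have T0E : [fset y; x; z] = T0 by rewrite /T0; fset_tac.
case: (d12 _ xzT cxz) => dxz; case: (d12 _ yzT cyz) => dyz.
- apply: Or31; apply/fsetP=> T; rewrite inE; apply/idP/eqP => [TD|->//].
  apply/eqP; rewrite (disc_strong dD (c := fun T => T == T0) _ TD T0D) //.
  move=> U U' e UD U'D eU eU' ce.
  have d1 : e `<=` T0 -> deg D e = 1 by move=> eT0; case: (triangle_edge ce eT0) => ->.
  case: (eqVneq U T0) => [UE|nU]; case: (eqVneq U' T0) => [UE'|nU'] //.
    by case/eqP: nU'; apply: (deg1_unique (d1 _)); rewrite // -?UE.
  by case/eqP: nU; apply: (deg1_unique (d1 _)); rewrite // -?UE'.
- apply: Or32; exists y, x, z; split; rewrite ?T0E // 1?eq_sym //; split=> //.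
    by rewrite fsetUC.
  left; apply: free; first by rewrite !inE eqxx.
  move=> e eT ce xe; case: (triangle_edge ce eT) => eE; rewrite eE //.
  by move: xe; rewrite eE !inE (negbTE xy) (negbTE xz).
- apply: Or32; exists x, y, z; split=> //; split=> //.
  left; apply: free; first by rewrite !inE eqxx orbT.
  move=> e eT ce ye; case: (triangle_edge ce eT) => eE; rewrite eE //.
  by move: ye; rewrite eE !inE eq_sym (negbTE xy) (negbTE yz).
case: (pselect (exists e, [/\ #|` e| = 2, z \in e & deg D e = 1])) => h; first exact: Or33.
apply: Or32; exists x, y, z; split=> //; split=> //; right; split=> // e ce ze.
by apply/eqP => de; apply: h; exists e.
Qed.

(* The triangle at the other boundary edge at [x], if not removable, is a chord
   triangle with a side strictly inside the side of [x]. *)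
Lemma removable_side D x y z (h : nat -> bool) : disc D -> [fset x; y; z] \in D ->
  x != y -> x != z -> y != z -> deg D [fset x; y] = 1 -> deg D [fset x; z] = 2 ->
  deg D [fset y; z] = 2 -> h x != h y ->
  (forall T, T \in D `\ [fset x; y; z] -> {in T &, forall u v, u != z -> v != z -> h u = h v}) ->
  exists p q r, removable D p q r.
Proof.
(* The side of [x] collects the triangles having a vertex other than [z] with the value of [x]; its
   size is the measure of the induction. *)
move=> dD; pose side x y z (h : nat -> bool) := [fset T in D `\ [fset x; y; z] |
  has (fun v => (v != z) && (h v == h x)) (enum_fset T)].
have sideP (x' y' z' : nat) h' T : (T \in side x' y' z' h') =
    (T \in D `\ [fset x'; y'; z']) && has (fun v => (v != z') && (h' v == h' x')) (enum_fset T).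
  by rewrite /side; set B := D `\ _; rewrite !inE.
move: {2}#|` side x y z h|.+1 (ltnSn #|` side x y z h|) => n.
elim: n x y z h => [//|n IH] x y z h hn T0D xy xz yz dxy dxz dyz hxy hs; set T0 := [fset x; y;
    z] in T0D hs.
have [xyT xzT yzT] := triangle_edges x y z.
have xyo : [fset x; y] \in outer_edges D x by rewrite in_outer dxy cardfs2 xy !inE eqxx.
have : 0 < #|` outer_edges D x `\ [fset x; y]|.
  by have := boundary_even dD xyo; rewrite (cardfsD1 [fset x; y]) xyo.
rewrite cardfs_gt0 => /fset0Pn[e]; rewrite in_fsetD1 in_outer => /and4P[exy xe /eqP ce /eqP de].
have [w xw eE] : exists2 w, x != w & e = [fset w; x].
  have := ce; rewrite (cardfsD1 x) xe add1n => -[/eqP/cardfs1P[w wE]].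
  have : w \in e `\ x by rewrite wE inE.
  rewrite !inE => /andP[wx _]; exists w; first by rewrite eq_sym.
  by rewrite -(fsetD1K xe) wE fsetUC.
have wy : w != y by apply: contraNneq exy => <-; rewrite eE fsetUC.
have /deg_gt0P[T TD eT] : 0 < deg D e by rewrite de.
rewrite eE in de eT.
have wx : w != x by rewrite eq_sym.
have [u [wu xu TE]] := triangle_of_edge TD (disc_card dD TD) wx eT.
rewrite TE in TD eT; have [wxT wuT xuT] := triangle_edges w x u.
case: (boundary_triangle dD TD wx wu xu de) => [DE|//|[dwu dxu bu]].
  have T0T : T0 = [fset w; x; u] by apply/fset1P; rewrite -DE.
  have : deg D [fset x; z] <= 1.
    by apply: leq_trans (fsubset_leq_card (fset_sub _ _)) _; rewrite DE cardfs1.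
  by rewrite dxz.
have [h' [hwx hs']] := chord_split dD TD wx wu xu de dwu dxu bu.
apply: (IH w x u h') => //; rewrite ltnS in hn; apply: leq_trans hn.
set T' := [fset w; x; u] in TD eT hs' wxT wuT xuT.
have T'T0 : T' != T0.
  apply: contraTneq wxT => ->; apply/negP => s; have : #|` [fset w; x]| = 2 by rewrite cardfs2 wx.
  case/triangle_edge/(_ s) => E.
  - by have := fset21 w x; rewrite E !inE (negbTE wx) (negbTE wy).
  - by rewrite E dxz in de.
  by have := fset22 w x; rewrite E !inE (negbTE xy) (negbTE xz).
have T0D' : T0 \in D `\ T' by rewrite in_fsetD1 eq_sym T'T0.
have T'D0 : T' \in D `\ T0 by rewrite in_fsetD1 T'T0.
(* The triangles of the new side that escape the old one form a class closed under adjacency in [D].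
   It does not contain [T0], so strong connectedness leaves it empty. *)
pose c U := (U \in side w x u h') && (U \notin side x y z h) && (U != T0).
have xT0 : x \in T0 by rewrite !inE eqxx.
have nx U : U \in side w x u h' -> x \notin U.
  rewrite sideP => /andP[UD /hasP[v vU /andP[vu /eqP hv]]]; apply/negP => xU.
  by move: hwx; rewrite -hv (hs' U UD v x) ?eqxx // eq_sym.
have same (x' y' z' : nat) (k : nat -> bool) U U' e' : 
    (forall T, T \in D `\ [fset x'; y'; z'] -> {in T &, forall u v, u != z' -> v != z' -> k u =
        k v}) ->
    U \in D `\ [fset x'; y'; z'] -> U' \in D `\ [fset x'; y'; z'] ->
    e' `<=` U -> e' `<=` U' -> #|` e'| = 2 -> U \in side x' y' z' k -> U' \in side x' y' z' k.
  move=> hk UD U'D eU eU' ce'; rewrite !sideP U'D => /andP[_ /hasP[v vU /andP[vz' /eqP kv]]].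
  have : 0 < #|` e' `\ z'|.
    by move: ce'; rewrite (cardfsD1 z'); case: (z' \in e'); case: #|` e' `\ z'|.
  rewrite cardfs_gt0 => /fset0Pn[q]; rewrite in_fsetD1 => /andP[qz qe].
  apply/hasP; exists q; first exact: (fsubsetP eU').
  by rewrite qz -kv (hk U UD q v) ?eqxx //; exact: (fsubsetP eU).
have T's : T' \in side x y z h.
  have xT' : x \in T' by rewrite !inE eqxx orbT.
  by rewrite sideP T'D0; apply/hasP; exists x; rewrite // xz eqxx.
have B_side U : U \in side w x u h' -> U \in side x y z h.
  move=> Us; apply/negPn/negP => nUs.
  have U0 : U != T0 by apply: contraNneq (nx U Us) => ->.
  have UD : U \in D by move: Us; rewrite sideP in_fsetD1 => /andP[/andP[]].
  have : c U by rewrite /c Us nUs.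
  rewrite (disc_strong dD (c := c) _ UD T0D) /c ?eqxx ?andbF //.
  have step V V' e' : V \in D -> V' \in D -> e' `<=` V -> e' `<=` V' -> #|` e'| = 2 -> c V -> c
      V'.
    move=> VD V'D eV eV' ce' /andP[/andP[Vs nVs] V0].
    have VT' : V \in D `\ T' by move: Vs; rewrite sideP => /andP[].
    have VT0 : V \in D `\ T0 by rewrite in_fsetD1 V0.
    have [V'T'|V'T'] := eqVneq V' T'.
      rewrite V'T' in eV'; case/negP: nVs; exact: (same x y z h T' V e').
    have V'DT' : V' \in D `\ T' by rewrite in_fsetD1 V'T'.
    have V's : V' \in side w x u h' by exact: (same w x u h' V V' e').
    have V'0 : V' != T0 by apply: contraNneq (nx _ V's) => ->.
    have V'DT0 : V' \in D `\ T0 by rewrite in_fsetD1 V'0.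
    rewrite /c V's V'0 !andbT /=; apply: contra nVs => V'ss; exact: (same x y z h V' V e').
  by move=> V V' e' VD V'D eV eV' ce'; apply/idP/idP; [exact: (step V V' e')|exact: (step V' V
      e')].
have : side w x u h' `<=` side x y z h `\ T'.
  apply/fsubsetP=> U Us; rewrite in_fsetD1 B_side // andbT.
  by apply: contraTneq Us => ->; rewrite sideP in_fsetD1 eqxx.
by move/fsubset_leq_card; rewrite (cardfsD1 T' (side x y z h)) T's add1n ltnS.
Qed.

Lemma disc_removable D : disc D ->
  (exists2 T : {fset nat}, #|` T| = 3 & D = [fset T]) \/ exists x y z, removable D x y z.
Proof.
move=> dD; have [e ce de] := disc_boundary dD.
have /deg_gt0P[T TD eT] : 0 < deg D e by rewrite de.
have [x [y [xy eE]]] := cardfs2E ce; rewrite eE in de eT.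
have cT := disc_card dD TD.
have [z [xz yz TE]] := triangle_of_edge TD cT xy eT.
rewrite TE in TD; case: (boundary_triangle dD TD xy xz yz de) => [DE|h|[dxz dyz b]].
- by left; exists T; rewrite // DE TE.
- by right.
right; have [h [hxy hs]] := chord_split dD TD xy xz yz de dxz dyz b.
exact: (removable_side dD TD xy xz yz de dxz dyz hxy hs).
Qed.

Inductive shelling : simplex_family -> Prop :=
| Shelling1 (T : {fset nat}) : #|` T| = 3 -> shelling [fset T]
| ShellingFree D x y z : shelling (D `\ [fset x; y; z]) ->
    removable D x y z -> (forall T, T \in D `\ [fset x; y; z] -> y \notin T) -> shelling D
| ShellingClosed D x y z : shelling (D `\ [fset x; y; z]) ->
    removable D x y z -> deg D [fset y; z] = 2 ->
    (forall e, #|` e| = 2 -> z \in e -> deg D e != 1) -> shelling D.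

Lemma disc_shelling D : disc D -> shelling D.
Proof.
move: {2}#|` D|.+1 (ltnSn #|` D|) => n; elim: n D => // n IH D Dn dD.
have [[T cT ->]|[x [y [z rD]]]] := disc_removable dD; first exact: Shelling1.
have [TD xy xz yz [dxy dxz h]] := rD.
have Dn' : #|` D `\ [fset x; y; z]| < n by move: Dn; rewrite (cardfsD1 [fset x; y; z]) TD.
case: (h) => [free|[dyz int]].
  apply: (ShellingFree (IH _ Dn' _) rD free); exact: remove_free.
by apply: (ShellingClosed (IH _ Dn' _) rD dyz int); exact: remove_closed.
Qed.

End Shelling.

(** * Shellings by complementary faces *)

Section Shell.
Implicit Types (C D E d : simplex_family) (e s t T : {fset nat}) (x y z u v w : nat).

(* [shell C d]: the complex [C] with boundary [d] is built by adding triangles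
   [T = R + S] that meet what is already there in the faces not containing [S];
   the faces of [T] left on the boundary are those not containing [R]. *)
Inductive shell : simplex_family -> simplex_family -> Prop :=
| Shell0 : shell fset0 fset0
| ShellS C d C' d' (R S : {fset nat}) :
    shell C d -> R != fset0 -> fdisjoint R S -> #|` R `|` S| = 3 ->
    (forall s, s `<=` R `|` S -> s \in C <-> ~~ (S `<=` s)) ->
    (forall s, s `<=` R `|` S -> ~~ (S `<=` s) -> s \in d) ->
    (forall s, s \in d -> R `<=` s -> s `<=` R `|` S) ->
    (forall s, s \in C' <-> s \in C \/ s `<=` R `|` S) ->
    (forall s, s \in d' <-> (s `<=` R `|` S /\ ~~ (R `<=` s)) \/
                            (s \in d /\ ~~ (s `<=` R `|` S))) ->
    shell C' d'.

Lemma shell_closed C d : shell C d ->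
  (forall s t, s \in C -> t `<=` s -> t \in C) /\
  ((forall s t, s \in d -> t `<=` s -> t \in d) /\ {subset d <= C}).
Proof.
elim=> [|{}C {}d C' d' R S _ [IC [Id dC]] R0 RS _ SC Sd Rd C'E d'E]; first by do !split.
split; [|split].
- move=> s t /C'E[sC|sT] ts; apply/C'E; first by left; exact: IC ts.
  by right; exact: fsubset_trans ts sT.
- move=> s t /d'E[[sT sR]|[sd sT]] ts; apply/d'E.
    left; rewrite (fsubset_trans ts sT); split=> //; apply: contra sR => Rt; exact:
        fsubset_trans ts.
  have [tT|tT] := boolP (t `<=` R `|` S); [left|right]; split=> //; last exact: Id ts.
  by apply: contra sT => Rt; apply: Rd => //; exact: fsubset_trans ts.
move=> s /d'E[[sT _]|[sd _]]; apply/C'E; [by right|left; exact: dC].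
Qed.

Definition boundary_edges D := [fset e in closure_of D | (#|` e| == 2) && (deg D e == 1)].
Definition boundary D := closure_of (boundary_edges D).

Lemma in_boundary_edges D e : (e \in boundary_edges D) = (#|` e| == 2) && (deg D e == 1).
Proof.
rewrite /boundary_edges; set B := closure_of D; rewrite !inE.
case: (#|` e| == 2); rewrite ?andbF //=; case: eqP => // d1; rewrite ?andbF // andbT.
have /deg_gt0P[T TD eT] : 0 < deg D e by rewrite d1.
by apply/in_closureP; exists T.
Qed.

Lemma in_boundaryP D s :
  s \in boundary D <-> exists e, [/\ #|` e| = 2, deg D e = 1 & s `<=` e].
Proof.
split=> [/in_closureP[e]|[e [ce de se]]].
  by rewrite in_boundary_edges => /andP[/eqP ce /eqP de] se; exists e.
by apply/in_closureP; exists e; rewrite // in_boundary_edges ce de.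
Qed.

(** Removing [T] lowers the degree of its edges by one: those of degree two form its contact with
    the rest, those of degree one are its share of the boundary. *)
Lemma shell_step D R S : let T := R `|` S in
  shell (closure_of (D `\ T)) (boundary (D `\ T)) -> T \in D ->
  R != fset0 -> fdisjoint R S -> #|` T| = 3 ->
  (forall s, s `<=` T -> ~~ (S `<=` s) -> exists e, [/\ #|` e| = 2, e `<=` T, s `<=` e & deg D
      e = 2]) ->
  (forall s, s `<=` T -> ~~ (R `<=` s) -> exists e, [/\ #|` e| = 2, e `<=` T, s `<=` e & deg D
      e = 1]) ->
  (forall U, U \in D `\ T -> ~~ (S `<=` U)) ->
  (forall e, #|` e| = 2 -> deg D e = 1 -> ~~ (R `<=` e)) ->
  shell (closure_of D) (boundary D).
Proof.
move=> T sh TD R0 RS cT p q r h.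
have far e : ~~ (e `<=` T) -> deg (D `\ T) e = deg D e by move=> /negbTE eT; rewrite (deg_rem e
    TD) eT.
have inner s : s `<=` T -> ~~ (S `<=` s) -> s \in boundary (D `\ T).
  move=> sT nS; have [e [ce eT se de]] := p s sT nS; apply/in_boundaryP; exists e; split=> //.
  by rewrite deg_remove // de.
apply: (ShellS sh R0 RS cT) => s; rewrite -/T.
- move=> sT; split=> [/in_closureP[U UD sU]|nS].
    by apply: contra (r U UD) => Ss; exact: fsubset_trans sU.
  have /in_boundaryP[e [ce de se]] := inner s sT nS.
  have /deg_gt0P[U UD eU] : 0 < deg (D `\ T) e by rewrite de.
  by apply/in_closureP; exists U => //; exact: fsubset_trans eU.
- exact: inner.
- move=> /in_boundaryP[e [ce de se]] Rs; apply/negPn/negP => nsT.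
  have eT : ~~ (e `<=` T) by apply: contra nsT; exact: fsubset_trans.
  by move: (h e ce); rewrite -far // de => /(_ erefl); rewrite (fsubset_trans Rs se).
- split=> [/in_closureP[U UD sU]|[/in_closureP[U UD sU]|sT]].
  + have [UT|UT] := eqVneq U T; first by right; rewrite -UT.
    by left; apply/in_closureP; exists U; rewrite // in_fsetD1 UT.
  + by apply/in_closureP; exists U => //; move: UD; rewrite in_fsetD1 => /andP[].
  + by apply/in_closureP; exists T.
split=> [/in_boundaryP[e [ce de se]]|[[sT nR]|[/in_boundaryP[e [ce de se]] nsT]]].
- have [sT|sT] := boolP (s `<=` T); [left|right]; split=> //.
    by apply: contra (h e ce de) => Rs; exact: fsubset_trans se.
  have eT : ~~ (e `<=` T) by apply: contra sT; exact: fsubset_trans.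
  by apply/in_boundaryP; exists e; rewrite far.
- by have [e [ce eT se de]] := q s sT nR; apply/in_boundaryP; exists e.
have eT : ~~ (e `<=` T) by apply: contra nsT; exact: fsubset_trans.
by apply/in_boundaryP; exists e; rewrite -far.
Qed.

Lemma closure_of0 : closure_of fset0 = fset0.
Proof. by apply/fsetP=> s; rewrite in_fset0; apply/in_closureP => -[]. Qed.

Lemma boundary0 : boundary fset0 = fset0.
Proof.
apply/fsetP=> s; rewrite in_fset0; apply/negP => /in_boundaryP[e [_ de _]].
by have /deg_gt0P[] : 0 < deg fset0 e by rewrite de.
Qed.

Lemma sub_edge x y z s : s `<=` [fset x; y; z] -> z \notin s -> s `<=` [fset x; y].
Proof.
move=> /fsubsetP sT zs; apply/fsubsetP=> i si; have := sT i si; rewrite !inE.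
have /negbTE-> : i != z by apply: contraNneq zs => <-.
by rewrite orbF.
Qed.

(** [S] is the face by which the triangle is new: the empty one for the first triangle, the free
    vertex [y], or the boundary edge [xy]. The complementary face [R] becomes interior. *)
Lemma shelling_shell D : shelling D -> shell (closure_of D) (boundary D).
Proof.
elim=> [T cT|{}D x y z _ IH [TD xy xz yz [dxy dxz _]] free|{}D x y z _ IH [TD xy xz yz [dxy dxz
    _]] dyz int].
- have TE : T `|` fset0 = T by rewrite fsetU0.
  apply: (@shell_step _ T fset0); rewrite ?TE ?inE ?eqxx ?fdisjointX0 //.
  + by rewrite fsetDv closure_of0 boundary0; exact: Shell0.
  + by rewrite -cardfs_gt0 cT.
  + by move=> s _; rewrite fsub0set.
  + move=> s sT nT; have /fset0Pn[v] : T `\` s != fset0 by rewrite fsetD_eq0.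
    rewrite in_fsetD => /andP[vs vT]; exists (T `\ v); split.
    * by move: cT; rewrite (cardfsD1 v) vT => -[].
    * exact: fsubD1set.
    * by apply/fsubsetP=> i si; rewrite in_fsetD1 (fsubsetP sT) // andbT; apply: contraNneq vs
        => <-.
    * have := @deg_add fset0 T (T `\ v) (negbT (in_fset0 T)); rewrite fsubD1set fsetU0 => ->.
      apply/eqP; rewrite eqSS -leqn0 leqNgt; apply/negP => /deg_gt0P[U].
      by rewrite in_fset0.
  + by move=> U; rewrite fsetDv in_fset0.
  + by move=> e ce _; apply/negP => /fsubset_leq_card; rewrite cT ce.
- have [xyT xzT yzT] := triangle_edges x y z.
  have TE : [fset x; z] `|` [fset y] = [fset x; y; z] by fset_tac.
  have dyz : deg D [fset y; z] = 1.
    have := deg_rem [fset y; z] TD; rewrite yzT => ->; apply/eqP; rewrite eqSS -leqn0 leqNgt.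
    apply/negP => /deg_gt0P[U /free yU]; rewrite fsubUset fsub1set (negbTE yU) //.
  apply: (@shell_step _ [fset x; z] [fset y]); rewrite ?TE //.
  + by apply/fset0Pn; exists x; rewrite !inE eqxx.
  + by apply/fdisjointP => i; rewrite !inE => /orP[]/eqP->; rewrite // eq_sym.
  + by rewrite cardfs3_neq.
  + move=> s sT; rewrite fsub1set => ys; exists [fset x; z]; split; rewrite ?cardfs2 ?xz //.
    apply: (@sub_edge x z y) => //; apply: fsubset_trans sT _; fset_tac.
  + move=> s sT; rewrite fsubUset !fsub1set negb_and => /orP[xs|zs].
      exists [fset y; z]; split; rewrite ?cardfs2 ?yz //.
      apply: (@sub_edge y z x) => //; apply: fsubset_trans sT _; fset_tac.
    exists [fset x; y]; split; rewrite ?cardfs2 ?xy //; exact: sub_edge sT zs.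
  + by move=> U /free; rewrite fsub1set.
  + move=> e ce de; apply/negP => xze; have eE : e = [fset x; z].
      by apply/esym/eqP; rewrite eqEfcard xze ce cardfs2 xz.
    by rewrite eE dxz in de.
have [xyT xzT yzT] := triangle_edges x y z.
have TE : [fset z] `|` [fset x; y] = [fset x; y; z] by fset_tac.
apply: (@shell_step _ [fset z] [fset x; y]); rewrite ?TE //.
- by apply/fset0Pn; exists z; rewrite !inE eqxx.
- by apply/fdisjointP => i; rewrite !inE => /eqP->; rewrite negb_or !(eq_sym z) xz.
- by rewrite cardfs3_neq.
- move=> s sT; rewrite fsubUset !fsub1set negb_and => /orP[xs|ys].
    exists [fset y; z]; split; rewrite ?cardfs2 ?yz //.
    apply: (@sub_edge y z x) => //; apply: fsubset_trans sT _; fset_tac.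
  exists [fset x; z]; split; rewrite ?cardfs2 ?xz //.
  apply: (@sub_edge x z y) => //; apply: fsubset_trans sT _; fset_tac.
- move=> s sT; rewrite fsub1set => zs; exists [fset x; y]; split; rewrite ?cardfs2 ?xy //.
  exact: sub_edge sT zs.
- by move=> U UD; apply/negP => /(deg1_remove TD xyT dxy UD).
- by move=> e ce de; rewrite fsub1set; apply/negP => /(int e ce); rewrite de.
Qed.

End Shell.

(** * Flips *)

Section Flips.
Implicit Types (A B R S T s t u : {fset nat}) (C d K L Y : simplex_family).

Lemma in_filtered (X : choiceType) (K : {fset X}) (p : pred X) (t : X) :
  (t \in [fset t in K | p t]) = (t \in K) && p t.
Proof. by rewrite !inE. Qed.

Lemma setUDK u B : u `|` B = (u `\` B) `|` B.
Proof. fset_tac. Qed.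

(* Both complexes become equal once [B] is starred in one and [A] in the
   other. *)
Lemma flip K L A B : is_complex K -> A != fset0 -> B != fset0 -> fdisjoint A B ->
  A \notin K ->
  (forall t, fdisjoint t B -> t `|` B \in K <-> t `<=` A /\ ~~ (A `<=` t)) ->
  (forall t, t \in L <-> ~~ (B `<=` t) /\ (t \in K \/ t `<=` A `|` B)) ->
  stellar_equiv K L.
Proof.
move=> cK A0 B0 AB AK lkB LE.
have dAB t : (A `<=` t `\` B) = (A `<=` t) by rewrite fsubsetD AB andbT.
have key u : u `|` B \in K <-> u `<=` A `|` B /\ ~~ (A `<=` u).
  rewrite setUDK lkB ?dAB; last by apply/fdisjointP => i; rewrite in_fsetD => /andP[].
  by rewrite fsubDset fsetUC.
have BK : B \in K.
  by have [_] := key fset0; rewrite fset0U; apply; rewrite fsub0set fsubset0.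
have BA : ~~ (B `<=` A).
  apply/negP => BA; case/negP: B0; rewrite -fsubset0; apply/fsubsetP=> i iB.
  by have := fdisjointP AB _ (fsubsetP BA _ iB); rewrite iB.
have cL : is_complex L.
  split; first by apply/LE; rewrite fsubset0 complex0 //; split=> //; left.
  move=> s /LE[nB h] t ts; apply/LE; split; first by apply: contra nB => /fsubset_trans; apply.
  case: h => h; [left; exact: complexS cK ts h|right; exact: fsubset_trans ts h].
have AL : A \in L by apply/LE; split=> //; right; exact: fsubsetUl.
pose v := (\max_(i <- vertices K `|` A `|` B) i).+1.
have vlt i : i \in vertices K `|` A `|` B -> i != v.
  move=> h; rewrite neq_ltn ltnS (@leq_bigmax_seq _ _ xpredT id) //.
have vK : v \notin vertices K by apply: contraL (eqxx v) => h; apply: vlt; rewrite !in_fsetU h.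
have vA : v \notin A by apply: contraL (eqxx v) => h; apply: vlt; rewrite !in_fsetU h orbT.
have vB : v \notin B by apply: contraL (eqxx v) => h; apply: vlt; rewrite !in_fsetU h orbT.
have vL : v \notin vertices L.
  apply/negP => /in_verticesP[s /LE[_ [sK|/fsubsetP sAB]] vs].
    by move/negP: vK; apply; apply/in_verticesP; exists s.
  by have := sAB v vs; rewrite in_fsetU (negbTE vA) (negbTE vB).
suff E : stellar_subdivision K B v = stellar_subdivision L A v.
  apply: (@stellar_equiv_trans _ (stellar_subdivision K B v)).
    by apply: rst_step; exact: StellarSubdivision.
  by apply: stellar_equiv_sym; rewrite E; apply: rst_step; exact: StellarSubdivision.
apply/fsetP=> t; rewrite !in_star //; congr (_ || _).
  apply/idP/idP => [/andP[tK nB]|/andP[/LE[nB h] nA]].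
    have nA : ~~ (A `<=` t) by apply: contra AK => At; exact: complexS cK At tK.
    by rewrite nA andbT; apply/LE; split=> //; left.
  rewrite nB andbT; case: h => // tAB.
  by apply: complexS cK (fsubsetUl t B) _; apply/key.
congr (_ && _); set u := t `\ v.
apply/idP/idP => [/andP[/key[uAB nA] nB]|/andP[/LE[nBA h] nA]].
  rewrite nA andbT; apply/LE; split; last by right; rewrite fsubUset uAB fsubsetUl.
  apply: contra nB => /fsubsetP BuA; apply/fsubsetP=> i iB.
  have := BuA i iB; rewrite in_fsetU => /orP[//|iA].
  by have := fdisjointP AB _ iA; rewrite iB.
have uAB : u `<=` A `|` B.
  case: h => [uAK|]; last exact: fsubset_trans (fsubsetUl _ _).
  by case/negP: AK; exact: complexS cK (fsubsetUr u A) uAK.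
apply/andP; split; first exact/key.
by apply: contra nBA => Bu; apply: fsubset_trans Bu (fsubsetUl _ _).
Qed.

(* Replaces the ball [a * C] by the ball [b * (C u a * d)] with the same
   boundary; each triangle of the shelling contributes one [flip] of
   [a u R] into [b u S]. *)
Lemma absorb C d : shell C d -> forall (a b : nat) Y K L, is_complex Y -> a != b ->
  (forall s, s \in C -> (a \notin s) && (b \notin s)) -> b \notin vertices Y ->
  {subset C <= Y} -> (forall s, s \in d -> a |` s \in Y) ->
  (forall s, s \in C -> s \notin d -> a |` s \notin Y) ->
  (forall t, t \in K <-> t \in Y \/ t `\ a \in C) ->
  (forall t, t \in L <-> t \in Y \/ (t `\ b \in C \/ t `\ b `\ a \in d)) ->
  stellar_equiv K L.
Proof.
elim=> [|{}C {}d C' d' R S sh IH R0 RS cT SC Sd Rd C'E d'E] a b Y K L cY ab abC bY CY dY nY KE LE.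
  suff -> : K = L by exact: rst_refl.
  by apply/fsetP=> t; apply/idP/idP => [/KE|/LE] h; [apply/LE|apply/KE]; left; case: h => // -[].
set T := R `|` S in cT SC Sd Rd C'E d'E.
have [Ccl [dcl dC]] := shell_closed sh.
have [C'cl [d'cl dC']] := shell_closed (ShellS sh R0 RS cT SC Sd Rd C'E d'E).
have TC' : T \in C' by apply/C'E; right.
have CC' s : s \in C -> s \in C' by move=> sC; apply/C'E; left.
have [aT bT] := andP (abC T TC').
have RT : R `<=` T := fsubsetUl _ _. have ST : S `<=` T := fsubsetUr _ _.
have aR : a \notin R := contra (fsubsetP RT a) aT.
have aS : a \notin S := contra (fsubsetP ST a) aT.
have bR : b \notin R := contra (fsubsetP RT b) bT.
have bS : b \notin S := contra (fsubsetP ST b) bT.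
have Rd' s : R `<=` s -> s \notin d'.
  move=> Rs; apply/negP => /d'E[[_ /negP[]//]|[sd /negP[]]]; exact: Rd.
have RC' : R \in C' by exact: C'cl RT.
have aRY : a |` R \notin Y by apply: nY => //; exact: Rd'.
have bYs s : s \in Y -> b \notin s by move=> sY; exact: vertices_notin bY sY.
(* The cone on the last triangle is made part of the surroundings, so the induction hypothesis
   replaces just the cone on the rest. *)
pose Y1 := Y `|` simplex (a |` T).
have inY1 t : (t \in Y1) = (t \in Y) || (t `<=` a |` T) by rewrite in_fsetU in_simplex.
have subaT t : (t `<=` a |` T) = (t `\ a `<=` T) by rewrite fsubDset.
have d_out s : s \in d -> ~~ (s `<=` T) -> s \in d' by move=> sd sT; apply/d'E; right.
have d_in s : s `<=` T -> ~~ (R `<=` s) -> s \in d' by move=> sT sR; apply/d'E; left.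
have dY1 s : s \in d -> a |` s \in Y1.
  move=> sd; rewrite inY1; have [sT|sT] := boolP (s `<=` T).
    by rewrite fsetUS ?orbT.
  by rewrite dY //; exact: d_out.
have cY1 : is_complex Y1.
  split=> [|s]; first by rewrite inY1 complex0.
  rewrite inY1 => /orP[sY|sT] t ts; rewrite inY1; first by rewrite (complexS cY ts).
  by rewrite (fsubset_trans ts sT) orbT.
have vY1 s i : s \in Y1 -> i \in s -> i \in vertices Y1 by move=> ? ?; apply/in_verticesP;
    exists s.
have CY1 s : s \in C -> s \in Y1 by move=> sC; rewrite inY1 CY ?CC'.
pose M := Y1 `|` [fset t in fpowerset (b |` vertices Y1) |
  (t `\ b \in C) || (t `\ b `\ a \in d)].
have ME t : t \in M <-> t \in Y1 \/ (t `\ b \in C \/ t `\ b `\ a \in d).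
  rewrite in_fsetU in_filtered fpowersetE; split.
    by case/orP=> [|/andP[_ /orP[]]]; tauto.
  case=> [->//|h]; apply/orP; right; apply/andP; split; last by apply/orP.
  apply/fsubsetP=> i it; rewrite in_fset1U; have [//|ib] := eqVneq i b; rewrite /=.
  case: h => h; first by apply: (vY1 _ i (CY1 _ h)); rewrite !inE ib.
  by apply: (vY1 _ i (dY1 _ h)); rewrite !inE ib it; case: (i == a).
have bY1 s : s \in Y1 -> b \notin s.
  rewrite inY1 => /orP[/bYs//|/fsubsetP sT]; apply/negP => /sT.
  by rewrite in_fset1U eq_sym (negbTE ab) (negbTE bT).
have KM : stellar_equiv K M.
  apply: (IH a b Y1) => //.
  - by move=> s /CC'; exact: abC.
  - by apply/negP => /in_verticesP[s /bY1/negP].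
  - move=> s sC sd; have sT : ~~ (s `<=` T).
      by apply: contra sd => sT; apply: Sd => //; apply/SC.
    have sd' : s \notin d'.
      by apply/negP => /d'E[[sT' _]|[sd' _]]; [rewrite sT' in sT|rewrite sd' in sd].
    rewrite inY1 negb_or nY ?CC' //= subaT.
    apply: contra sT; apply: fsubset_trans; rewrite fsubsetD1 fsubsetU1.
    by case/andP: (abC s (CC' s sC)).
  - move=> t; rewrite inY1 subaT; split=> [/KE[tY|/C'E[tC|tT]]|[/orP[tY|tT]|h]].
    + by left; rewrite tY.
    + by right.
    + by left; rewrite tT orbT.
    + by apply/KE; left.
    + by apply/KE; right; apply/C'E; right.
    + by apply/KE; right; apply/C'E; left.
have cK : is_complex K.
  split=> [|s /KE h t ts]; apply/KE; first by left; rewrite complex0.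
  by case: h => h; [left; exact: complexS cY ts h|right; apply: C'cl h _; exact: fsetSD].
have cM : is_complex M by apply/(stellar_equiv_complex KM).
apply: (stellar_equiv_trans KM).
have remb (u s : {fset nat}) : b \notin s -> (s `<=` u `\ b) = (s `<=` u).
  by move=> bs; rewrite fsubsetD1 bs andbT.
have aneb : b \notin [fset a] by rewrite inE eq_sym.
have baR : b \notin a |` R by rewrite in_fset1U eq_sym (negbTE ab).
have mem_aR u : (a |` R `<=` u) = (a \in u) && (R `<=` u `\ a).
  by rewrite fsubUset fsub1set fsubsetD1 aR andbT.
have bdisj : fdisjoint (b |` S) (a |` R).
  apply/fdisjointP => i; rewrite !in_fset1U => /orP[/eqP->|iS].
    by rewrite eq_sym (negbTE ab).
  rewrite negb_or (contraTneq _ iS) => [|->//]; rewrite /=.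
  by apply: contraL iS => iR; exact: (fdisjointP RS).
(* The cone on [T] is now attached to the replaced ball, and [a u R] has the boundary of [b u S] as
   its link. The flip removes the former and inserts the latter, absorbing this cone into the
   ball. *)
apply: (flip cM _ _ bdisj).
- by apply/fset0Pn; exists b; rewrite in_fset1U eqxx.
- by apply/fset0Pn; exists a; rewrite in_fset1U eqxx.
- apply/negP => /ME[/bY1|]; first by rewrite in_fset1U eqxx.
  have -> : (b |` S) `\ b = S by rewrite fsetU1K.
  have -> : S `\ a = S by apply/fsetDidPl; rewrite fdisjointX1.
  by case=> [|/dC] /SC => /(_ ST); rewrite fsubset_refl.
- move=> t tB; have tdis i : i \in t -> (i != a) && (i \notin R).
    by move=> it; have := fdisjointP tB _ it; rewrite in_fset1U negb_or.
  have at_ : a \notin t by apply/negP => /tdis; rewrite eqxx.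
  have tS : t `\ b `<=` T -> t `<=` b |` S.
    move=> /fsubsetP tT; apply/fsubsetP=> i it; rewrite in_fset1U.
    have [//|ib] := eqVneq i b; have := tT i; rewrite in_fsetD1 ib it => /(_ isT).
    by rewrite in_fsetU; have /andP[_ /negbTE->] := tdis i it.
  set u := t `|` (a |` R).
  have uE : u `\ b `\ a = (t `\ b) `|` R.
    apply/fsetP=> i; rewrite !inE; have [->|ia] := eqVneq i a.
      by rewrite (negbTE at_) (negbTE aR) andbF.
    by have [->|] := eqVneq i b; rewrite ?(negbTE bR).
  have Su : (S `<=` u `\ b `\ a) = (S `<=` t).
    rewrite uE; apply/fsubsetP/fsubsetP => h i iS; have := h i iS; rewrite !inE.
      by rewrite (contraTF (fdisjointP RS i)) ?negbK // orbF => /andP[].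
    by move=> ->; rewrite andbT; apply/orP; left; apply: contraTneq iS => ->.
  split=> [/ME[|[|ud]]|[tbS ntbS]].
  + rewrite inY1 => /orP[uY|ua].
      by case/negP: aRY; apply: complexS cY _ uY; exact: fsubsetUr.
    have bt : b \notin t.
      apply/negP => bt; have bu : b \in u by rewrite in_fsetU bt.
      by have := fsubsetP ua _ bu; rewrite in_fset1U eq_sym (negbTE ab) (negbTE bT).
    split; last by rewrite fsubUset fsub1set (negbTE bt).
    apply: tS; apply: fsubset_trans (fsubD1set _ _) _.
    apply/fsubsetP=> i it; have iu : i \in u by rewrite in_fsetU it.
    by have := fsubsetP ua _ iu; rewrite in_fset1U; have /andP[/negbTE-> _] := tdis i it.
  + move=> /CC'/abC/andP[/negP[]]; rewrite !inE eqxx !orbT andbT //.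
  + have uT : u `\ b `\ a `<=` T by apply: Rd => //; rewrite uE fsubsetUr.
    split; first by apply: tS; apply: fsubset_trans uT; rewrite uE fsubsetUl.
    rewrite fsubUset negb_and -Su; apply/orP; right; apply/SC => //; exact: dC.
  apply/ME; have [bt|bt] := boolP (b \in t).
    have nSt : ~~ (S `<=` t) by apply: contra ntbS => St; rewrite fsubUset fsub1set bt.
    right; right; apply: Sd; rewrite ?Su // uE fsubUset RT andbT.
    by apply: fsubset_trans ST; rewrite fsubDset.
  left; rewrite inY1 fsubUset fsetUS // andbT; apply/orP; right.
  apply: fsubset_trans (fsubsetU1 _ _); apply: fsubset_trans ST.
  by apply/fsubsetP=> i it; have := fsubsetP tbS i it; rewrite in_fset1U; case: eqVneq it =>
      [->|//]; rewrite (negbTE bt).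
move=> t; rewrite mem_aR.
have subT : t `\ b `\ a `<=` T -> t `<=` (b |` S) `|` (a |` R).
  move=> /fsubsetP h; apply/fsubsetP=> i it; have := h i; rewrite !inE it andbT.
  by case: (i == a); case: (i == b); rewrite ?orbT //= => /(_ isT); rewrite orbC.
have nab : a \notin t -> t `\ b `\ a = t `\ b.
  by move=> at_; apply/fsetDidPl; rewrite fdisjointX1 in_fsetD1 (negbTE at_) andbF.
have Rt : (R `<=` t `\ b `\ a) = (R `<=` t `\ a).
  by rewrite fsubsetD1 aR andbT remb // fsubsetD1 aR andbT.
have inside : t `\ b `\ a `<=` T -> ~~ ((a \in t) && (R `<=` t `\ a)) -> t \in L.
  move=> tT; rewrite negb_and => /orP[at_|nR]; apply/LE; right.
    by left; apply/C'E; right; rewrite -nab.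
  by right; apply: d_in; rewrite // Rt.
split=> [/LE[tY|[tC|td]]|[nR [/ME[|[tC|td]]|tAB]]].
- split; last by left; apply/ME; left; rewrite inY1 tY.
  by rewrite -mem_aR; apply: contra aRY => h; exact: complexS cY h tY.
- have at_ : a \notin t.
    by have /andP[+ _] := abC _ tC; rewrite in_fsetD1 ab.
  rewrite (negbTE at_); split=> //; case/C'E: tC => h; first by left; apply/ME; right; left.
  by right; apply: subT; rewrite nab.
- rewrite -Rt; split.
    by rewrite negb_and; apply/orP; right; apply: contraL td; exact: Rd'.
  have [tT|tT] := boolP (t `\ b `\ a `<=` T); first by right; exact: subT.
  by left; apply/ME; right; right; case/d'E: td => [[tT']|[]//]; rewrite tT' in tT.
- rewrite inY1 => /orP[tY|taT]; first by apply/LE; left.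
  apply: inside => //; rewrite -subaT; apply: fsubset_trans taT; exact: fsubD1set.
- by apply/LE; right; left; exact: CC'.
- have [tT|tT] := boolP (t `\ b `\ a `<=` T); first exact: inside.
  by apply/LE; right; right; exact: d_out.
apply: inside => //; apply/fsubsetP=> i; rewrite !inE => /and3P[ia ib it].
by have := fsubsetP tAB i it; rewrite !inE (negbTE ia) (negbTE ib) /= orbC.
Qed.

Lemma bd_relabel A A' : #|` A| = #|` A'| -> A != fset0 ->
  stellar_equiv (simplex_bd A) (simplex_bd A').
Proof.
move=> cAA' A0; pose f i := nth 0 (enum_fset A') (index i (enum_fset A)).
have idx i : i \in A -> index i (enum_fset A) < size (enum_fset A').
  by move=> iA; rewrite -[size _]/(#|` A'|) -cAA' -index_mem in iA *.
have finj : {in A &, injective f}.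
  move=> i j iA jA /eqP; rewrite /f nth_uniq ?fset_uniq ?idx // => /eqP E.
  by rewrite -(nth_index 0 iA) E nth_index.
have fA : f @` A = A'.
  apply/eqP; rewrite eqEfcard card_in_imfset // cAA' leqnn andbT.
  by apply/fsubsetP=> _ /imfsetP[i /= iA ->]; apply: mem_nth; exact: idx.
have cA := simplex_bd_complex A0.
have vA i : i \in vertices (simplex_bd A) -> i \in A.
  by case/in_verticesP=> s; rewrite in_simplex_bd => /andP[/fsubsetP sA _] /sA.
suff <- : relabel f (simplex_bd A) = simplex_bd A'.
  by apply: rst_step; apply: StellarRelabel => // i j /vA iA /vA jA; exact: finj.
apply/fsetP=> t; apply/in_relabelP/idP => [[s + ->]|].
  rewrite !in_simplex_bd => /andP[sA As]; apply/andP; split.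
    by rewrite -fA; apply/fsubsetP=> _ /imfsetP[i /= /(fsubsetP sA) iA ->]; apply/imfsetP;
        exists i.
  apply: contra As => As; apply/fsubsetP=> i iA.
  have : f i \in f @` s by apply: (fsubsetP As); rewrite -fA; apply/imfsetP; exists i.
  by case/imfsetP=> j /= js /finj->//; exact: (fsubsetP sA).
rewrite in_simplex_bd => /andP[tA' At]; exists [fset i in A | f i \in t].
  rewrite in_simplex_bd fset_sub /=; apply: contra At => /fsubsetP As.
  rewrite -fA; apply/fsubsetP=> _ /imfsetP[i /= iA ->].
  by have := As i iA; rewrite in_filtered => /andP[].
apply/fsetP=> i; apply/idP/imfsetP => [it|[j /=]].
  have := fsubsetP tA' i it; rewrite -fA => /imfsetP[j /= jA ij]; exists j => //.
  by rewrite in_filtered jA -ij.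
by rewrite in_filtered => /andP[_ ?] ->.
Qed.

(** The union of [a * C], [b * C] and [a * b * d]: the ball [a * C] together with the cone from [b]
    over its boundary sphere. *)
Definition two_cones C d (a b : nat) : simplex_family :=
  [fset t in fpowerset (a |` (b |` vertices C)) |
    (t `\ b `\ a \in C) && ((a \in t) && (b \in t) ==> (t `\ b `\ a \in d))].

Lemma in_two_cones C d a b t : (t \in two_cones C d a b) =
  (t `\ b `\ a \in C) && ((a \in t) && (b \in t) ==> (t `\ b `\ a \in d)).
Proof.
rewrite in_filtered fpowersetE andb_idl // => /andP[tC _].
apply/fsubsetP=> i it; rewrite !in_fset1U.
case: eqVneq => //= ia; case: eqVneq => //= ib; apply/in_verticesP.
by exists (t `\ b `\ a) => //; rewrite !inE ia ib.
Qed.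

Lemma two_cones_complex C d (a b : nat) : shell C d -> C != fset0 ->
  is_complex (two_cones C d a b).
Proof.
move=> sh C0; have [Ccl [dcl _]] := shell_closed sh.
have sub0 (s t : {fset nat}) : t `<=` s -> t `\ b `\ a `<=` s `\ b `\ a by move=> ts; rewrite
    !fsetSD.
have /fset0Pn[s sC] := C0.
split=> [|s1]; rewrite in_two_cones.
  by rewrite !fset0D (Ccl s fset0 sC (fsub0set _)) in_fset0.
case/andP=> h1 h2 t ts; rewrite in_two_cones (Ccl _ _ h1 (sub0 s1 t ts)) /=.
apply/implyP => /andP[at_ bt]; apply: (dcl (s1 `\ b `\ a)); last exact: sub0.
by apply: (implyP h2); rewrite !(fsubsetP ts).
Qed.

(** Adding a triangle [R u S] to the disc amounts to a flip that exchanges [a u b u R] for [S], so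
    the shelling can be undone down to one triangle. *)
Lemma shell_two_cones C d (a b : nat) : shell C d -> a != b ->
  (forall s, s \in C -> (a \notin s) && (b \notin s)) -> C != fset0 ->
  stellar_equiv (two_cones C d a b) (simplex_bd [fset i in iota 1 5]).
Proof.
move=> sh ab; elim: sh => [|{}C {}d C' d' R S sh IH R0 RS cT SC Sd Rd C'E d'E abC _].
  by rewrite eqxx.
set T := R `|` S in cT SC Sd Rd C'E d'E.
have [Ccl [dcl dC]] := shell_closed sh.
have [C'cl [d'cl dC']] := shell_closed (ShellS sh R0 RS cT SC Sd Rd C'E d'E).
have TC' : T \in C' by apply/C'E; right.
have CC' s : s \in C -> s \in C' by move=> sC; apply/C'E; left.
have [aT bT] := andP (abC T TC').
have RT : R `<=` T := fsubsetUl _ _. have ST : S `<=` T := fsubsetUr _ _.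
have aR : a \notin R := contra (fsubsetP RT a) aT.
have aS : a \notin S := contra (fsubsetP ST a) aT.
have bR : b \notin R := contra (fsubsetP RT b) bT.
have bS : b \notin S := contra (fsubsetP ST b) bT.
have d_out s : s \in d -> ~~ (s `<=` T) -> s \in d' by move=> sd sT; apply/d'E; right.
have d_in s : s `<=` T -> ~~ (R `<=` s) -> s \in d' by move=> sT sR; apply/d'E; left.
have Rd' s : R `<=` s -> s \notin d'.
  move=> Rs; apply/negP => /d'E[[_ /negP[]//]|[sd /negP[]]]; exact: Rd.
pose B := a |` (b |` R).
have BE t : (B `<=` t) = [&& a \in t, b \in t & R `<=` t `\ b `\ a].
  by rewrite /B !fsubUset !fsub1set !fsubsetD1 aR bR !andbT.
have subT t : (t `\ b `\ a `<=` T) = (t `<=` S `|` B).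
  rewrite !fsubDset; congr (_ `<=` _); rewrite /B /T; fset_tac.
pose K' := two_cones C' d' a b.
(* An empty [S] marks the first triangle, and all proper faces of the simplex on it and [a], [b] are
   present. *)
have [S0|S0] := eqVneq S fset0.
  have C0 s : s \notin C.
    apply/negP => sC; have := Ccl s fset0 sC (fsub0set _); move/SC => /(_ (fsub0set _)).
    by rewrite S0 fsub0set.
  have TR : T = R by rewrite /T S0 fsetU0.
  have -> : two_cones C' d' a b = simplex_bd B.
    apply/fsetP=> t; rewrite in_two_cones in_simplex_bd -{1}(fset0U B) -S0 -subT BE.
    apply/andP/andP => -[h1 h2]; split.
    - by case/C'E: h1 => // h; rewrite (negbTE (C0 _)) in h.
    - by rewrite andbA; apply: contraTN h2 => /andP[-> /Rd'/negbTE->].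
    - by apply/C'E; right.
    apply/implyP => abt; apply: d_in => //; apply: contra h2 => ->.
    by rewrite andbT.
  apply: bd_relabel; last by apply/fset0Pn; exists a; rewrite in_fset1U eqxx.
  rewrite card_fseq undup_id ?iota_uniq // size_iota /B !cardfsU1 in_fset1U (negbTE ab) aR bR.
  by rewrite -TR cT.
have C0 : C != fset0.
  by apply/fset0Pn; exists fset0; apply/SC; rewrite ?fsub0set // fsubset0.
apply: stellar_equiv_trans (IH _ C0) => [|s /CC'/abC //]; apply: stellar_equiv_sym.
have cK := two_cones_complex a b sh C0.
have SB : fdisjoint S B.
  apply/fdisjointP => i iS; rewrite /B !in_fset1U !negb_or.
  have -> : i != a by apply: contraTneq iS => ->.
  have -> : i != b by apply: contraTneq iS => ->.
  by apply: contraL iS => iR; exact: (fdisjointP RS).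
apply: (flip cK S0 _ SB).
- by apply/fset0Pn; exists a; rewrite in_fset1U eqxx.
- rewrite in_two_cones negb_and; apply/orP; left.
  have -> : S `\ b `\ a = S.
    apply/fsetP=> i; rewrite !inE; case: (eqVneq i a) => [->|_]; first by rewrite (negbTE aS).
    by case: (eqVneq i b) => [->|//]; rewrite (negbTE bS).
  by apply/negP => /(SC _ ST); rewrite fsubset_refl.
- move=> t tB; have tdis i : i \in t -> [&& i != a, i != b & i \notin R].
    by move=> it; have := fdisjointP tB _ it; rewrite /B !in_fset1U !negb_or.
  have at_ : a \notin t by apply/negP => /tdis; rewrite eqxx.
  have bt : b \notin t by apply/negP => /tdis; rewrite eqxx andbF.
  have uE : (t `|` B) `\ b `\ a = t `|` R.
    apply/fsetP=> i; rewrite /B !inE.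
    case: (eqVneq i a) => [->|_]; first by rewrite (negbTE at_) (negbTE aR).
    by case: (eqVneq i b) => [->|_] //; rewrite (negbTE bt) (negbTE bR).
  have Su : (S `<=` t `|` R) = (S `<=` t).
    apply/fsubsetP/fsubsetP => h i iS; have := h i iS; rewrite !inE; last by move=> ->.
    by case/orP=> // iR; have := fdisjointP RS i iR; rewrite iS.
  rewrite in_two_cones uE !inE !eqxx !orbT /=.
  split=> [/andP[uC ud]|[tS nSt]].
    have uT : t `|` R `<=` T by apply: Rd => //; exact: fsubsetUr.
    split; last by rewrite -Su; apply/SC.
    apply/fsubsetP=> i it; have : i \in T by apply: (fsubsetP uT); rewrite inE it.
    by rewrite inE => /orP[iR|//]; have /and3P[_ _] := tdis i it; rewrite iR.
  have uT : t `|` R `<=` T by rewrite fsubUset RT (fsubset_trans tS ST).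
  have ud : t `|` R \in d by apply: Sd => //; rewrite Su.
  by rewrite ud dC.
move=> t; rewrite -subT !in_two_cones BE andbA.
split=> [/andP[tC td]|[nB [/andP[tC td]|tT]]].
- split; first by rewrite negb_and -implybE; apply/implyP => abt; apply/negP => /Rd'; rewrite
    (implyP td abt).
  case/C'E: tC => [tC|]; last by right.
  have [|tT] := boolP (t `\ b `\ a `<=` T); first by right.
  left; rewrite tC; apply/implyP => /(implyP td)/d'E[[]|[]//]; by rewrite (negbTE tT).
- rewrite CC' //; apply/implyP => abt; have td' := implyP td abt.
  have [tT|] := boolP (t `\ b `\ a `<=` T); last exact: d_out.
  by apply: d_in => //; move: nB; rewrite abt.
apply/andP; split; first by apply/C'E; right.
by apply/implyP => abt; apply: d_in => //; move: nB; rewrite abt.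
Qed.

End Flips.

(** * Derived subdivisions *)

Section Derived.
Variables (B W : simplex_family) (U : {fset nat}) (lb : {fset nat} -> nat)
  (cmp : nat -> nat -> bool) (le : {fset nat} -> nat -> bool).
Implicit Types (V : simplex_family) (s t u : {fset nat}) (l : nat).
Hypotheses (cB : is_complex B) (WB : W `<=` B) (W0 : fset0 \notin W)
  (Wup : forall s t, s \in W -> t \in B -> s `<=` t -> t \in W)
  (lbB : {in W, forall s, lb s \notin vertices B})
  (lbU : {in W, forall s, lb s \notin U}) (lb_inj : {in W &, injective lb})
  (le_mono : forall s t l, s `<=` t -> le t l -> le s l)
  (le_lb : forall s t, s \in B -> t \in W -> le s (lb t) = (s `<=` t))
  (cmp_lb : {in W &, forall s t, cmp (lb s) (lb t) = (s `<=` t) || (t `<=` s)})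
  (cmp_U : forall s l, s \in W -> l \in U -> cmp (lb s) l = le s l)
  (cmpC : forall l l', cmp l l' = cmp l' l).

Let p := vertices B.

(* The simplexes [s u J] with [s] in [B] but not in [V] and [J] a set of
   pairwise comparable labels above [s], each in [U] or labelling a member of
   [V]. *)
Definition derived V : simplex_family :=
  [fset t in fpowerset (vertices B `|` (U `|` [fset lb s | s in V])) |
    [&& t `&` vertices B \in B, t `&` vertices B \notin V &
      all (fun l => le (t `&` vertices B) l && all (cmp l) (enum_fset (t `\` vertices B)))
          (enum_fset (t `\` vertices B))]].

Lemma in_derived V t : t \in derived V <->
  [/\ t `&` p \in B, t `&` p \notin V & forall l, l \in t -> l \notin p ->
    [/\ l \in U \/ (exists2 s, s \in V & l = lb s), le (t `&` p) l &
      forall l', l' \in t -> l' \notin p -> cmp l l']].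
Proof.
rewrite /derived -/p in_filtered fpowersetE; split.
  case/andP=> /fsubsetP tp /and3P[h1 h2 /allP h3]; split=> // l lt lp.
  have lD : l \in t `\` p by rewrite in_fsetD lp.
  have /andP[h4 /allP h5] := h3 l lD; split=> // [|l' l't l'p]; last first.
    by apply: h5; rewrite -[_ \in _]/(l' \in t `\` p) in_fsetD l'p.
  have := tp l lt; rewrite in_fsetU -/p (negbTE lp) orFb in_fsetU => /orP[lU|/imfsetP[s /= sV
      ->]]; first by left.
  by right; exists s.
case=> h1 h2 h3; rewrite h1 h2 /=; apply/andP; split.
  apply/fsubsetP=> l lt; rewrite !in_fsetU; have [//|lp] := boolP (l \in p).
  have [[->//|[s sV ->]] _ _] := h3 l lt lp.
  by apply/orP; right; apply/orP; right; apply/imfsetP; exists s.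
apply/allP => l; rewrite -[_ \in _]/(l \in t `\` p) in_fsetD => /andP[lp lt].
have [_ -> h5] := h3 l lt lp; apply/allP => l'.
by rewrite -[_ \in _]/(l' \in t `\` p) in_fsetD => /andP[l'p l't]; exact: h5.
Qed.

(** [V] is the set of simplexes already starred. Larger simplexes come first, so at each stage it is
    closed upwards. *)
Definition upper V := [/\ V `<=` W & forall s t, s \in V -> t \in B -> s `<=` t -> t \in V].

Lemma derived_complex V : upper V -> is_complex (derived V).
Proof.
move=> [VW Vup]; split=> [|s /in_derived[h1 h2 h3] t ts].
  apply/in_derived; rewrite fset0I complex0 //; split=> //.
  by apply: contra W0; exact: (fsubsetP VW).
have tsp : t `&` p `<=` s `&` p by exact: fsetSI.
apply/in_derived; split; first exact: complexS cB tsp h1.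
  by apply: contra h2 => tV; exact: Vup tsp.
move=> l lt lp; have [h4 h5 h6] := h3 l (fsubsetP ts l lt) lp; split=> //.
  exact: le_mono h5.
by move=> l' l't; apply: h6; exact: (fsubsetP ts).
Qed.

Lemma sub_vertices s : s \in B -> s `<=` p.
Proof. by move=> sB; apply/fsubsetP=> i si; apply/in_verticesP; exists s. Qed.

(** All proper cofaces of [s0] in [B] have been starred before it, so a simplex of the current
    complex that contains [s0] adds only labels to it. Starring [s0] then introduces exactly the
    chains that start with its label. *)
Lemma derived_step V s0 : upper V -> s0 \in V ->
  (forall s, s \in V -> s `<=` s0 -> s = s0) ->
  upper (V `\ s0) /\ stellar_equiv (derived (V `\ s0)) (derived V).
Proof.
move=> uV sV smin; have [VW Vup] := uV.
have uV' : upper (V `\ s0).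
  split; first exact: fsubset_trans (fsubD1set _ _) VW.
  move=> s t; rewrite !in_fsetD1 => /andP[ss0 sV'] tB st; rewrite (Vup s t) // andbT.
  by apply: contraNneq ss0 => tE; apply/eqP/smin; rewrite -?tE.
split=> //; have cV' := derived_complex uV'.
have V'V s : s \in V `\ s0 -> s \in V by rewrite in_fsetD1 => /andP[].
have sW := fsubsetP VW _ sV; have sB := fsubsetP WB _ sW.
pose v := lb s0; have vp : v \notin p by exact: lbB.
have vU : v \notin U by exact: lbU.
have vlb s : s \in V `\ s0 -> v <> lb s.
  rewrite in_fsetD1 => /andP[ss0 sV'] /lb_inj E; rewrite E ?eqxx // in ss0.
  exact: (fsubsetP VW).
have nv t : t \in derived (V `\ s0) -> v \notin t.
  case/in_derived=> _ _ h; apply/negP => vt; have [[vU'|[s sV' lE]] _ _] := h v vt vp.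
    by rewrite vU' in vU.
  exact: vlb sV' lE.
have sp : s0 `&` p = s0 by apply/fsetIidPl; exact: sub_vertices.
have s0D : s0 \in derived (V `\ s0).
  apply/in_derived; rewrite sp sB in_fsetD1 eqxx; split=> // l ls0 /negP[].
  exact: (fsubsetP (sub_vertices sB)).
have subp t : (s0 `<=` t) = (s0 `<=` t `&` p) by rewrite fsubsetI sub_vertices // andbT.
have s00 : s0 != fset0 by apply: contraNneq W0 => <-.
have maxV s : s \in B -> s0 `<=` s -> s \notin V `\ s0 -> s = s0.
  by move=> sB' ss; rewrite in_fsetD1 (Vup s0 s) // andbT negbK => /eqP.
suff <- : stellar_subdivision (derived (V `\ s0)) s0 v = derived V.
  apply: rst_step; apply: StellarSubdivision => //.
  by apply/negP => /in_verticesP[t /nv/negP].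
apply/fsetP=> t; rewrite in_star //; last by apply/negP => /in_verticesP[? /nv/negP].
have [vt|vt] := boolP (v \in t); last first.
  rewrite andFb orbF; apply/andP/idP => [[/in_derived[h1 h2 h3] st]|/in_derived[h1 h2 h3]].
    apply/in_derived; split=> //.
      by apply: contra st => tV; rewrite subp; move: h2; rewrite in_fsetD1 tV andbT negbK =>
          /eqP->.
    move=> l lt lp; have [h4 h5 h6] := h3 l lt lp; split=> //.
    by case: h4 => [|[s /V'V]]; [left|right; exists s].
  split; last by rewrite subp; apply: contra h2 => /(Vup _ _ sV h1).
  apply/in_derived; split=> //; first by apply: contra h2 => /V'V.
  move=> l lt lp; have [h4 h5 h6] := h3 l lt lp; split=> //.
  case: h4 => [|[s sV' lE]]; [by left|right; exists s => //].
  by rewrite in_fsetD1 sV' andbT; apply: contraNneq vt => sE; rewrite /v -sE -lE.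
rewrite (_ : (t \in derived (V `\ s0)) = false) /=; last by apply: contraTF vt; exact: nv.
have tv : (t `\ v) `&` p = t `&` p.
  apply/fsetP=> i; rewrite 2!in_fsetI in_fsetD1; case: (eqVneq i v) => [->|//].
  by rewrite (negbTE vp) !andbF.
set u := t `\ v `|` s0.
have up : u `&` p = (t `&` p) `|` s0 by rewrite /u fsetIUl tv sp.
rewrite subp tv; apply/idP/idP => [/andP[/in_derived[h1 h2 h3] nst]|/in_derived[h1 h2 h3]].
  have uE : u `&` p = s0 by apply: maxV => //; rewrite up fsubsetUr.
  have ts : t `&` p `<=` s0 by rewrite -uE up fsubsetUl.
  have tB : t `&` p \in B by exact: complexS cB ts sB.
  have inu l : l \in t -> l != v -> l \in u by move=> lt lv; rewrite !inE lv lt.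
  have cv l : l \in t -> l \notin p -> cmp v l.
    move=> lt lp; have [->|lv] := eqVneq l v; first by rewrite cmp_lb ?fsubset_refl.
    have [[lU|[s sV' lE]] h5 _] := h3 l (inu l lt lv) lp; rewrite uE in h5.
      by rewrite cmp_U.
    have sW' := fsubsetP VW _ (V'V s sV').
    by move: h5; rewrite lE le_lb // cmp_lb // => ->.
  apply/in_derived; split=> //.
    apply/negP => tV; case/negP: nst.
    by rewrite (smin _ tV ts).
  move=> l lt lp; have [lE|lv] := eqVneq l v.
    rewrite lE; split; [by right; exists s0|by rewrite le_lb|exact: cv].
  have [h4 h5 h6] := h3 l (inu l lt lv) lp; split.
  - by case: h4 => [|[s /V'V]]; [left|right; exists s].
  - by apply: le_mono h5; rewrite uE.
  move=> l' l't l'p; have [->|l'v] := eqVneq l' v; first by rewrite cmpC cv.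
  by apply: h6 => //; exact: inu.
have [_ tle vcmp] := h3 v vt vp.
have ts : t `&` p `<=` s0 by move: tle; rewrite le_lb.
have nst : ~~ (s0 `<=` t `&` p) by apply: contra h2 => st; rewrite (_ : t `&` p = s0) //;
    apply/eqP; rewrite eqEfsubset ts.
have uE : u `&` p = s0 by rewrite up; apply/fsetUidPr.
apply/andP; split=> //; apply/in_derived; rewrite uE sB in_fsetD1 eqxx; split=> // l lu lp.
have inu l1 : l1 \in u -> l1 \notin p -> l1 \in t /\ l1 != v.
  rewrite !inE => /orP[/andP[//]|ls0 /negP[]]; exact: (fsubsetP (sub_vertices sB)).
have [lt lv] := inu l lu lp; have [h4 h5 h6] := h3 l lt lp; split.
- case: h4 => [|[s sV' lE]]; [by left|right; exists s => //].
  by rewrite in_fsetD1 sV' andbT; apply: contraNneq lv => sE; rewrite lE sE.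
- have := vcmp l lt lp; case: h4 => [lU|[s sV' lE]]; first by rewrite cmp_U.
  have sW' := fsubsetP VW _ sV'.
  rewrite lE cmp_lb // le_lb // => /orP[//|ss].
  by rewrite (smin s) // in lE *; rewrite lE eqxx in lv.
by move=> l' l'u l'p; have [l't _] := inu l' l'u l'p; exact: h6.
Qed.

Lemma derived_equiv : stellar_equiv (derived fset0) (derived W).
Proof.
suff h n V : #|` V| = n -> upper V -> stellar_equiv (derived fset0) (derived V).
  by apply: (h _ _ erefl); split=> // s t; exact: Wup.
elim: n V => [|n IH] V Vn uV; first by move/eqP: Vn; rewrite cardfs_eq0 => /eqP->; exact:
    rst_refl.
have [s0 sV smin] : exists2 s0, s0 \in V & forall s, s \in V -> #|` s0| <= #|` s|.
  have ex : exists k, has (fun s : {fset nat} => #|` s| == k) (enum_fset V).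
    have /fset0Pn[s sV] : V != fset0 by rewrite -cardfs_gt0 Vn.
    by exists #|` s|; apply/hasP; exists s.
  case: (ex_minnP ex) => k /hasP[s0 sV /eqP <-] kmin; exists s0 => // s sV'.
  by apply: kmin; apply/hasP; exists s.
have sub_min s : s \in V -> s `<=` s0 -> s = s0.
  by move=> sV' ss; apply/eqP; rewrite eqEfcard ss smin.
have [uV' E] := derived_step uV sV sub_min.
apply: stellar_equiv_trans E; apply: IH => //.
by move: Vn; rewrite (cardfsD1 s0) sV add1n => -[].
Qed.

End Derived.

(** * The two halves of the sphere *)

Section Half.
Variables (S : simplex_family) (phi : nat -> nat) (a : nat)
  (lab : {fset nat} -> nat) (Q : simplex_family).
Hypothesis fQ : folded_cone S phi a lab Q.
Implicit Types (s t x y T : {fset nat}).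

Let sS := folded_surface fQ.
Let cS := surface_complex sS.
Let fphi := folded_folding fQ.
Let phiS x : x \in S -> phi @` x \in S. Proof. exact: (folding_in fphi). Qed.

Variable c : {fset nat} -> bool.
Hypotheses (c_phi : forall T, T \in S -> #|` T| = 3 -> c (phi @` T) = ~~ c T)
  (c_adj : forall T T' s, adjacent_triangles S T T' s -> phi @` s != s -> c T = c T').

Definition colored := [fset T in S | (#|` T| == 3) && c T].

Lemma in_half T : (T \in colored) = [&& T \in S, #|` T| == 3 & c T].
Proof. exact: in_filtered. Qed.

Lemma half_phi T : T \in S -> #|` T| = 3 -> ~~ c T -> phi @` T \in colored.
Proof. by move=> TS cT nc; rewrite in_half phiS // (folding_card fQ) // cT c_phi. Qed.

(** No edge at such a vertex is fixed, so [c] never changes within the star. *)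
Lemma star_color v T T' : phi v != v -> T \in S -> T' \in S -> #|` T| = 3 -> #|` T'| = 3 ->
  v \in T -> v \in T' -> c T = c T'.
Proof.
move=> pv; apply: (star_connected sS) => {T T'} T T' s TS T'S cT cT' sT sT' cs vs.
apply: (c_adj (s := s)); first by split.
apply: contra_neq pv => ps.
have [|h _] := folding_fixed fQ (complexS cS sT TS) (fsubset_refl s); first by rewrite ps.
exact: h.
Qed.

Lemma half_cover s : s \in S -> s \in closure_of colored \/ phi @` s \in closure_of colored.
Proof.
move=> sS'; have [T [TS cT sT]] := surface_extend sS sS'.
case nc: (c T); [left|right]; apply/in_closureP.
  by exists T; rewrite // in_half TS cT nc.
by exists (phi @` T); [apply: half_phi; rewrite ?nc|exact: folding_sub].
Qed.

Lemma closure_half_sub s : s \in closure_of colored -> s \in S.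
Proof. by case/in_closureP=> T; rewrite in_half => /and3P[TS _ _] sT; exact: complexS sT TS. Qed.

(** At a vertex that is not fixed all triangles have one colour, but here one would come from the
    half and another from its image. *)
Lemma half_meet s v : s \in closure_of colored -> phi @` s \in closure_of colored -> v \in s ->
    phi v = v.
Proof.
move=> sC; have sS' := closure_half_sub sC.
case/in_closureP: sC => T; rewrite in_half => /and3P[TS /eqP cT kT] sT.
case/in_closureP=> T'; rewrite in_half => /and3P[T'S /eqP cT' kT'] psT' vs.
apply/eqP/negPn/negP => pv.
have pT' := phiS T'S; have cpT' : #|` phi @` T'| = 3 by rewrite (folding_card fQ).
have vT' : v \in phi @` T'.
  rewrite -(folding_vertex fQ sS' vs); apply/imfsetP; exists (phi v) => //=.
  by apply: (fsubsetP psT'); apply/imfsetP; exists v.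
have := star_color pv TS pT' cT cpT' (fsubsetP sT v vs) vT'.
by rewrite kT c_phi // kT'.
Qed.

Lemma half_fixed s : s \in closure_of colored -> phi @` s \in closure_of colored -> phi @` s = s.
Proof.
move=> sC psC; apply/fsetP=> i; apply/imfsetP/idP => [[j /= js ->]|is_].
  by rewrite (half_meet sC psC js).
by exists i; rewrite ?(half_meet sC psC is_).
Qed.

Lemma edge_triangles e T : #|` e| = 2 -> T \in S -> #|` T| = 3 -> e `<=` T -> phi @` e = e ->
  forall U, U \in S -> #|` U| = 3 -> e `<=` U -> U = T \/ U = phi @` T.
Proof.
move=> ce TS cT eT pe U US cU eU.
have [T' [T'S cT' eT' T'T h]] := other_triangle sS TS cT ce eT.
have epT : e `<=` phi @` T by rewrite -pe; exact: folding_sub.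
have cpT : #|` phi @` T| = 3 by rewrite (folding_card fQ).
case: (h _ (phiS TS) cpT epT) => [E|->]; last exact: h.
by case/eqP: (folding_triangle fphi TS cT).
Qed.

Lemma half_deg_fixed e : e \in S -> #|` e| = 2 -> phi @` e = e -> deg colored e = 1.
Proof.
move=> eS ce pe; have [T0 [T0S cT0 eT0]] := surface_extend sS eS.
have [T [TS cT eT kT]] : exists T, [/\ T \in S, #|` T| = 3, e `<=` T & c T].
  case kT: (c T0); first by exists T0.
  exists (phi @` T0); rewrite phiS // (folding_card fQ) // c_phi // kT; split=> //.
  by rewrite -pe; exact: folding_sub.
rewrite /deg (_ : [fset _ in colored | _] = [fset T]) ?cardfs1 //; apply/fsetP=> U.
rewrite in_cofaces in_half inE; apply/idP/eqP => [/andP[/and3P[US /eqP cU kU] eU]|->].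
  case: (edge_triangles ce TS cT eT pe US cU eU) => // UE.
  by move: kU; rewrite UE c_phi // kT.
by rewrite TS cT kT eT.
Qed.

Lemma half_deg e : #|` e| = 2 -> deg colored e <= 2 /\ (deg colored e = 1 -> e \in S /\ phi @`
    e = e).
Proof.
move=> ce; case: (posnP (deg colored e)) => [->//|/deg_gt0P[T]].
rewrite in_half => /and3P[TS /eqP cT kT] eT; have eS := complexS cS eT TS.
have [pe|pe] := eqVneq (phi @` e) e; first by rewrite half_deg_fixed.
have [T' [T'S cT' eT' T'T h]] := other_triangle sS TS cT ce eT.
suff -> : deg colored e = 2 by [].
rewrite /deg (_ : [fset _ in colored | _] = [fset T; T']); first by rewrite cardfs2 eq_sym T'T.
apply/fsetP=> U; rewrite in_cofaces in_half in_fset2; apply/idP/idP.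
  by case/andP=> /and3P[US /eqP cU _] eU; case: (h U US cU eU) => ->; rewrite eqxx ?orbT.
have kT' : c T' by rewrite -(c_adj (T := T) (s := e)) //; split.
by case/orP=> /eqP->; rewrite ?TS ?T'S ?cT ?cT' ?eT ?eT' ?kT ?kT'.
Qed.

(** Reflection extends a colouring of the half to the sphere: at a fixed edge the two triangles are
    mirror images with equal values. Connectedness of [S] and its stars is thus inherited by the
    half. *)
Lemma extend_half (P : {fset nat} -> Prop) (k : {fset nat} -> bool) :
  (forall s, s \in S -> P s -> P (phi @` s)) ->
  (forall T T' e, T \in colored -> T' \in colored -> e `<=` T -> e `<=` T' -> #|` e| = 2 ->
    P e -> k T = k T') ->
  let k' T := if c T then k T else k (phi @` T) in
  forall T T' e, T \in S -> T' \in S -> #|` T| = 3 -> #|` T'| = 3 ->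
    e `<=` T -> e `<=` T' -> #|` e| = 2 -> P e -> k' T = k' T'.
Proof.
move=> Pphi hk k' T T' e TS T'S cT cT' eT eT' ce Pe; rewrite /k'.
have eS := complexS cS eT TS.
have [pe|pe] := eqVneq (phi @` e) e.
  case: (edge_triangles ce TS cT eT pe T'S cT' eT') => -> //.
  by rewrite c_phi // (foldingK fQ) //; case: (c T).
rewrite -(c_adj (T := T) (T' := T') (s := e)) //.
have kE : c T = c T' by apply: (c_adj (s := e)).
case kT: (c T).
  by apply: (hk _ _ e); rewrite // in_half ?TS ?T'S ?cT ?cT' -?kE kT.
apply: (hk _ _ (phi @` e)); rewrite ?half_phi ?folding_sub ?(folding_card fQ) -?kE ?kT //.
exact: Pphi.
Qed.

(** Without a fixed edge [c] would be constant on [S], although [phi] negates it. *)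
Lemma half_disc_nonempty : exists2 e, #|` e| = 2 & deg colored e = 1.
Proof.
apply: contrapT => h; have [v vS] := surface_nonempty sS.
have [T [TS cT _]] := surface_extend sS vS.
have : c T = c (phi @` T).
  apply: (strongly_connected sS) => //; rewrite ?phiS ?(folding_card fQ) //.
  move=> U U' s US U'S cU cU' sU sU' cs; apply: (c_adj (s := s)); first by split.
  apply/eqP => ps; apply: h; exists s => //.
  by apply: half_deg_fixed => //; exact: complexS sU US.
by rewrite c_phi //; case: (c T).
Qed.

Lemma half_disc : disc colored.
Proof.
split.
- by move=> T; rewrite in_half => /and3P[_ /eqP].
- by move=> e /half_deg[].
- move=> v k hk T T'; rewrite !in_half => /and3P[TS /eqP cT kT] /and3P[T'S /eqP cT' kT'] vT vT'.
  have [pv|pv] := eqVneq (phi v) v.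
    have Pphi s : s \in S -> v \in s -> v \in phi @` s.
      by move=> _ vs; apply/imfsetP; exists v.
    have := star_connected sS (extend_half Pphi hk) TS T'S cT cT' vT vT'.
    by rewrite /= kT kT'.
  pose k' U := if U \in colored then k U else true.
  have : k' T = k' T'.
    apply: (star_connected sS (v := v)) => // U U' s US U'S cU cU' sU sU' cs vs.
    have inh W : W \in S -> #|` W| = 3 -> v \in W -> W \in colored.
      by move=> WS cW vW; rewrite in_half WS cW -(star_color pv TS WS).
    have UH := inh U US cU (fsubsetP sU v vs); have U'H := inh U' U'S cU' (fsubsetP sU' v vs).
    by rewrite /k' UH U'H; apply: (hk _ _ s).
  by rewrite /k' !in_half TS T'S cT cT' kT kT'.
- move=> k hk T T'; rewrite !in_half => /and3P[TS /eqP cT kT] /and3P[T'S /eqP cT' kT'].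
  have hk' U U' e : U \in colored -> U' \in colored -> e `<=` U -> e `<=` U' -> #|` e| = 2 ->
    True -> k U = k U' by move=> ? ? ? ? ? _; apply: (hk _ _ e).
  have E := extend_half (P := fun=> True) (fun _ _ _ => I) hk'.
  have := strongly_connected sS (fun U U' s a b i j l m n => E U U' s a b i j l m n I) TS T'S
      cT cT'.
  by rewrite /= kT kT'.
- have C_v t v : t \in closure_of colored -> v \in t -> [fset v] \in closure_of colored.
    case/in_closureP=> T TD tT vt; apply/in_closureP; exists T => //.
    by rewrite fsub1set (fsubsetP tT).
  (* Folding by [phi] is a simplicial retraction of the sphere onto the half; a cocycle is pulled
     back along it and acquires a potential on [S]. *)
  move=> g gD; pose r v := if [fset v] \in closure_of colored then v else phi v.
  have rC t : t \in closure_of colored -> r @` t = t.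
    move=> tC; have rt v : v \in t -> r v = v by move=> vt; rewrite /r (C_v t).
    apply/fsetP=> i; apply/imfsetP/idP => [[j /= jt ->]|it]; first by rewrite rt.
    by exists i; rewrite ?rt.
  have rS t : t \in S -> r @` t \in closure_of colored.
    move=> tS; have [tC|ptC] := half_cover tS; first by rewrite rC.
    rewrite (_ : r @` t = phi @` t) //.
    have rt v : v \in t -> r v = phi v.
      move=> vt; rewrite /r; case: ifP => // vC; rewrite (half_meet vC) ?inE //.
      by rewrite image_fset1; apply: C_v ptC _; apply/imfsetP; exists v.
    by apply/fsetP=> i; apply/imfsetP/imfsetP => -[j /= jt ->]; exists j; rewrite ?rt.
  have : acyclic 3 S by have := surface_acyclic sS (complex0 cS); rewrite cardfs0 link0.
  case=> _ hS; have [|f fE] := hS (fun u w => g (r u) (r w)).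
    by move=> u v w /rS; rewrite image_fset3; exact: gD.
  exists f => u w uw; rewrite -fE; last exact: closure_half_sub.
  by rewrite /r !(C_v _ _ uw) ?inE ?eqxx ?orbT.
exact: half_disc_nonempty.
Qed.

(** A fixed edge has one triangle in each half, hence is a boundary edge. Fixed vertices lie on such
    edges because none of them is isolated. *)
Lemma half_boundary : (forall i, [fset i] \in Q -> H1 (link Q [fset i])) ->
  forall s, s \in boundary colored <-> s \in S /\ phi @` s = s.
Proof.
move=> HL s; split=> [/in_boundaryP[e [ce de se]]|[sS' ps]].
  have [_ /(_ de)[eS pe]] := half_deg ce; split; first exact: complexS se eS.
  have [|h _] := folding_fixed fQ eS (fsubset_refl e); first by rewrite pe.
  apply/fsetP=> i; apply/imfsetP/idP => [[j /= js ->]|is_]; first by rewrite h ?(fsubsetP se).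
  by exists i; rewrite // h ?(fsubsetP se).
have fix_edge e : e \in S -> #|` e| = 2 -> phi @` e = e -> s `<=` e -> s \in boundary colored.
  by move=> eS ce pe se; apply/in_boundaryP; exists e; rewrite half_deg_fixed.
have := surface_card sS sS'; case E: #|` s| => [|[|[|[|//]]]] _.
- move/eqP: E; rewrite cardfs_eq0 => /eqP->.
  have [e ce de] := half_disc_nonempty; apply/in_boundaryP; exists e; split=> //.
- move/eqP: E => /cardfs1P[v sE]; rewrite sE image_fset1 in ps.
  have pv : phi v = v by have := fset11 (phi v); rewrite ps inE => /eqP.
  have [|w [wv vwS pw]] := no_isolated_fixed fQ HL _ pv.
    by apply/in_verticesP; exists s; rewrite // sE inE.
  apply: (fix_edge _ vwS); rewrite ?cardfs2 1?eq_sym ?wv ?image_fset2 ?pv ?pw //.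
  by rewrite sE fsub1set !inE eqxx.
- exact: (fix_edge s).
by have := folding_triangle fphi sS' E; rewrite ps eqxx.
Qed.

End Half.

(** * The folded cone as a union of two balls *)

Section FoldedSphere.
Variables (S : simplex_family) (phi : nat -> nat) (a b : nat)
  (lab : {fset nat} -> nat) (Q : simplex_family).
Hypothesis fQ : folded_cone S phi a lab Q.
Implicit Types (s t x y : {fset nat}) (l : nat).

Let sS := folded_surface fQ.
Let cS := surface_complex sS.
Let fphi := folded_folding fQ.
Let aS := folded_apex fQ.
Let phiS x : x \in S -> phi @` x \in S. Proof. exact: (folding_in fphi). Qed.

Variable c : {fset nat} -> bool.
Hypotheses (c_phi : forall T, T \in S -> #|` T| = 3 -> c (phi @` T) = ~~ c T)
  (c_adj : forall T T' s, adjacent_triangles S T T' s -> phi @` s != s -> c T = c T')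
  (HL : forall i, [fset i] \in Q -> H1 (link Q [fset i]))
  (ab : a != b) (bS : b \notin vertices S)
  (fresh : forall x, x \in cone a S -> x != fset0 -> lab x \notin a |` (b |` vertices S)).

Let C := closure_of (colored S c).
Let d := boundary (colored S c).

Let sh : shell C d.
Proof. exact/shelling_shell/disc_shelling/(half_disc fQ c_phi c_adj). Qed.

Let CS s : s \in C -> s \in S. Proof. exact: (closure_half_sub fQ). Qed.
Let dP s : s \in d <-> s \in S /\ phi @` s = s.
Proof. exact: (half_boundary fQ c_phi c_adj HL). Qed.
Let C_closed s t : s \in C -> t `<=` s -> t \in C.
Proof. by have [h _] := shell_closed sh; exact: h. Qed.
Let d_closed s t : s \in d -> t `<=` s -> t \in d.
Proof. by have [_ [h _]] := shell_closed sh; exact: h. Qed.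
Let dC s : s \in d -> s \in C.
Proof. by have [_ [_ h]] := shell_closed sh; exact: h. Qed.
Let Ca s : s \in C -> a \notin s. Proof. by move/CS; exact: (a_notin aS). Qed.
Let Cb s : s \in C -> b \notin s. Proof. by move/CS; exact: vertices_notin. Qed.
Let both s : s \in C -> phi @` s \in C -> s \in d.
Proof. by move=> sC psC; apply/dP; split; [exact: CS|exact: (half_fixed fQ c_phi c_adj)]. Qed.
Let cover s : s \in S -> s \in C \/ phi @` s \in C.
Proof. exact: (half_cover fQ c_phi). Qed.
Let C_fset0 : fset0 \in C.
Proof.
have [h|] := cover (complex0 cS); first by [].
by move=> h; exact: C_closed h (fsub0set _).
Qed.
Let cC : is_complex C. Proof. by split=> [|s sC t]; [|exact: C_closed]. Qed.
Let aC : a \notin vertices C.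
Proof. by apply/negP => /in_verticesP[s /Ca/negP]. Qed.

(** The simplexes of the second cone are indexed by [C] through [phi], which makes both cones
    comparable over the same disc. *)
Let top s := a |` phi @` s.
Let I : simplex_family := [fset s in C | s \notin d].
Let inI s : (s \in I) = (s \in C) && (s \notin d). Proof. exact: in_filtered. Qed.
(** The cells without a representative in the first cone: those of [a u phi s] with [s] interior to
    the disc. For [s] in [d] both cones share the cell. *)
Let U := [fset lab (top s) | s in I].
Let B := cone a C.
Let inB t : (t \in B) = (t `\ a \in C). Proof. exact: in_cone. Qed.
Let cB : is_complex B. Proof. by apply: join_complex => //; exact: simplex_complex. Qed.
Let W : simplex_family := [fset t in B | t != fset0].
Let inW t : (t \in W) = (t \in B) && (t != fset0). Proof. exact: in_filtered. Qed.
Let Bcone t : t \in B -> t \in cone a S.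
Proof. by rewrite inB (coneE sS aS) => /CS. Qed.
Let BC t : t \in B -> a \notin t -> t \in C.
Proof. by rewrite inB => tC at_; rewrite -(fsetD1_notin at_). Qed.
Let addaK s : a \notin s -> (a |` s) `\ a = s.
Proof. by move=> as_; rewrite fsetU1K. Qed.

Let topcone s : s \in S -> top s \in cone a S.
Proof. by move=> sS'; apply: (cone_a sS aS); exact: phiS. Qed.
Let a1 s : a |` s != fset0. Proof. by apply/fset0Pn; exists a; rewrite fset1U1. Qed.
Let aphi s : s \in S -> a \notin phi @` s. Proof. by move=> sS'; apply: (a_notin aS); exact:
    phiS. Qed.

Let lab_top s x : s \in S -> x \in cone a S -> lab x = lab (top s) -> x = top s.
Proof.
move=> sS' xC E; have [//|[tS _]] := (folded_label fQ (topcone sS') (a1 _) xC).1 (esym E).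
by have := a_notin aS tS; rewrite fset1U1.
Qed.

Let top_inj s s' : s \in S -> s' \in S -> top s = top s' -> s = s'.
Proof.
move=> sS' s'S E; rewrite -(foldingK fQ sS') -(foldingK fQ s'S); congr (_ @` _).
by rewrite -(addaK (aphi sS')) -/(top s) E addaK // aphi.
Qed.

(** The first cone embeds into the quotient: simplexes of [C] that are exchanged by [phi] lie in [d]
    and are therefore fixed. *)
Let lab_W s t : s \in W -> t \in B -> lab s = lab t -> t = s.
Proof.
rewrite inW => /andP[sB s0] tB; case/(folded_label fQ (Bcone sB) s0 (Bcone tB)) => // -[sS' tE].
have sC : s \in C by apply: BC => //; exact: (a_notin aS).
have tC : t \in C by apply: BC => //; rewrite tE aphi.
by rewrite tE; have /dP[] : s \in d by apply: both; rewrite -?tE.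
Qed.

Let not_top s t : s \in I -> t \in B -> lab t <> lab (top s).
Proof.
rewrite inI => /andP[sC sd] tB E; have sS' := CS sC.
have tE := lab_top sS' (Bcone tB) E; move: tB; rewrite tE inB addaK ?aphi // => psC.
by case/negP: sd; exact: both.
Qed.

Let cmp l l' := `[< exists x y, [/\ x \in cone a S, y \in cone a S, x != fset0, x `<=` y &
  (lab x = l /\ lab y = l') \/ (lab x = l' /\ lab y = l)] >].

Let cmpC l l' : cmp l l' = cmp l' l.
Proof.
by apply/asboolP/asboolP => -[x [y [xC yC x0 xy h]]]; exists x, y; split=> //;
  case: h; [right|left|right|left].
Qed.

Let cmpI x y : x \in cone a S -> y \in cone a S -> x != fset0 -> x `<=` y -> cmp (lab x) (lab y).
Proof. by move=> xC yC x0 xy; apply/asboolP; exists x, y; split=> //; left. Qed.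

Let cmp_lab_half s t x y : s \in W -> t \in W -> x \in cone a S -> y \in cone a S ->
  x != fset0 -> x `<=` y -> lab x = lab s -> lab y = lab t -> s `<=` t.
Proof.
rewrite !inW => /andP[sB s0] /andP[tB t0] xC yC x0 xy Ex Ey.
have y0 := sub_neq0 x0 xy.
case: ((folded_label fQ xC x0 (Bcone sB)).1 Ex) => [sE|[xS sE]];
  case: ((folded_label fQ yC y0 (Bcone tB)).1 Ey) => [tE|[yS tE]].
- by rewrite sE tE.
- have xS := complexS cS xy yS; have tC : t \in C by apply: BC => //; rewrite tE aphi.
  have sC : s \in C by apply: BC => //; rewrite sE (a_notin aS).
  have /dP[_ ps] : s \in d.
    by apply: both => //; apply: C_closed tC _; rewrite tE sE; exact: folding_sub.
  by rewrite -ps sE tE; exact: folding_sub.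
- have sC : s \in C by apply: BC => //; rewrite sE aphi.
  have xyt : x `<=` t `\ a by rewrite tE fsubsetD1 xy (a_notin aS).
  have xC' : x \in C by apply: C_closed xyt; rewrite -inB.
  have /dP[_ px] : x \in d by apply: both; rewrite -?sE.
  by rewrite sE px tE.
by rewrite sE tE; exact: folding_sub.
Qed.

(** Incidence of a simplex of the first cone with a cell. A cell of the second cone meets the first
    one only in [C u a * d], which is the reason for the last clause. *)
Let le1 t l := `[< (exists2 s, s \in W & l = lab s /\ t `<=` s) \/
  exists s, [/\ s \in I, l = lab (top s), t `\ a `<=` s & a \in t -> t `\ a \in d] >].

Let le1_mono s t l : s `<=` t -> le1 t l -> le1 s l.
Proof.
move=> st /asboolP[[u uW [lE tu]]|[u [uI lE tu td]]]; apply/asboolP.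
  by left; exists u => //; split=> //; exact: fsubset_trans tu.
have stD : s `\ a `<=` t `\ a by exact: fsetSD.
right; exists u; split=> //; first exact: fsubset_trans tu.
by move/(fsubsetP st)/td => h; exact: d_closed stD.
Qed.

Let le1_lab s t : s \in B -> t \in W -> le1 s (lab t) = (s `<=` t).
Proof.
move=> sB tW; have tB : t \in B by move: tW; rewrite inW => /andP[].
apply/asboolP/idP => [[[u uW [lE su]]|[u [uI lE _ _]]]|st].
- by move: uW (uW); rewrite {1}inW => /andP[uB _] uW; rewrite -(lab_W tW uB lE).
- by case: (not_top uI tB lE).
by left; exists t.
Qed.

Let le1_top s t : s \in I -> le1 t (lab (top s)) <-> t `\ a `<=` s /\ (a \in t -> t `\ a \in d).
Proof.
move=> sI; have sS' : s \in S by move: sI; rewrite inI => /andP[/CS].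
split=> [/asboolP[[u uW [lE _]]|[u [uI lE tu td]]]|[ts td]].
- move: uW; rewrite inW => /andP[uB _]; by case: (not_top sI uB (esym lE)).
- have uS : u \in S by move: uI; rewrite inI => /andP[/CS].
  by have /(top_inj sS' uS)-> := lab_top uS (topcone sS') lE.
by apply/asboolP; right; exists s.
Qed.

Let cmp_W s t : s \in W -> t \in W -> cmp (lab s) (lab t) = (s `<=` t) || (t `<=` s).
Proof.
move=> sW tW; have [[sB s0] [tB t0]] : (s \in B /\ s != fset0) /\ (t \in B /\ t != fset0).
  by split; apply/andP; rewrite -inW.
apply/idP/orP => [/asboolP[x [y [xC yC x0 xy [[Ex Ey]|[Ex Ey]]]]]|[st|ts]].
- by left; exact: cmp_lab_half Ex Ey.
- by right; exact: cmp_lab_half Ex Ey.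
- by apply: cmpI => //; exact: Bcone.
by rewrite cmpC; apply: cmpI => //; exact: Bcone.
Qed.

Let cmp_top s t : s \in W -> t \in I -> cmp (lab s) (lab (top t)) = le1 s (lab (top t)).
Proof.
move=> sW tI; have [sB s0] : s \in B /\ s != fset0 by apply/andP; rewrite -inW.
have [tC td] : t \in C /\ t \notin d by apply/andP; rewrite -inI.
have tS := CS tC; have sDC : s `\ a \in C by rewrite -inB.
apply/idP/idP => [/asboolP[x [y [xC yC x0 xy [[Ex Ey]|[Ex Ey]]]]]|/(le1_top _ tI)[st sd]].
- have yE := lab_top tS yC Ey; apply/le1_top => //.
  case: ((folded_label fQ xC x0 (Bcone sB)).1 Ex) => [sE|[xS sE]].
    have sp : s `\ a `<=` phi @` t by rewrite fsubDset -/(top t) -yE sE.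
    have psC : phi @` (s `\ a) \in C.
      apply: (C_closed tC); rewrite -[t](foldingK fQ tS); exact: folding_sub.
    have sdd := both sDC psC; split=> //.
    by have /dP[_ <-] := sdd; rewrite -[t](foldingK fQ tS); exact: folding_sub.
  have as_ : a \notin s by rewrite sE aphi.
  rewrite fsetD1_notin // (negbTE as_); split=> //; rewrite sE -[t](foldingK fQ tS).
  apply: folding_sub; have : x `<=` y `\ a by rewrite fsubsetD1 xy (a_notin aS).
  by rewrite yE addaK // aphi.
- have xE := lab_top tS xC Ex; have ay : a \in y by apply: (fsubsetP xy); rewrite xE fset1U1.
  have y0 := sub_neq0 x0 xy.
  case: ((folded_label fQ yC y0 (Bcone sB)).1 Ey) => [sE|[yS _]]; last first.
    by have := a_notin aS yS; rewrite ay.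
  case/negP: td; apply: both => //; apply: C_closed sDC _.
  by rewrite sE fsubsetD1 aphi // andbT; apply: fsubset_trans xy; rewrite xE fsubsetU1.
have [as_|as_] := boolP (a \in s).
  have /dP[_ ps] := sd as_; apply: cmpI (Bcone sB) (topcone tS) s0 _.
  by rewrite -fsubDset -ps; exact: folding_sub.
have sC := BC sB as_; rewrite fsetD1_notin // in st.
have -> : lab s = lab (phi @` s).
  by apply/(folded_label fQ (Bcone sB) s0); [apply/(cone_S sS aS)/phiS/CS|right; split=> //;
      exact: CS].
apply: cmpI; rewrite ?topcone //; first by apply/(cone_S sS aS)/phiS/CS.
  by rewrite -cardfs_gt0 (folding_card fQ) ?cardfs_gt0 //; exact: CS.
apply: fsubset_trans (fsubsetU1 _ _); exact: folding_sub.
Qed.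

Let vB i : i \in vertices B -> i \in a |` (b |` vertices S).
Proof.
case/in_verticesP=> t /Bcone; rewrite (coneE sS aS) => tS it; rewrite !in_fset1U.
case: eqVneq => //= ia; apply/orP; right; apply/in_verticesP; exists (t `\ a) => //.
by rewrite in_fsetD1 ia.
Qed.

Let lab_fresh x : x \in cone a S -> x != fset0 -> lab x \notin vertices B.
Proof. by move=> xC x0; apply: contra (fresh xC x0); exact: vB. Qed.

Let U_P l : l \in U -> exists2 s, s \in I & l = lab (top s).
Proof. by case/imfsetP=> s /= sI ->; exists s. Qed.

Let U_top s : s \in I -> lab (top s) \in U. Proof. by move=> sI; apply/imfsetP; exists s. Qed.

Let IS s : s \in I -> s \in S. Proof. by rewrite inI => /andP[/CS]. Qed.

Let derived_cone : stellar_equiv (derived B U lab cmp le1 fset0) (derived B U lab cmp le1 W).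
Proof.
apply: derived_equiv => //.
- by apply/fsubsetP=> t; rewrite inW => /andP[].
- by rewrite inW eqxx andbF.
- move=> s t; rewrite !inW => /andP[_ s0] tB st; rewrite tB; exact: sub_neq0 st.
- by move=> s; rewrite inW => /andP[/Bcone sC s0]; exact: lab_fresh.
- move=> s; rewrite inW => /andP[sB _]; apply/negP => /U_P[t tI]; exact: not_top.
- move=> s t sW tW E; apply/esym/(lab_W sW) => //; by move: tW; rewrite inW => /andP[].
by move=> s l sW /U_P[t tI ->]; exact: cmp_top.
Qed.

Let derived_cone_Q : derived B U lab cmp le1 W = Q.
Proof.
apply/fsetP=> t; apply/idP/idP => [/in_derived[h1 h2 h3]|tQ].
  have t0 : t `&` vertices B = fset0.
    by apply/eqP; move: h2; rewrite inW h1 /= negbK.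
  have nB l : l \in t -> l \notin vertices B.
    by move=> lt; apply/negP => lB; have := in_fset0 l; rewrite -t0 in_fsetI lt lB.
  apply/(folded_simplex fQ); split=> [i it|i j it jt].
    have [[/U_P[s sI ->]|[s + ->]] _ _] := h3 i it (nB i it).
      by exists (top s); split; [exact/topcone/IS|exact: a1|].
    by rewrite inW => /andP[/Bcone sC s0]; exists s.
  have [_ _ h] := h3 i it (nB i it).
  by have /asboolP := h j jt (nB j jt).
have [h1 h2] := (folded_simplex fQ t).1 tQ.
have nB l : l \in t -> l \notin vertices B.
  by case/h1=> x [xC x0 <-]; exact: lab_fresh.
have t0 : t `&` vertices B = fset0.
  by apply/fsetP=> l; rewrite in_fsetI in_fset0; apply/negP => /andP[/nB/negP].
apply/in_derived; rewrite t0 inW eqxx andbF; split=> //; first exact: complex0.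
move=> l lt _; have [x [xC x0 lE]] := h1 l lt.
have lev s : s \in W -> le1 fset0 (lab s).
  by move=> sW; rewrite le1_lab ?fsub0set //; exact: complex0.
(* Up to [phi] every cell has a representative in the first cone or is the [top] of an interior
   simplex. *)
have key : (exists2 s, s \in W & l = lab s) \/ exists2 s, s \in I & l = lab (top s).
  have xS : x `\ a \in S by rewrite -(coneE sS aS).
  have [xaC|pxC] := cover xS; first by left; exists x; rewrite ?inW ?inB ?xaC.
  have [ax|ax] := boolP (a \in x); last first.
    rewrite fsetD1_notin // in pxC xS; left; exists (phi @` x).
      by rewrite inW inB fsetD1_notin ?aphi // pxC -cardfs_gt0 (folding_card fQ) ?cardfs_gt0.
    rewrite -lE; apply/(folded_label fQ xC x0); [exact/(cone_S sS aS)/phiS|by right].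
  have [pd|pd] := boolP (phi @` (x `\ a) \in d).
    left; exists x => //; rewrite inW inB x0 andbT.
    by have /dP[_] := pd; rewrite (foldingK fQ) // => ->; exact: dC.
  right; exists (phi @` (x `\ a)); first by rewrite inI pxC.
  by rewrite /top (foldingK fQ) // fsetD1K.
split.
- case: key => [[s sW ->]|[s sI ->]]; [by right; exists s|left; exact: U_top].
- case: key => [[s sW ->]|[s sI ->]]; first exact: lev.
  by apply/le1_top => //; rewrite fset0D fsub0set.
by move=> l' l't _; apply/asboolP; exact: h2.
Qed.

Let N := two_cones C d a b.
Let inN t : (t \in N) = (t `\ b `\ a \in C) && ((a \in t) && (b \in t) ==> (t `\ b `\ a \in d)).
Proof. exact: in_two_cones. Qed.
Let cN : is_complex N.
Proof. by apply: two_cones_complex sh _; apply/fset0Pn; exists fset0. Qed.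
(** The simplexes interior to the ball [a * C] in the union of two balls. Starring them with the
    labels of [U] rebuilds the second cone, this time over [C] itself. *)
Let W2 : simplex_family := [fset a |` s | s in I].
Let W2P t : t \in W2 <-> exists2 s, s \in I & t = a |` s.
Proof. by split=> [/imfsetP[s /= sI ->]|[s sI ->]]; [exists s|apply/imfsetP; exists s]. Qed.
Let lab2 t := lab (top (t `\ a)).
Let le2 t l := `[< exists s, [/\ s \in I, l = lab (top s) & t `<=` a |` s] >].

Let IC s : s \in I -> s \in C. Proof. by rewrite inI => /andP[]. Qed.
Let Id s : s \in I -> s \notin d. Proof. by rewrite inI => /andP[]. Qed.
Let lab2E s : s \in I -> lab2 (a |` s) = lab (top s).
Proof. by move=> sI; rewrite /lab2 addaK // Ca // IC. Qed.
Let lab_top_inj s t : s \in I -> t \in I -> lab (top s) = lab (top t) -> s = t.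
Proof.
by move=> /IS sI /IS tI E; apply: top_inj => //; exact: lab_top tI (topcone sI) E.
Qed.
Let bW2 s : s \in I -> b \notin a |` s.
Proof. by move=> sI; rewrite in_fset1U eq_sym (negbTE ab) Cb // IC. Qed.
Let nb t : b \notin t -> t `\ b = t. Proof. exact: fsetD1_notin. Qed.

Let le2_top s t : s \in I -> le2 t (lab (top s)) = (t `<=` a |` s).
Proof.
move=> sI; apply/asboolP/idP => [[u [uI E tu]]|ts]; last by exists s.
by rewrite (lab_top_inj sI uI E).
Qed.

Let cmp_top2 s t : s \in I -> t \in I -> cmp (lab (top s)) (lab (top t)) = (s `<=` t) || (t
    `<=` s).
Proof.
move=> sI tI; have sS' := IS sI; have tS := IS tI.
have half s' t' x y : s' \in I -> t' \in I -> x \in cone a S -> y \in cone a S -> x `<=` y ->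
    lab x = lab (top s') -> lab y = lab (top t') -> s' `<=` t'.
  move=> /IS s'S /IS t'S xC yC xy Ex Ey.
  have xE := lab_top s'S xC Ex; have yE := lab_top t'S yC Ey.
  rewrite -[s'](foldingK fQ s'S) -[t'](foldingK fQ t'S); apply: folding_sub.
  rewrite -(addaK (aphi s'S)) -(addaK (aphi t'S)); apply: fsetSD.
  by rewrite -/(top s') -/(top t') -xE -yE.
have top_sub s' t' : s' `<=` t' -> top s' `<=` top t'.
  by move=> st; apply: fsetUS; exact: folding_sub.
apply/idP/orP => [/asboolP[x [y [xC yC x0 xy [[Ex Ey]|[Ex Ey]]]]]|[st|ts]].
- by left; apply: half Ex Ey.
- by right; apply: half Ex Ey.
- by apply: cmpI; rewrite ?topcone ?top_sub ?a1.
by rewrite cmpC; apply: cmpI; rewrite ?topcone ?top_sub ?a1.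
Qed.

Let vN i : i \in vertices N = (i == b) || (i \in vertices B).
Proof.
apply/in_verticesP/idP => [[t]|/orP[/eqP->|/in_verticesP[t tB it]]].
- rewrite inN => /andP[tC _] it; have [//|ib] := eqVneq i b; rewrite /=.
  by apply/in_verticesP; exists (t `\ b); rewrite ?inB // in_fsetD1 ib.
- exists [fset b]; last by rewrite inE.
  have -> : [fset b] \in N; last by [].
  by rewrite inN fsetDv fset0D C_fset0 /= inE (negbTE ab).
have bt : b \notin t.
  apply/negP => bt; have := Bcone tB; rewrite (coneE sS aS) => /(vertices_notin bS).
  by rewrite in_fsetD1 eq_sym ab bt.
by exists t => //; rewrite inN nb // (negbTE bt) andbF andbT -inB.
Qed.

Let lab_freshN s : s \in I -> lab (top s) \notin vertices N.
Proof.
move=> sI; rewrite vN negb_or lab_fresh ?a1 ?topcone ?IS // andbT.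
apply: contraNneq (fresh (topcone (IS sI)) (a1 _)) => ->.
by rewrite !in_fset1U eqxx orbT.
Qed.

Let derived_two_cones : stellar_equiv (derived N fset0 lab2 cmp le2 fset0) (derived N fset0
    lab2 cmp le2 W2).
Proof.
apply: derived_equiv => //.
- apply/fsubsetP=> t /W2P[s sI ->].
  by rewrite inN nb ?bW2 // addaK ?Ca ?IC // (negbTE (bW2 sI)) andbF.
- by apply/negP => /W2P[s _ /esym/eqP]; rewrite (negbTE (a1 s)).
- move=> _ t /W2P[s sI ->]; rewrite inN => /andP[tC td] st.
  have at_ : a \in t by apply: (fsubsetP st); rewrite fset1U1.
  have sub : s `<=` t `\ b `\ a.
    by rewrite !fsubsetD1 Cb ?Ca ?IC // !andbT; apply: fsubset_trans st; exact: fsubsetU1.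
  have nd : t `\ b `\ a \notin d by apply: contra (Id sI) => h; exact: d_closed sub.
  have bt : b \notin t by apply: contra nd => bt; apply: (implyP td); rewrite at_ bt.
  rewrite nb // in tC nd; apply/W2P; exists (t `\ a); first by rewrite inI tC nd.
  by rewrite fsetD1K.
- by move=> _ /W2P[s sI ->]; rewrite lab2E // lab_freshN.
- move=> _ _ /W2P[s sI ->] /W2P[t tI ->]; rewrite !lab2E // => E.
  by rewrite (lab_top_inj sI tI E).
- move=> s t l st /asboolP[u [uI lE tu]]; apply/asboolP; exists u; split=> //.
  exact: fsubset_trans tu.
- by move=> s _ sN /W2P[t tI ->]; rewrite lab2E // le2_top.
move=> _ _ /W2P[s sI ->] /W2P[t tI ->]; rewrite !lab2E // cmp_top2 //.
have aux s' t' : s' \in I -> (a |` s' `<=` a |` t') = (s' `<=` t').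
  move=> s'I; apply/idP/idP => [h|]; last exact: fsetUS.
  apply/fsubsetP=> i is'; have := fsubsetP h i; rewrite !in_fset1U is' orbT => /(_ isT).
  by case: eqVneq is' => // ->; rewrite (negbTE (Ca (IC s'I))).
by rewrite !aux.
Qed.

Let derived_two_cones0 : derived N fset0 lab2 cmp le2 fset0 = N.
Proof.
apply/fsetP=> t; apply/idP/idP => [/in_derived[h1 h2 h3]|tN].
  suff -> : t = t `&` vertices N by [].
  apply/esym/fsetIidPl/fsubsetP=> l lt; apply/negPn/negP => lN.
  have [[l0|[s s0]] _ _] := h3 l lt lN; first by rewrite in_fset0 in l0.
  by rewrite in_fset0 in s0.
have tE : t `&` vertices N = t.
  by apply/fsetIidPl/fsubsetP=> l lt; apply/in_verticesP; exists t.
apply/in_derived; rewrite tE tN in_fset0; split=> // l lt /negP[].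
by apply/in_verticesP; exists t.
Qed.

Let F := derived B U lab cmp le1 fset0.
Let F_P t : t \in F <-> [/\ t `&` vertices B \in B & forall l, l \in t -> l \notin vertices B ->
  [/\ l \in U, le1 (t `&` vertices B) l & forall l', l' \in t -> l' \notin vertices B -> cmp l
      l']].
Proof.
split=> [/in_derived[h1 _ h3]|[h1 h3]].
  split=> // l lt lB; have [[lU|[s s0]] h4 h5] := h3 l lt lB; first by split.
  by rewrite in_fset0 in s0.
apply/in_derived; rewrite in_fset0; split=> // l lt lB; have [h4 h5 h6] := h3 l lt lB.
by split=> //; left.
Qed.

Let tB_id t : t \in B -> t `&` vertices B = t.
Proof. by move=> tB; apply/fsetIidPl/fsubsetP=> l lt; apply/in_verticesP; exists t. Qed.

Let B_F t : t \in B -> t \in F.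
Proof.
move=> tB; apply/F_P; rewrite tB_id //; split=> // l lt /negP[].
by apply/in_verticesP; exists t.
Qed.

(** What remains of [F] without the interior of the first ball, that is, without the simplexes
    [a u s] with [s] interior to the disc. It contains the second ball and the common boundary. *)
Let Y : simplex_family := [fset t in F | (a \in t) ==> ((t `&` vertices B) `\ a \in d)].
Let inY t : (t \in Y) = (t \in F) && ((a \in t) ==> ((t `&` vertices B) `\ a \in d)).
Proof. exact: in_filtered. Qed.

Let aB : a \in vertices B.
Proof.
apply/in_verticesP; exists [fset a]; last by rewrite inE.
by rewrite inB fsetDv.
Qed.

Let bB : b \notin vertices B.
Proof.
apply/negP => /in_verticesP[t /Bcone]; rewrite (coneE sS aS) => /(vertices_notin bS).
by rewrite in_fsetD1 eq_sym ab /= => /negbTE->.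
Qed.

Let bF t : t \in F -> b \notin t.
Proof.
case/F_P=> _ h; apply/negP => bt; have [/U_P[s sI bE] _ _] := h b bt bB.
have := fresh (topcone (IS sI)) (a1 _); rewrite -/(top s) -bE !in_fset1U eqxx.
by rewrite orbT.
Qed.

Let cF : is_complex F.
Proof.
apply: (derived_complex (W := W)) => //; first by rewrite inW eqxx andbF.
Qed.

(* The chains of labels in [U] triangulate the interior of the second ball; they
   are the same on both sides of the equivalence. *)
Let absorb_half : stellar_equiv F (derived N fset0 lab2 cmp le2 W2).
Proof.
have cY : is_complex Y.
  split; first by rewrite inY in_fset0 complex0.
  move=> s; rewrite inY => /andP[sF sd] t ts; rewrite inY (complexS cF ts sF) /=.
  apply/implyP => /(fsubsetP ts) as_; apply: (d_closed (implyP sd as_)).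
  by apply: fsetSD; exact: fsetSI.
have CB s : s \in C -> s \in B by move=> sC; rewrite inB fsetD1_notin ?Ca.
have aCB s : s \in C -> a |` s \in B by move=> sC; rewrite inB addaK ?Ca.
apply: (absorb sh cY ab).
- by move=> s sC; rewrite Ca ?Cb.
- by apply/negP => /in_verticesP[t]; rewrite inY => /andP[/bF/negP].
- by move=> s sC; rewrite inY (B_F (CB s sC)) (negbTE (Ca sC)).
- move=> s sd; have sC := dC sd; rewrite inY B_F ?aCB //= tB_id ?aCB // addaK ?Ca // sd.
  by rewrite implybT.
- move=> s sC nsd; rewrite inY negb_and; apply/orP; right.
  by rewrite fset1U1 tB_id ?aCB // addaK ?Ca.
- move=> t; split=> [tF|[|tC]]; last 2 first.
  + by rewrite inY => /andP[].
  + by apply: B_F; rewrite inB.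
  rewrite inY tF /=; have [at_|] := boolP (a \in t); last by left.
  have [[tB h]] : (t `&` vertices B \in B) /\ forall l, l \in t -> l \notin vertices B ->
      [/\ l \in U, le1 (t `&` vertices B) l & forall l', l' \in t -> l' \notin vertices B ->
          cmp l l'].
    by case/F_P: tF.
  have [tV|] := boolP (t `<=` vertices B).
    by right; rewrite -inB -[t](fsetIidPl tV).
  case/fsubsetPn=> l lt lB; left; have [/U_P[s sI lE] h1 _] := h l lt lB.
  move: h1; rewrite lE => /(le1_top _ sI)[_ h2]; apply: h2.
  by rewrite in_fsetI at_ aB.
move=> t; split=> [/in_derived[h1 h2 h3]|h].
  have [tV|] := boolP (t `<=` vertices N).
    rewrite (fsetIidPl tV) in h1 h2; move: h1; rewrite inN => /andP[tC td].
    have [at_|at_] := boolP (a \in t); last first.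
      by right; left; rewrite -(fsetD1_notin (v := a) (s := t `\ b)) // in_fsetD1 (negbTE at_)
          andbF.
    have [bt|bt] := boolP (b \in t); first by right; right; apply: (implyP td); rewrite at_ bt.
    right; right; apply/negPn/negP => nd; case/negP: h2; apply/W2P; exists (t `\ a).
      by rewrite nb // in tC nd; rewrite inI tC nd.
    by rewrite fsetD1K.
  case/fsubsetPn=> l lt lN.
  have bt : b \notin t.
    have [[|[_ /W2P[s sI ->] lE] le_ _]] := h3 l lt lN; first by rewrite in_fset0.
    rewrite lE lab2E // le2_top // in le_.
    have bsub := fsubsetP le_ b; apply/negP => bt.
    by have := bW2 sI; rewrite bsub // in_fsetI bt vN eqxx.
  have tE : t `&` vertices N = t `&` vertices B.
    apply/fsetP=> i; rewrite !in_fsetI vN; case: (eqVneq i b) => [->|//].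
    by rewrite (negbTE bt).
  have nN i : i \in t -> (i \in vertices N) = (i \in vertices B).
    by move=> it; rewrite vN; case: eqVneq => // ib; rewrite ib (negbTE bt) in it.
  have tau : (t `&` vertices B) `\ a \in C.
    by move: h1; rewrite inN tE (nb (t := t `&` vertices B)) ?in_fsetI ?(negbTE bt) // => /andP[].
  have ad : a \in t `&` vertices B -> (t `&` vertices B) `\ a \in d.
    move=> at_; apply/negPn/negP => nd; case/negP: h2; rewrite tE; apply/W2P.
    by exists ((t `&` vertices B) `\ a); rewrite ?inI ?tau // fsetD1K.
  left; rewrite inY; apply/andP; split; last first.
    by apply/implyP => at_; apply: ad; rewrite in_fsetI at_ aB.
  apply/F_P; split=> [|l1 l1t]; first by rewrite inB.
  rewrite -(nN l1) // => l1N; have [[l0|[_ /W2P[s sI ->] lE]] le_ h6] := h3 l1 l1t l1N.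
    by rewrite in_fset0 in l0.
  rewrite lab2E // in lE; rewrite lE le2_top // tE in le_; split.
  - by rewrite lE U_top.
  - by rewrite lE; apply/le1_top => //; rewrite fsubDset.
  by move=> l' l't; rewrite -(nN l') // => l'N; exact: h6.
case: h => [|h].
  rewrite inY => /andP[tF tad]; have bt := bF tF; have [tB h] := (F_P t).1 tF.
  have tE : t `&` vertices N = t `&` vertices B.
    apply/fsetP=> i; rewrite !in_fsetI vN; case: (eqVneq i b) => [->|//].
    by rewrite (negbTE bt).
  have nN i : i \in t -> (i \in vertices N) = (i \in vertices B).
    by move=> it; rewrite vN; case: eqVneq => // ib; rewrite ib (negbTE bt) in it.
  have bI : b \notin t `&` vertices B by rewrite in_fsetI (negbTE bt).
  apply/in_derived; rewrite tE; split.
  - by rewrite inN nb // (negbTE bI) andbF andbT -inB.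
  - apply/negP => /W2P[s sI E]; have at_ : a \in t `&` vertices B by rewrite E fset1U1.
    have at' : a \in t by move: at_; rewrite in_fsetI => /andP[].
    by have := Id sI; have := implyP tad at'; rewrite E addaK ?Ca ?IC // => ->.
  move=> l lt; rewrite nN // => lB; have [/U_P[s sI lE] h1 h2] := h l lt lB; split.
  - by right; exists (a |` s); [apply/W2P; exists s|rewrite lab2E].
  - by move: h1; rewrite lE => /(le1_top _ sI)[h1 _]; rewrite le2_top // -fsubDset.
  by move=> l' l't; rewrite nN // => l'B; exact: h2.
have [tN tW] : t \in N /\ t \notin W2.
  case: h => h.
    have at_ : a \notin t by have := Ca h; rewrite in_fsetD1 ab.
    split; first by rewrite inN (negbTE at_) andbT; apply: C_closed h (fsubD1set _ _).
    by apply/negP => /W2P[s _ E]; rewrite E fset1U1 in at_.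
  split; first by rewrite inN h dC // implybT.
  apply/negP => /W2P[s sI E]; have := Id sI; rewrite E nb ?bW2 // addaK ?Ca ?IC // in h.
  by rewrite h.
have tE : t `&` vertices N = t.
  by apply/fsetIidPl/fsubsetP=> l lt; apply/in_verticesP; exists t.
apply/in_derived; rewrite tE; split=> // l lt /negP[].
by apply/in_verticesP; exists t.
Qed.

Lemma fresh_folded_sphere : stellar_equiv Q (simplex_bd [fset i in iota 1 5]).
Proof.
rewrite -derived_cone_Q; apply: (stellar_equiv_trans (stellar_equiv_sym derived_cone)).
apply: (stellar_equiv_trans absorb_half); rewrite -/F.
apply: (stellar_equiv_trans (stellar_equiv_sym derived_two_cones)).
rewrite derived_two_cones0; apply: (shell_two_cones sh ab) => [s sC|].
  by rewrite Ca ?Cb.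
by apply/fset0Pn; exists fset0.
Qed.

End FoldedSphere.

(** * Making labels distinct from vertices *)

Section Shift.
Variables (S : simplex_family) (phi : nat -> nat) (a : nat)
  (lab : {fset nat} -> nat) (Q : simplex_family).
Hypothesis fQ : folded_cone S phi a lab Q.

(** Cell labels are codes and may coincide with vertices of [S], with [a], or with the additional
    apex [b]. A shift beyond all of these separates them. *)
Lemma folded_cone_shift m :
  folded_cone S phi a (fun x => m + lab x)%N (relabel (addn m) Q).
Proof.
case: fQ => sS fphi aS labE QP; split=> // [x y xC x0 yC|t].
  by rewrite -(labE x y) //; split=> [/addnI|->].
split=> [/in_relabelP[s /QP[h1 h2] ->]|[h1 h2]].
  split=> [_ /imfsetP[i /= is_ ->]|_ _ /imfsetP[i /= is_ ->] /imfsetP[j /= js ->]].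
    by have [x [xC x0 <-]] := h1 i is_; exists x.
  have [x [y [xC yC x0 xy h]]] := h2 i j is_ js; exists x, y; split=> //.
  by case: h => -[-> ->]; [left|right].
have mt i : i \in t -> (m + (i - m))%N = i.
  by case/h1=> x [_ _ <-]; rewrite addKn.
apply/in_relabelP; exists [fset (i - m)%N | i in t].
  apply/QP; split=> [_ /imfsetP[i /= it ->]|_ _ /imfsetP[i /= it ->] /imfsetP[j /= jt ->]].
    by have [x [xC x0 <-]] := h1 i it; exists x; rewrite addKn.
  have [x [y [xC yC x0 xy h]]] := h2 i j it jt; exists x, y; split=> //.
  by case: h => -[<- <-]; rewrite !addKn; [left|right].
apply/fsetP=> i; apply/idP/imfsetP => [it|[_ /imfsetP[j /= jt ->] ->]].
  by exists (i - m)%N; rewrite /= ?mt //; apply/imfsetP; exists i.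
by rewrite mt.
Qed.

Lemma folded_sphere : locally manifold_link Q -> stellar_equiv Q (simplex_bd [fset i in iota 1
    5]).
Proof.
move=> mQ; pose V := a |` vertices S.
pose b := (\max_(i <- V) i).+1; pose Q' := relabel (addn b.+1) Q.
have Vb i : i \in V -> i < b by move=> iV; rewrite ltnS (@leq_bigmax_seq _ _ xpredT id).
have QQ' : stellar_equiv Q Q'.
  apply: rst_step; apply: StellarRelabel; first exact: (folded_complex fQ).
  by move=> i j _ _; exact: addnI.
have fQ' := folded_cone_shift b.+1.
have mQ' : locally manifold_link Q'.
  exact: (locally_stellar manifold_link_star manifold_link_relabel manifold_link_join QQ').1 mQ.
have cQ' := folded_complex fQ'.
have hQ' : H1 Q' by have := mQ' _ (complex0 cQ'); rewrite cardfs0 link0.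
have HL i : [fset i] \in Q' -> H1 (link Q' [fset i]).
  by move/mQ'; rewrite cardfs1 => -[].
apply: stellar_equiv_trans QQ' _.
have [c [c_phi c_adj]] := global_coloring fQ' HL hQ'.
apply: (fresh_folded_sphere fQ' c_phi c_adj HL (b := b)).
- by rewrite neq_ltn Vb // fset1U1.
- by apply/negP => bS; have := Vb b; rewrite ltnn in_fset1U bS orbT => /(_ isT).
move=> x _ _; rewrite !in_fset1U !negb_or; apply/and3P; split.
- by apply/eqP => E; have := Vb a; rewrite fset1U1 -E => /(_ isT); lia.
- by apply/eqP; lia.
apply/negP => lS; have := Vb (b.+1 + lab x)%N; rewrite in_fset1U lS orbT => /(_ isT); lia.
Qed.

End Shift.

(** By [no_pinching], which rests on the vanishing of the first cohomology, the third clause of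
    [same_cell] is subsumed by the other two. *)
Lemma flat_folded_cone (S : simplex_family) (e : regular_equiv S) (p0 : {perm generators S}) (a
    : nat) :
  surface S -> is_p0 e p0 -> fingroup.normal [set 1; p0]%g (Cox e p0) ->
  a \notin vertices S -> H1 (cone_quotient e a) ->
  folded_cone S (involution e p0) a (cell_label e a) (cone_quotient e a).
Proof.
move=> sS p0P p0N aS hQ; split=> //; first exact: folding_involution.
  move=> x y xC x0 yC; rewrite (cell_label_eq sS p0P p0N) //; split.
    case=> [->|h|[v [w [vS wS vw -> ->]]]]; [by left|by right|].
    case: vw => [->|[_ _ vw]]; first by left.
    case: (no_pinching sS p0P p0N aS hQ vS wS vw) => ->; [by left|right].
    by rewrite -in_vertices ?image_fset1 //; exact: surface_complex.
  by case=> [->|[xS ->]]; [apply: Or31|apply: Or32].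
move=> t; rewrite (cone_quotientP sS p0P p0N); split=> -[h1 h2]; split=> //.
  move=> i j it jt; case: (h2 i j it jt) => -[x [y [xC yC x0 [xi yj xy]]]];
    exists x, y; split=> //; by [left|right].
move=> i j it jt; have [x [y [xC yC x0 xy [[xi yj]|[xi yj]]]]] := h2 i j it jt; [left|right];
  by exists x, y.
Qed.

Theorem theorem5p2 (R : realType) (M : simplex_family) :
  stellar_manifold 3 M ->
  compact (realization (R := R) M) ->
  closed_complex M ->
  connected (realization (R := R) M) ->
  simply_connected R (realization (R := R) M) ->
  flat 3 M ->
  stellar_sphere 3 M.
Proof.
move=> mM _ _ _ scM [S [e [a [sS aS MQ [p0 [p0P _ p0N]]]]]].
have cM : is_complex M by case: mM.
have mlM := manifold_locally mM (simply_connected_H1 cM scM).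
have mQ := (locally_stellar manifold_link_star manifold_link_relabel manifold_link_join MQ).1 mlM.
have cQ : is_complex (cone_quotient e a) by apply/(stellar_equiv_complex MQ).
have hQ : H1 (cone_quotient e a) by have := mQ _ (complex0 cQ); rewrite cardfs0 link0.
have fQ := flat_folded_cone (sphere_surface sS) p0P p0N aS hQ.
exact: stellar_equiv_trans MQ (folded_sphere fQ mQ).
Qed.
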